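(* Let $N\ge2$, $1<p<\infty$, let $\Omega\subsetneq\mathbb{R}^N$ be a domain, and let $(V,W)$ be a $p$-Bessel pair on $(0,R)$ with positive solution $\varphi$, where $R>\frac12D_\infty(\Omega)$, or $R=\infty$ if $D_\infty(\Omega)=\infty$. Let $\tilde V_{M,p},W_{M,p}$ be the spherical means of $(V,W)$, and for $u\in C_0^\infty(\Omega)$ let $$\delta_M(u)=\int_\Omega\tilde V_{M,p}(x)|\nabla u(x)|^p\,dx-\int_\Omega W_{M,p}(x)|u(x)|^p\,dx .$$ If $\varphi$ is increasing, then $\delta_M(u)\ge0$ for all $u\in C_0^\infty(\Omega)$; in particular $$\int_\Omega W_{M,p}(x)|u(x)|^p\,dx\le\int_\Omega\tilde V_{M,p}(x)|\nabla u(x)|^p\,dx .$$ Moreover, for $u\in C_0^\infty(\Omega)$ the remainder has the expression $$\delta_M(u)=2\,\mathcal S_\Omega\!\left[V(\rho_\nu)\left|\frac{\varphi'(\rho_\nu)}{\varphi(\rho_\nu)}\right|^{p-2}\frac{\varphi'(\rho_\nu)}{\varphi(\rho_\nu)}|u|^p\right]+\int_{S^{N-1}}\int_\Omega V(\rho_\nu(x))\,C_p\!\left(\partial_\nu u(x),\ \varphi(\rho_\nu(x))\,\partial_\nu\!\left(\frac{u(x)}{\varphi(\rho_\nu(x))}\right)\right)dx\,d\sigma(\nu).$$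
   Context: For $0<R\le\infty$ and $1<p<\infty$, a pair $(V,W)$ of positive $C^1$ functions on $(0,R)$ is a $p$-Bessel pair on $(0,R)$ if the ODE $(V|y'|^{p-2}y')'+W|y|^{p-2}y=0$ has a positive $C^1$ solution $\varphi$ on $(0,R)$; such a $\varphi$ is called a positive solution of the pair. Convention: if $1<p<2$, $\varphi'$ is assumed to have constant sign on $(0,R)$. For $x,y\in\mathbb{R}^k$, $C_p(x,y)=|x|^p-|x-y|^p-p|x-y|^{p-2}(x-y)\cdot y$. For $\nu\in S^{N-1}$ and $x\in\Omega$, $\rho_\nu(x)=\inf\{|s|: s\in\mathbb{R},\ x+s\nu\notin\Omega\}$ is the distance from $x$ to $\partial\Omega$ along the line through $x$ in the direction $\nu$; $\partial_\nu$ is the directional derivative; $d\sigma$ is the normalized round measure on $S^{N-1}$. The spherical means are $$\tilde V_{M,p}(x)=\int_{S^{N-1}}V(\rho_\nu(x))|\cos(\nu,\vec e)|^p\,d\sigma(\nu),\qquad W_{M,p}(x)=\int_{S^{N-1}}W(\rho_\nu(x))\,d\sigma(\nu),$$ where $\vec e$ is any fixed unit vector in $\mathbb{R}^N$ and $(a,b)$ denotes the angle between $a$ and $b$. For $\nu\in S^{N-1}$ and $x'\in\nu^\perp\cong\mathbb{R}^{N-1}$, $[x',\nu]$ is the family of connected components (open segments, possibly infinite) of the intersection of $\Omega$ with the line $\{x'+s\nu:s\in\mathbb{R}\}$; $D_{x',\nu}\in[0,\infty]$ is the supremum of the lengths of the elements of $[x',\nu]$, and the essential diameter of $\Omega$ is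 $D_\infty(\Omega)=\operatorname{ess\,sup}_{\nu\in S^{N-1}}\operatorname{ess\,sup}_{x'\in\nu^\perp}D_{x',\nu}$. For $\ell\in[x',\nu]$ let $m_\ell$ be the midpoint of $\ell$ if $\ell$ is bounded, and $m_\ell=\infty$ otherwise, with the convention $f(\infty)=0$ for compactly supported $f$. The $\nu$-skeleton is $\Sigma_\nu=\overline{\{m_\ell:\ell\in[x',\nu],x'\in\nu^\perp\}}\cap\Omega$, and $\mu_\nu$ is the Radon measure on $\Sigma_\nu$ with $\int_{\Sigma_\nu}f\,d\mu_\nu=\int_{\nu^\perp}\sum_{\ell\in[x',\nu]}f(m_\ell)\,dx'$ for $f\in C_0(\Omega)$ (continuous with compact support). The spherical skeletal mean is $\mathcal S_\Omega[f]=\int_{S^{N-1}}\int_{\Sigma_\nu}f(m)\,d\mu_\nu(m)\,d\sigma(\nu)$, where the integrand may depend on $\nu$.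
   Formalization: The value of the spherical mean of V depends on the unit vector e in general (e.g. strip 0<x_2<1, p=2, V=1/r, W=r^{-3}, φ=r), so it is assumed that it is the same for every e; the remainder identity is stated when φ is increasing or when neither side is of the form ∞−∞. *)

(* Defs.v *)
From HB Require Import structures.
From mathcomp Require Import all_boot all_order all_algebra.
From mathcomp Require Import all_classical all_reals all_analysis.
From mathcomp Require Import measurable_realfun ess_sup_inf.
Set Implicit Arguments. Unset Strict Implicit. Unset Printing Implicit Defensive.
Import Order.TTheory GRing.Theory Num.Theory numFieldNormedType.Exports.
Local Open Scope classical_set_scope.
Local Open Scope ring_scope.

(* Borel sets of R^n. *)
HB.instance Definition _ (R : realType) (n : nat) :=
  @isMeasurable.Build (sigma_display (@open 'rV[R]_n)) 'rV[R]_n <<s @open 'rV[R]_n >>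
    (@sigma_algebra0 _ setT _) (@sigma_algebraC _ _)
    (@sigma_algebra_bigcup _ setT _).

(* Lebesgue measure on the Borel sets of R^n, by slicing along the first
   coordinate. *)
Fixpoint lebesgue_rV (R : realType) (n : nat) : set 'rV[R]_n -> \bar R :=
  if n is m.+1 then
    fun A => (\int[@lebesgue_measure R]_x
      lebesgue_rV [set v : 'rV[R]_m | A (row_mx (x%:M : 'rV[R]_1) v)])%E
  else fun A => \d_(0 : 'rV[R]_0) A.

Section lebesgue_rV_measure.
Variable R : realType.

Lemma open_measurable_rV n (A : set 'rV[R]_n) : open A -> measurable A.
Proof. exact: sub_sigma_algebra. Qed.

Lemma rV_ballE n (x y : 'rV[R]_n) (e : R) : 0 < e ->
  ball x e y <-> forall i, `|x ord0 i - y ord0 i| < e.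
Proof.
move=> e0; split=> [[_ h] i|h]; first exact: h.
by split=> // i j; rewrite ord1; exact: h.
Qed.

Let rcons1 n (p : R * 'rV[R]_n) : 'rV[R]_n.+1 := row_mx (p.1%:M : 'rV[R]_1) p.2.

Let rcons10 n (p : R * 'rV[R]_n) : @rcons1 n p ord0 ord0 = p.1.
Proof.
rewrite /rcons1 mxE; case: splitP => // j _.
by rewrite (ord1 j) [LHS]mxE eqxx mulr1n.
Qed.

Let rcons1S n (p : R * 'rV[R]_n) i : @rcons1 n p ord0 (lift ord0 i) = p.2 ord0 i.
Proof.
rewrite /rcons1 mxE; case: splitP => j /=; first by rewrite (ord1 j).
by rewrite /bump/= add1n => -[] /val_inj->.
Qed.

Lemma open_rV_bigcup n (U : set 'rV[R]_n) : open U ->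
  exists F : nat -> 'rV[R]_n * R, (forall k, 0 <= (F k).2) /\
    U = \bigcup_k (if 0 < (F k).2 then ball (F k).1 (F k).2 else set0).
Proof.
move=> oU.
pose c (q : 'rV[rat]_n) : 'rV[R]_n := map_mx ratr q.
pose G (k : nat) : 'rV[R]_n * R := if @unpickle ('rV[rat]_n * nat)%type k is Some (q, m)
  then if `[< ball (c q) (m.+1%:R^-1) `<=` U >] then (c q, m.+1%:R^-1) else (0, 0)
  else (0, 0).
exists G; split.
  move=> k; rewrite /G; case: unpickle => [[q m]|//]; case: ifP => //= _.
apply/seteqP; split => [y Uy|y [k _]]; last first.
  rewrite /G; case: unpickle => [[q m]|]; last by rewrite ltxx.
  case: asboolP => [h|_]; last by rewrite ltxx.
  by case: ifP => // _; exact: h.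
have /nbhs_ballP[e /= e0 eU] : nbhs y U by exact: open_nbhs_nbhs.
pose m := Num.trunc (2 / e).
have mP : m.+1%:R^-1 < e / 2.
  rewrite -[ltRHS]invrK ltf_pV2 ?posrE ?invr_gt0 ?divr_gt0//.
  by rewrite invf_div truncnS_gt.
have m0 : 0 < (m.+1%:R^-1 : R) by rewrite invr_gt0 ltr0n.
have qP i : exists q : rat, `|ratr q - y ord0 i| < m.+1%:R^-1.
  have [q] : exists q : rat,
      ratr q \in `](y ord0 i - m.+1%:R^-1), (y ord0 i + m.+1%:R^-1)[.
    by apply: rat_in_itvoo; rewrite ltrD2l gtrN.
  rewrite in_itv/= => /andP[a b]; exists q.
  by rewrite ltr_norml ltrBrDl a ltrBlDl b.
pose q : 'rV[rat]_n := \row_i xchoose (qP i).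
exists (pickle (q, m)) => //; rewrite /G pickleK.
have bq : ball (c q) m.+1%:R^-1 y.
  by apply/(rV_ballE _ _ m0) => i; rewrite !mxE; exact: (xchooseP (qP i)).
rewrite asboolT /=; first by rewrite m0.
move=> z zq; apply: eU.
apply: (@le_ball _ _ _ (m.+1%:R^-1 + m.+1%:R^-1)).
  by rewrite [leRHS](splitr e) lerD// ltW.
by apply: ball_triangle zq; exact: ball_sym.
Qed.

Lemma measurable_rcons n : measurable_fun (setT : set (measurableTypeR R * 'rV[R]_n)) (@rcons1 n).
Proof.
apply: (@measurability _ _ _ _ _ _ (@open 'rV[R]_n.+1)) => // _ [U oU <-].
have [F [F0 ->]] := open_rV_bigcup oU.
rewrite setTI preimage_bigcup; apply: bigcup_measurable => k _.
case: ifPn => [Fk|_]; last by rewrite preimage_set0.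
rewrite (_ : _ @^-1` _ = ball ((F k).1 ord0 ord0) (F k).2 `*`
   ball (\row_i (F k).1 ord0 (lift ord0 i)) (F k).2); last first.
  apply/seteqP; split => [[x v]|[x v]].
    move=> /(rV_ballE _ _ Fk) h; split => /=.
      by have := h ord0; rewrite rcons10.
    by apply/(rV_ballE _ _ Fk) => i; have := h (lift ord0 i); rewrite rcons1S mxE.
  move=> [/= h0 /(rV_ballE _ _ Fk) h]; apply/(rV_ballE _ _ Fk) => i.
  case: (unliftP ord0 i) => [j ->|->]; last by rewrite rcons10.
  by rewrite rcons1S; have := h j; rewrite mxE.
apply: measurableX; last by apply: open_measurable_rV; exact: ball_open.
by apply: open_measurable; exact: ball_open.
Qed.

Let cube n (k : nat) := [set v : 'rV[R]_n | forall i, `|v ord0 i| <= k%:R].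

Arguments cube : clear implicits.
Lemma measurable_cube (n k : nat) : measurable (cube n k).
Proof.
rewrite -[cube n k]setCK; apply: measurableC; apply: open_measurable_rV.
apply: closed_openC.
rewrite (_ : cube n k = \bigcap_(i in setT) [set v | `|v ord0 i| <= k%:R]); last first.
  apply/seteqP; split => v; first by move=> h i _; exact: (h i).
  by move=> h i; exact: (h i I).
apply: closed_bigI => i _.
apply: (@closed_comp _ _ (fun v : 'rV[R]_n => `|v ord0 i|) [set x : R | x <= k%:R]).
  move=> v _; apply: continuous_comp; first exact: coord_continuous.
  exact: norm_continuous.
exact: closed_le.
Qed.


Let sfinite n (m : {measure set 'rV[R]_n -> \bar R}) :
  (forall k, (m (cube n k) < +oo)%E) -> sigma_finite setT m.
Proof.
move=> mf.
exists (cube n); last by move=> k; split; [exact: measurable_cube|exact: mf].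
apply/seteqP; split => // v _.
exists (Num.trunc (\sum_i `|v ord0 i|)).+1 => // i.
apply: le_trans (ltW (truncnS_gt _)).
by rewrite (bigD1 i)//= lerDl sumr_ge0.
Qed.


Section step.
Variables (n : nat) (m : {measure set 'rV[R]_n -> \bar R}).
Hypothesis mf : forall k, (m (cube n k) < +oo)%E.

Let m' : set 'rV[R]_n -> \bar R := m.
HB.instance Definition _ := Measure.on m'.
HB.instance Definition _ := @Measure_isSigmaFinite.Build _ _ _ m' (sfinite mf).

Let L := product_measure1 (@lebesgue_measure R) m'.

Lemma lebesgue_rV_step : exists2 P : {measure set 'rV[R]_n.+1 -> \bar R},
  (fun A => \int[@lebesgue_measure R]_x
     m [set v : 'rV[R]_n | A (row_mx (x%:M : 'rV[R]_1) v)])%E = P &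
  forall k, (P (cube n.+1 k) < +oo)%E.
Proof.
pose P' := [the measure _ _ of pushforward L (@rcons1 n)].
pose P := P' (@measurable_rcons n).
exists P.
  apply/funext => A; rewrite /P/= /pushforward /L /product_measure1 /=.
  apply: eq_integral => x _; congr (m _).
  by apply/seteqP; split => v; rewrite /xsection/= inE.
move=> k; rewrite /P/= /pushforward.
rewrite (_ : _ @^-1` _ = [set x : R | `|x| <= k%:R] `*` cube n k); last first.
  apply/seteqP; split => [[x v]|[x v]].
    move=> /= h; split => [|i] /=; first by have := h ord0; rewrite rcons10.
    by have := h (lift ord0 i); rewrite rcons1S.
  move=> [/= h0 h] i.
  case: (unliftP ord0 i) => [j ->|->]; last by rewrite rcons10.
  by rewrite rcons1S; exact: h.
have -> : [set x : R | `|x| <= k%:R] = `[- k%:R, k%:R]%classic.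
  by apply/seteqP; split => x /=; rewrite in_itv/= ler_norml.
rewrite /L product_measure1E//; last exact: measurable_cube.
apply: lte_mul_pinfty => //; last exact: mf.
have E := @lebesgue_measure_itv R `[- k%:R, k%:R].
by apply: (@eq_ind_r _ _ (fun z => z \is a fin_num) _ _ E); case: ifP.
Qed.

End step.

Lemma lebesgue_rV_spec n : exists2 m : {measure set 'rV[R]_n -> \bar R},
  @lebesgue_rV R n = m & forall k, (m (cube n k) < +oo)%E.
Proof.
elim: n => [|n [m mE mf]].
  exists (\d_(0 : 'rV[R]_0)) => // k.
  by rewrite /= diracE; case: (_ \in _); rewrite ltry.
by rewrite /= mE; exact: lebesgue_rV_step.
Qed.

Variable n : nat.
Let lebesgue_rV0 : lebesgue_rV (set0 : set 'rV[R]_n) = 0%E.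
Proof. by have [m -> _] := lebesgue_rV_spec n; rewrite measure0. Qed.

Let lebesgue_rV_ge0 (A : set 'rV[R]_n) : (0 <= lebesgue_rV A)%E.
Proof. by have [m -> _] := lebesgue_rV_spec n; exact: measure_ge0. Qed.

Let lebesgue_rV_sigma_additive : semi_sigma_additive (@lebesgue_rV R n).
Proof.
by have [m -> _] := lebesgue_rV_spec n; exact: measure_semi_sigma_additive.
Qed.

Let lebesgue_rV_sigma_finite : sigma_finite setT (@lebesgue_rV R n).
Proof. by have [m -> mf] := lebesgue_rV_spec n; exact: sfinite mf. Qed.

HB.instance Definition _ := isMeasure.Build _ _ _ (@lebesgue_rV R n)
  lebesgue_rV0 lebesgue_rV_ge0 lebesgue_rV_sigma_additive.
HB.instance Definition _ := @Measure_isSigmaFinite.Build _ _ _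
  (@lebesgue_rV R n) lebesgue_rV_sigma_finite.

End lebesgue_rV_measure.

Section euclidean.
Context {R : realType} {n : nat}.
Implicit Types x y nu : 'rV[R]_n.

Definition edot x y : R := \sum_(i < n) x ord0 i * y ord0 i.

(* The library norm on ['rV[R]_n] is the sup norm. *)
Definition enorm x : R := Num.sqrt (edot x x).

Definition cos_angle x y : R := edot x y / (enorm x * enorm y).

Definition unit_sphere : set 'rV[R]_n := [set x | enorm x = 1].

Definition unit_ball : set 'rV[R]_n := [set x | enorm x < 1].

Definition direction x : 'rV[R]_n := (enorm x)^-1 *: x.

Definition hyperplane nu : set 'rV[R]_n := [set x | edot x nu = 0].

Definition proj_hyperplane nu x : 'rV[R]_n := x - edot x nu *: nu.

Lemma edot_continuous (T : topologicalType) (f g : T -> 'rV[R]_n) t :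
  {for t, continuous f} -> {for t, continuous g} ->
  {for t, continuous (fun u => edot (f u) (g u))}.
Proof.
move=> cf cg; apply: cvg_big => [|i _]; first exact: add_continuous.
by apply: cvgM; apply: (@continuous_comp _ _ _ _ (fun v : 'rV[R]_n => v ord0 i));
  [exact: cf|exact: coord_continuous|exact: cg|exact: coord_continuous].
Qed.

Lemma enorm_continuous : continuous enorm.
Proof.
move=> x; apply: (@continuous_comp _ _ _ (fun x => edot x x) Num.sqrt).
  by apply: (@edot_continuous _ id id); exact: cvg_id.
exact: sqrt_continuous.
Qed.

Lemma continuous_measurable_rV (f : 'rV[R]_n -> 'rV[R]_n) :
  continuous f -> measurable_fun setT f.
Proof.
move=> cf; apply: (@measurability _ _ _ _ _ _ (@open 'rV[R]_n)) => // _ [U oU <-].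
rewrite setTI; apply: open_measurable_rV; by apply: open_comp => // x _; exact: cf.
Qed.

Lemma measurable_proj_hyperplane nu : measurable_fun setT (proj_hyperplane nu).
Proof.
apply: continuous_measurable_rV => x.
apply: (@cvgB _ _ _ (nbhs x) _ id (fun y => edot y nu *: nu)); first exact: cvg_id.
apply: (@cvgZr_tmp _ _ _ (nbhs x)); apply: (@edot_continuous _ id (fun=> nu)).
  exact: cvg_id.
exact: cst_continuous.
Qed.

Lemma measurable_direction : measurable_fun setT direction.
Proof.
have o0 : open [set x | enorm x != 0].
  rewrite (_ : [set x | _] = enorm @^-1` [set y | y != 0])//.
  apply: open_comp; last exact: open_neq.
  by move=> x _; exact: enorm_continuous.
apply: (@measurability _ _ _ _ _ _ (@open 'rV[R]_n)) => // _ [U oU <-].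
have oW : open (direction @^-1` U `&` [set x | enorm x != 0] : set 'rV[R]_n).
  rewrite openE => x [Ux x0].
  have cd : {for x, continuous direction}.
    apply: (@cvgZ _ _ _ (nbhs x)); last exact: cvg_id.
    by apply: cvgV => //; exact: enorm_continuous.
  apply: filterI; last exact: open_nbhs_nbhs.
  by apply: cd; exact: open_nbhs_nbhs.
rewrite setTI -(setIT (_ @^-1` _)) -(setUv [set x | enorm x != 0]) setIUr.
apply: measurableU; first exact: open_measurable_rV.
have mC : measurable (~` [set x | enorm x != 0]).
  by apply: measurableC; exact: open_measurable_rV.
have [U0|U0] := pselect (U 0).
  rewrite (_ : _ `&` _ = ~` [set x | enorm x != 0])//; apply/seteqP; split.
    by move=> x [].
  by move=> x /= /negP; rewrite negbK => x0; split;
    [rewrite /direction/= (eqP x0) invr0 scale0r|rewrite (eqP x0) eqxx].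
rewrite (_ : _ `&` _ = set0)// -subset0 => x [/= Ux /negP]; rewrite negbK => /eqP x0.
by apply: U0; move: Ux; rewrite /direction x0 invr0 scale0r.
Qed.

Lemma measurable_unit_ball : measurable unit_ball.
Proof.
apply: open_measurable_rV; apply: (@open_comp _ _ enorm [set y | y < 1]).
  by move=> x _; exact: enorm_continuous.
exact: open_lt.
Qed.

Lemma measurable_slab nu : measurable [set x | 0 <= edot x nu <= 1].
Proof.
rewrite (_ : [set x | _] = (edot ^~ nu) @^-1` `[0, 1]%classic); last first.
  by apply/seteqP; split => x /=; rewrite in_itv.
rewrite -[_ @^-1` _]setCK; apply: measurableC; apply: open_measurable_rV.
apply: closed_openC; apply: closed_comp; last exact: interval_closed.
by move=> x _; apply: (@edot_continuous _ id (fun=> nu)); [exact: cvg_id|exact: cst_continuous].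
Qed.

(* Normalized surface measure of the unit sphere, as the cone measure:
   sigma(A) = |{x in B : x/|x| in A}| / |B|, with B the unit ball. *)
Definition sphere_measure : set 'rV[R]_n -> \bar R := fun A =>
  ((fine (lebesgue_rV unit_ball))^-1%:E *
    lebesgue_rV ((direction @^-1` A) `&` unit_ball))%E.

(* (n-1)-dimensional Lebesgue measure of the hyperplane orthogonal to a unit
   vector nu: the n-dimensional volume of the cylinder of height 1 over A. *)
Definition hyperplane_measure nu : set 'rV[R]_n -> \bar R := fun A =>
  lebesgue_rV ((proj_hyperplane nu @^-1` A) `&` [set x | 0 <= edot x nu <= 1]).

Let c_ge0 : 0 <= (fine (lebesgue_rV unit_ball))^-1.
Proof. by rewrite invr_ge0 fine_ge0// measure_ge0. Qed.

Let sphere_spec : exists m : {measure set 'rV[R]_n -> \bar R}, sphere_measure = m.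
Proof.
pose m1 := [the measure _ _ of mrestr (@lebesgue_rV R n) measurable_unit_ball].
pose m2 := [the measure _ _ of pushforward m1 direction].
pose m3 := [the measure _ _ of mscale (NngNum c_ge0) (m2 measurable_direction)].
by exists m3.
Qed.

Let hyperplane_spec nu :
  exists m : {measure set 'rV[R]_n -> \bar R}, hyperplane_measure nu = m.
Proof.
pose m1 := [the measure _ _ of mrestr (@lebesgue_rV R n) (measurable_slab nu)].
pose m2 := [the measure _ _ of pushforward m1 (proj_hyperplane nu)].
by exists (m2 (measurable_proj_hyperplane nu)).
Qed.

Let sphere0 : sphere_measure set0 = 0%E.
Proof. by have [m ->] := sphere_spec; exact: measure0. Qed.
Let sphere_ge0 A : (0 <= sphere_measure A)%E.
Proof. by have [m ->] := sphere_spec; exact: measure_ge0. Qed.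
Let sphere_sigma_additive : semi_sigma_additive sphere_measure.
Proof. by have [m ->] := sphere_spec; exact: measure_semi_sigma_additive. Qed.

HB.instance Definition _ := isMeasure.Build _ _ _ sphere_measure
  sphere0 sphere_ge0 sphere_sigma_additive.

Let hyperplane0 nu : hyperplane_measure nu set0 = 0%E.
Proof. by have [m ->] := hyperplane_spec nu; exact: measure0. Qed.
Let hyperplane_ge0 nu A : (0 <= hyperplane_measure nu A)%E.
Proof. by have [m ->] := hyperplane_spec nu; exact: measure_ge0. Qed.
Let hyperplane_sigma_additive nu : semi_sigma_additive (hyperplane_measure nu).
Proof. by have [m ->] := hyperplane_spec nu; exact: measure_semi_sigma_additive. Qed.

HB.instance Definition _ nu := isMeasure.Build _ _ _ (hyperplane_measure nu)
  (hyperplane0 nu) (hyperplane_ge0 nu) (@hyperplane_sigma_additive nu).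

End euclidean.

Section test_functions.
Context {R : realType} {n : nat}.
Implicit Types (Omega : set 'rV[R]_n) (u : 'rV[R]_n -> R).

Definition partial (i : 'I_n) u : 'rV[R]_n -> R :=
  fun x => 'D_(delta_mx ord0 i) u x.

Fixpoint Ck (k : nat) u : Prop :=
  continuous u /\
  (if k is k'.+1 then forall i : 'I_n,
     (forall x, derivable u x (delta_mx ord0 i)) /\ Ck k' (partial i u)
   else True).

Definition smooth u := forall k, Ck k u.

Definition gradient u (x : 'rV[R]_n) : 'rV[R]_n := \row_i partial i u x.

Definition compactly_supported Omega u :=
  let S := closure [set x | u x != 0] in compact S /\ S `<=` Omega.

Definition test_function Omega u := smooth u /\ compactly_supported Omega u.

Definition domain Omega := [/\ open Omega, connected Omega & Omega !=set0].

End test_functions.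

Section bessel_pairs.
Context {R : realType}.
Implicit Types (p r : R) (rad : \bar R) (V W phi : R -> R).

Definition in_interval rad r := 0 < r /\ (r%:E < rad)%E.

Definition C1_on rad (f : R -> R) := forall r, in_interval rad r ->
  derivable f r 1 /\ {for r, continuous (derive1 f)}.

(* |t|^(p-2) t, equal to 0 at t = 0 also when p < 2 *)
Definition spow p (t : R) : R := `|t| `^ (p - 2) * t.

Definition positive_solution p rad V W phi :=
  [/\ forall r, in_interval rad r -> 0 < phi r,
      C1_on rad phi,
      forall r, in_interval rad r ->
        is_derive r 1 (fun s => V s * spow p (derive1 phi s)) (- (W r * spow p (phi r))) &
      p < 2 -> (forall r, in_interval rad r -> 0 <= derive1 phi r) \/
               (forall r, in_interval rad r -> derive1 phi r <= 0)].

Definition bessel_pair p rad V W :=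
  [/\ forall r, in_interval rad r -> 0 < V r /\ 0 < W r,
      C1_on rad V, C1_on rad W & exists phi, positive_solution p rad V W phi].

(* The vectors are real numbers here: [C_p] is only applied to directional
   derivatives of real-valued functions. *)
Definition Cp p (x y : R) : R :=
  `|x| `^ p - `|x - y| `^ p - p * `|x - y| `^ (p - 2) * ((x - y) * y).

Definition at_ext T (f : R -> T) (c : T) (r : \bar R) : T :=
  if r is t%:E then f t else c.

(* The distance to the boundary along a line is +oo exactly when the line does
   not leave the domain; V and W are then given their limit at +oo (upper,
   resp. lower, limit should it not exist), while phi is treated as constant,
   its value being immaterial in [phi * D_nu (u / phi)]. *)
Definition V_at V : \bar R -> \bar R :=
  at_ext (EFin \o V) (limf_esup (EFin \o V) (pinfty_nbhs R)).
Definition W_at W : \bar R -> \bar R :=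
  at_ext (EFin \o W) (limf_einf (EFin \o W) (pinfty_nbhs R)).
Definition phi_at phi : \bar R -> R := at_ext phi 1.
Definition dphi_at phi : \bar R -> R := at_ext (derive1 phi) 0.

End bessel_pairs.

Section geometry.
Context {R : realType} {n : nat}.
Variable Omega : set 'rV[R]_n.
Implicit Types (nu x : 'rV[R]_n) (I : set R).

Definition rho nu x : \bar R :=
  ereal_inf [set `|s|%:E | s in [set s : R | ~ Omega (x + s *: nu)]].

(* A segment {x + s nu | s in I} of the line through x directed by the unit
   vector nu is represented by the parameter set I. *)
Definition chord nu x : set R := [set s | Omega (x + s *: nu)].

Definition segments nu x : set (set R) :=
  [set connected_component (chord nu x) s | s in chord nu x].

Definition seg_length I : \bar R :=
  (ereal_sup (EFin @` I) - ereal_inf (EFin @` I))%E.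

Definition max_length nu x : \bar R :=
  ereal_sup (0%E |` [set seg_length I | I in segments nu x]).

Definition essential_diameter : \bar R :=
  ess_sup sphere_measure (fun nu => ess_sup (hyperplane_measure nu) (max_length nu)).

Definition bounded_segments nu x : set (set R) :=
  [set I | segments nu x I /\ bounded_set I].

Definition midpoint nu x I : 'rV[R]_n := x + ((inf I + sup I) / 2) *: nu.

Definition skeleton nu : set 'rV[R]_n :=
  closure [set m | exists x I,
    [/\ hyperplane nu x, bounded_segments nu x I & m = midpoint nu x I]] `&` Omega.

(* The Radon measure on the skeleton determined by its values on continuous
   functions with compact support in Omega; as a Borel measure on R^n it is
   carried by the skeleton. *)
Definition skeletal_measure nu (mu : {measure set 'rV[R]_n -> \bar R}) :=
  [/\ mu (~` skeleton nu) = 0%E,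
      forall K, compact K -> K `<=` Omega -> (mu K < +oo)%E &
      forall f : 'rV[R]_n -> R, continuous f -> compactly_supported Omega f ->
        (\int[mu]_(m in skeleton nu) (f m)%:E =
         \int[hyperplane_measure nu]_(x in hyperplane nu)
           (\sum_(I \in bounded_segments nu x) f (midpoint nu x I))%:E)%E].

Definition skeletal_mean (mu : 'rV[R]_n -> {measure set 'rV[R]_n -> \bar R})
    (f : 'rV[R]_n -> 'rV[R]_n -> \bar R) : \bar R :=
  (\int[sphere_measure]_(nu in unit_sphere) \int[mu nu]_(m in skeleton nu) f nu m)%E.

Definition V_mean (p : R) (V : R -> R) (e x : 'rV[R]_n) : \bar R :=
  (\int[sphere_measure]_(nu in unit_sphere)
     (V_at V (rho nu x) * (`|cos_angle nu e| `^ p)%:E))%E.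

Definition W_mean (W : R -> R) (x : 'rV[R]_n) : \bar R :=
  (\int[sphere_measure]_(nu in unit_sphere) W_at W (rho nu x))%E.

(* [VM] is the spherical mean of V, computed with any fixed unit vector e: this
   presupposes that the value of [V_mean] at x does not depend on e. *)
Definition is_V_mean (p : R) (V : R -> R) (VM : 'rV[R]_n -> \bar R) :=
  forall e, unit_sphere e -> forall x, Omega x -> VM x = V_mean p V e x.

Definition gradient_energy (p : R) (VM : 'rV[R]_n -> \bar R) (u : 'rV[R]_n -> R) :=
  (\int[@lebesgue_rV R n]_(x in Omega) (VM x * (enorm (gradient u x) `^ p)%:E))%E.

Definition potential_energy (p : R) (W : R -> R) (u : 'rV[R]_n -> R) :=
  (\int[@lebesgue_rV R n]_(x in Omega) (W_mean W x * (`|u x| `^ p)%:E))%E.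

Definition delta_M (p : R) (VM : 'rV[R]_n -> \bar R) (W : R -> R)
    (u : 'rV[R]_n -> R) : \bar R :=
  (gradient_energy p VM u - potential_energy p W u)%E.

Definition skeletal_term (p : R) (V phi : R -> R) (u : 'rV[R]_n -> R)
    (mu : 'rV[R]_n -> {measure set 'rV[R]_n -> \bar R}) : \bar R :=
  (2%:E * skeletal_mean mu (fun nu m =>
     V_at V (rho nu m) *
     (spow p (dphi_at phi (rho nu m) / phi_at phi (rho nu m)) * `|u m| `^ p)%:E))%E.

Definition Cp_term (p : R) (V phi : R -> R) (u : 'rV[R]_n -> R) : \bar R :=
  (\int[sphere_measure]_(nu in unit_sphere) \int[@lebesgue_rV R n]_(x in Omega)
     (V_at V (rho nu x) *
      (Cp p ('D_nu u x)
        (phi_at phi (rho nu x) * 'D_nu (fun y => u y / phi_at phi (rho nu y)) x))%:E))%E.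

End geometry.

(* Main.v *)
(** On a line of direction [nu], let [rho] be the distance to the nearer endpoint
    of the component containing the point. On each half of a bounded component
    [rho] is affine, and Picone's identity differentiates
    [V(rho) |phi'|^(p-2) phi' phi^(1-p) |u|^p]; the boundary terms vanish by
    compactness of the support of [u], except at the midpoint, where the two
    halves contribute equally. This gives the one-dimensional formula on every
    component; on a full line [rho = +oo] is constant and there is no boundary
    term. Integrating over the component, then over [nu^perp] and over [nu],
    gives the formula: the mean of [V] is computed at each [x] with [e] the
    direction of [grad u], and the skeletal measure is identified, by testing on
    bump functions, with the image under the midpoint map of [dx / L], [L] being
    the length of the component through [x]. Chords longer than the essential
    diameter form a null set.

    Because the energies are extended reals, the identity is first proved
    without subtraction, as [G + 2 S^- = P + 2 S^+ + C], where [S^+] and [S^-]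
    are the skeletal means of the positive and negative parts. If [phi] is
    increasing then [S^- = 0] and the potential energy [P] is finite, because
    the flux [V |phi'|^(p-2) phi'] is nonincreasing and bounds the integral of
    [W] along segments. If [phi] is not increasing then the flux is eventually
    negative, so that [S^+] is finite. *)

Require Import Defs.
From HB Require Import structures.
From mathcomp Require Import all_boot all_order all_algebra finmap.
From mathcomp Require Import all_classical all_reals all_analysis.
From mathcomp Require Import measurable_realfun ess_sup_inf ring lra.
Set Implicit Arguments. Unset Strict Implicit. Unset Printing Implicit Defensive.
Import Order.TTheory GRing.Theory Num.Theory numFieldNormedType.Exports.
Local Open Scope classical_set_scope.
Local Open Scope ring_scope.

(** * Integration on product and Euclidean spaces *)

(** [V] and [W] are arbitrary outside [(0, rad)], so the integrands of the statement need not be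
    Borel. Each is replaced by a Borel density on pairs (direction, point), masked by a set of good
    pairs: a threshold [d] is fixed between half the essential diameter and [rad], and every line on
    which [rho] exceeds [d] somewhere is discarded. The mask is invariant along lines, so
    one-dimensional identities survive it, and the integrals of the statement are compared with the
    masked ones off null sets, without measurability.

    Lines contained in [Omega] are the second obstacle. There the identity only equates the gradient
    and [C_p] terms, while [W] at infinity would enter the potential energy without compensation.
    The Bessel pair settles this: if [phi] increases, the lower limit of [W] is 0; if not, the upper
    limit of [V] is [+oo], and then either [u] vanishes on almost all such lines or the gradient and
    [C_p] integrals are both [+oo].

    No coordinates adapted to a direction are chosen: integrals over [nu^perp] are integrals over a
    slab of height 1. *)

Section ae_integral.
Context d (T : measurableType d) (R : realType).
Variable m : {measure set T -> \bar R}.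
Import HBNNSimple.
Local Open Scope ereal_scope.

(** Since [f] is not assumed measurable, its integral is handled as a supremum over simple
    minorants: multiplying one of them by the indicator of the complement of [N] does not change its
    integral. *)
Lemma ge0_integral_null_set (D N : set T) (f : T -> \bar R) :
  measurable N -> m N = 0 -> (forall x, D x -> 0 <= f x) ->
  \int[m]_(x in D) f x = \int[m]_(x in D) (f \_ (~` N)) x.
Proof.
move=> mN N0 f0.
have f0' x : D x -> 0 <= (f \_ (~` N)) x.
  by move=> Dx; rewrite /patch; case: ifP => // _; exact: f0.
rewrite !ge0_integralE//; apply/eqP; rewrite eq_le; apply/andP; split.
  apply: ge_ereal_sup => _ [h hf <-].
  apply: ereal_sup_ubound.
  pose k := mul_nnsfun h (indic_nnsfun R (measurableC mN)).
  exists k => [x|].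
    have := hf x; rewrite /k /= /patch; case: ifPn => xD.
      rewrite mindicE in_setC; by case: (x \in N) => /=; rewrite ?mulr0 ?mulr1.
    move=> h0; apply: le_trans h0; rewrite lee_fin mindicE.
    by case: (x \in ~` N); rewrite ?mulr1 ?mulr0//; exact: fun_ge0.
  rewrite -!integralT_nnsfun; apply: ae_eq_integral => //.
  - exact/measurable_EFinP/measurable_funP.
  - exact/measurable_EFinP/measurable_funP.
  - exists N; split => // x /= /not_implyP[_ H]; apply: contrapT => Nx; apply: H.
    by rewrite /k /= mindicE mem_set//= mulr1.
apply: le_ereal_sup => _ [h hf <-]; exists h => // x.
apply: le_trans (hf x) _; rewrite /patch; case: ifPn => // xD.
by case: ifPn => // _; apply: f0; rewrite inE in xD.
Qed.

(* No measurability is required: [V] and [W] are arbitrary outside the interval. *)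
Lemma eq_integral_null_set (D N : set T) (f g : T -> \bar R) :
  measurable N -> m N = 0 -> (forall x, D x -> ~ N x -> f x = g x) ->
  \int[m]_(x in D) f x = \int[m]_(x in D) g x.
Proof.
move=> mN N0 fg.
rewrite integralE [RHS]integralE.
rewrite (ge0_integral_null_set mN N0)// (ge0_integral_null_set (f := f^\-) mN N0)//.
rewrite (ge0_integral_null_set (f := g^\+) mN N0)//.
rewrite (ge0_integral_null_set (f := g^\-) mN N0)//.
congr (_ - _); apply: eq_integral => x; rewrite inE => Dx; rewrite /patch;
  case: ifPn => //; rewrite inE => Nx; by rewrite ?funeposE ?funenegE fg.
Qed.

(* [g] may take the value [+oo] and need not be integrable. *)
Lemma integralB_ge0 (f g : T -> \bar R) :
  measurable_fun setT f -> measurable_fun setT g ->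
  (forall x, 0 <= f x) -> (forall x, f x \is a fin_num) -> (forall x, 0 <= g x) ->
  \int[m]_x f x < +oo ->
  \int[m]_x (f x - g x) = \int[m]_x f x - \int[m]_x g x.
Proof.
move=> mf mg f0 ffin g0 foo.
have fF : \int[m]_x f x \is a fin_num by rewrite ge0_fin_numE// integral_ge0.
have intf : m.-integrable setT f.
  apply/integrableP; split => //.
  by under eq_integral do rewrite gee0_abs//.
have [goo|] := ltP (\int[m]_x g x) +oo.
  rewrite integralB//; apply/integrableP; split => //.
  by under eq_integral do rewrite gee0_abs//.
rewrite leye_eq => /eqP goo; rewrite goo addeNy.
rewrite integralE.
have mfg : measurable_fun setT (fun x => f x - g x).
  by apply: emeasurable_funB.
suff -> : \int[m]_x ((fun x => f x - g x)^\- x) = +oo.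
  have p_fin : \int[m]_x ((fun x => f x - g x)^\+ x) <= \int[m]_x f x.
    apply: ge0_le_integral => //.
      exact: measurable_funepos.
    move=> x _; rewrite funeposE ge_max f0 andbT.
    by rewrite -[leRHS]adde0; apply: leeD => //; rewrite oppe_le0.
  have : \int[m]_x ((fun x => f x - g x)^\+ x) < +oo by exact: le_lt_trans foo.
  by case: (\int[m]_x _) => //.
apply/eqP; rewrite -leye_eq leNgt; apply/negP => H.
suff : \int[m]_x g x < +oo by rewrite goo.
(* Pointwise [g <= f + (f - g)^-], so a finite integral of the negative part would make the integral
   of [g] finite. *)
apply: (@le_lt_trans _ _ (\int[m]_x (f x + (fun x => f x - g x)^\- x))).
  apply: ge0_le_integral => //.
    apply: emeasurable_funD => //; exact: measurable_funeneg.
  move=> x _; rewrite funenegE.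
  apply: (@le_trans _ _ (f x + (- (f x - g x)))); last by rewrite leeD// le_max lexx.
  have := ffin x; case: (f x) => //= r _.
  have := g0 x; case: (g x) => //= s _.
  by rewrite lee_fin opprB addrCA subrr addr0.
rewrite ge0_integralD//; last exact: measurable_funeneg.
by rewrite lte_add_pinfty.
Qed.

End ae_integral.

Section borel_rV.
Context {R : realType}.

(** Balls of the sup norm are boxes, and an open set is a countable union of balls
    ([open_rV_bigcup]), so its preimage is built from the coordinates. *)
Lemma measurable_fun_rV d (T : measurableType d) n (f : T -> 'rV[R]_n) :
  (forall i, measurable_fun setT (fun x => f x ord0 i)) -> measurable_fun setT f.
Proof.
move=> mf; apply: (@measurability _ _ _ _ _ _ (@open 'rV[R]_n)) => // _ [U oU <-].
have [F [F0 ->]] := open_rV_bigcup oU.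
rewrite setTI preimage_bigcup; apply: bigcup_measurable => k _.
case: ifPn => [Fk|_]; last by rewrite preimage_set0.
rewrite (_ : _ @^-1` _ =
  \bigcap_(i in [set: 'I_n]) ((fun x => f x ord0 i) @^-1` ball ((F k).1 ord0 i) (F k).2)).
  apply: fin_bigcap_measurable => [|i _]; first exact: finite_finset.
  rewrite -[X in measurable X]setTI.
  by apply: mf => //; exact: measurable_ball.
apply/seteqP; split => x /=.
  by move=> /(rV_ballE _ _ Fk) h i _; exact: h.
by move=> h; apply/(rV_ballE _ _ Fk) => i; exact: h.
Qed.

Lemma continuous_measurable_rVR n (f : 'rV[R]_n -> R) : continuous f -> measurable_fun setT f.
Proof.
move=> cf; apply: (measurability _ (RGenOInfty.measurableE R)).
move=> _ [_ [a ->] <-]; rewrite setTI; apply: open_measurable_rV.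
by apply: open_comp => [x _|]; [exact: cf|exact: interval_open].
Qed.

Lemma edot_ge0 n (x : 'rV[R]_n) : 0 <= edot x x.
Proof. by apply: sumr_ge0 => i _; rewrite -expr2 sqr_ge0. Qed.

Lemma le_edot_coord n (x : 'rV[R]_n) i : x ord0 i ^+ 2 <= edot x x.
Proof. by rewrite /edot (bigD1 i)//= -expr2 lerDl sumr_ge0// => j _; rewrite -expr2 sqr_ge0. Qed.

Lemma measurable_fun_coord n i : measurable_fun setT (fun x : 'rV[R]_n => x ord0 i).
Proof. by apply: continuous_measurable_rVR; exact: coord_continuous. Qed.

(** An open set of the product corresponds to an open set of ['rV_(n + k)], which is Borel by
    definition, and the measurable map [row_mx] pulls it back into the product sigma-algebra.
    Semicontinuous functions of (direction, point) are thereby jointly measurable, as Tonelli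
    requires. *)
Lemma open_measurable_rVX n k (U : set ('rV[R]_n * 'rV[R]_k)) : open U -> measurable U.
Proof.
move=> oU.
have cl : continuous (@lsubmx R 1 n k).
  move=> w A /nbhs_ballP[e /= e0 eA]; apply/nbhs_ballP; exists e => //= v.
  by move=> /(rV_ballE _ _ e0) h; apply: eA; apply/(rV_ballE _ _ e0) => i; rewrite !mxE.
have cr : continuous (@rsubmx R 1 n k).
  move=> w A /nbhs_ballP[e /= e0 eA]; apply/nbhs_ballP; exists e => //= v.
  by move=> /(rV_ballE _ _ e0) h; apply: eA; apply/(rV_ballE _ _ e0) => i; rewrite !mxE.
have cs : continuous (fun w : 'rV[R]_(n + k) => (lsubmx w, rsubmx w)).
  by move=> w; apply: (@cvg_pair _ _ _ (nbhs w) (nbhs (lsubmx w)) (nbhs (rsubmx w))); [exact: cl|exact: cr].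
have mr : measurable_fun setT (fun p : 'rV[R]_n * 'rV[R]_k => row_mx p.1 p.2).
  apply: measurable_fun_rV => i; case: (split_ordP i) => j ->.
    under eq_fun do rewrite row_mxEl.
    exact: measurableT_comp (measurable_fun_coord j) measurable_fst.
  under eq_fun do rewrite row_mxEr.
  exact: measurableT_comp (measurable_fun_coord j) measurable_snd.
rewrite (_ : U = (fun p => row_mx p.1 p.2) @^-1`
   ((fun w : 'rV[R]_(n + k) => (lsubmx w, rsubmx w)) @^-1` U)).
  rewrite -[X in measurable X]setTI; apply: mr => //; apply: open_measurable_rV.
  by apply: open_comp => // w _; exact: cs.
by apply/seteqP; split => -[x y] /=; rewrite row_mxKl row_mxKr.
Qed.

Lemma continuous_measurable_rVX n k (f : 'rV[R]_n * 'rV[R]_k -> R) :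
  continuous f -> measurable_fun setT f.
Proof.
move=> cf; apply: (measurability _ (RGenOInfty.measurableE R)).
move=> _ [_ [a ->] <-]; rewrite setTI; apply: open_measurable_rVX.
by apply: open_comp => [x _|]; [exact: cf|exact: interval_open].
Qed.

Lemma measurable_fun_line d (T : measurableType d) n (f g : T -> 'rV[R]_n) (t : T -> R) :
  measurable_fun setT f -> measurable_fun setT g -> measurable_fun setT t ->
  measurable_fun setT (fun x => f x + t x *: g x).
Proof.
move=> mf mg mt; apply: measurable_fun_rV => i.
under eq_fun do rewrite !mxE.
apply: measurable_funD.
  exact: measurableT_comp (@measurable_fun_coord n i) mf.
by apply: measurable_funM => //; exact: measurableT_comp (@measurable_fun_coord n i) mg.
Qed.

Lemma measurable_fun_edot d (T : measurableType d) n (f g : T -> 'rV[R]_n) :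
  measurable_fun setT f -> measurable_fun setT g ->
  measurable_fun setT (fun x => edot (f x) (g x)).
Proof.
move=> mf mg; rewrite /edot.
apply: (@measurable_sum _ _ _ _ _ _ (fun i x => f x ord0 i * g x ord0 i)) => i.
by apply: measurable_funM; [exact: measurableT_comp (@measurable_fun_coord n i) mf|
  exact: measurableT_comp (@measurable_fun_coord n i) mg].
Qed.

End borel_rV.

(** * Translation invariance and slicing of Lebesgue measure by parallel lines *)

Section translation.
Context {R : realType}.

Lemma measurable_indic_comp d d' (T : measurableType d) (U : measurableType d')
    (A : set U) (f : T -> U) : measurable A -> measurable_fun setT f ->
  measurable_fun setT (fun x => (\1_A (f x) : R)%:E).
Proof.
move=> mA mf; apply/measurable_EFinP.
rewrite (_ : (fun x => _) = \1_(f @^-1` A)).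
  by apply: measurable_indic; rewrite -[X in measurable X]setTI; exact: mf.
by apply/funext => x; rewrite !indicE; congr (_%:R); apply/idP/idP; rewrite !inE.
Qed.

Local Open Scope ereal_scope.

Lemma ge0_integral_mrestr d (T : measurableType d) (m : {measure set T -> \bar R})
    (D : set T) (mD : measurable D) (f : T -> \bar R) :
  measurable_fun setT f -> (forall x, 0 <= f x) ->
  \int[mrestr m mD]_x f x = \int[m]_(x in D) f x.
Proof.
move=> mf f0; rewrite -(setUv D) ge0_integral_setU//.
- rewrite (@eq_measure_integral _ _ _ D m) => [|A mA AD]; last first.
    by rewrite /= /mrestr setIidl.
  rewrite (@eq_measure_integral _ _ _ (~` D) mzero) => [|A mA AD].
    by rewrite integral_measure_zero adde0.
  have AD0 : A `&` D = set0 by apply/seteqP; split => // x [/AD].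
  by transitivity (m set0); [congr (m _)|exact: (measure0 m)].
- exact: measurableC.
- exact: measurable_funS mf.
- by rewrite disj_set2E setICr.
Qed.

Local Notation leb := (@lebesgue_measure R).

Lemma lebesgue_measureD (c : R) (A : set R) : measurable A ->
  pushforward leb (fun x => x + c)%R A = leb A.
Proof.
move=> mA; apply/esym.
have mc : measurable_fun setT (fun x : measurableTypeR R => x + c : measurableTypeR R)%R.
  exact: measurable_funD.
pose P := [the measure _ _ of pushforward leb (fun x : measurableTypeR R => x + c : measurableTypeR R)%R].
apply: (@lebesgue_measure_unique _ (P mc)) => //= _ [[a b]] _ <-; rewrite /P/=.
rewrite /pushforward (_ : _ @^-1` _ = `](a - c)%R, (b - c)%R]%classic); last first.
  by apply/seteqP; split => x /=; rewrite !in_itv/= ltrBlDr lerBrDr.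
rewrite !lebesgue_measure_itv/= !lte_fin ltrD2r.
by case: ifP => // _; rewrite -!EFinD; congr (_%:E); ring.
Qed.

Lemma ge0_integralD_shift (c : R) (f : R -> \bar R) :
  measurable_fun [set: R] f -> (forall x, 0 <= f x) ->
  \int[leb]_x f (x + c)%R = \int[leb]_x f x.
Proof.
move=> mf f0.
have mc : measurable_fun setT (fun x : measurableTypeR R => x + c : measurableTypeR R)%R.
  exact: measurable_funD.
rewrite -[LHS](@ge0_integral_pushforward _ _ _ _ R _ mc leb setT f)//.
apply: eq_measure_integral => A mA _; exact: lebesgue_measureD.
Qed.

Lemma lebesgue_rVS n (A : set 'rV[R]_n.+1) :
  lebesgue_rV A = \int[leb]_x
      lebesgue_rV [set v : 'rV[R]_n | A (row_mx (x%:M : 'rV[R]_1) v)].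
Proof. by []. Qed.

(** Induction along the slicing that defines [lebesgue_rV]: the outer integral is translated by the
    first coordinate of [c] and the slices by the others. *)
Lemma lebesgue_rV_translation n (c : 'rV[R]_n) (A : set 'rV[R]_n) : measurable A ->
  lebesgue_rV ((fun x => x + c)%R @^-1` A) = lebesgue_rV A.
Proof.
elim: n => [|n IH] in c A *.
  move=> mA; congr (lebesgue_rV _); apply/seteqP; split => x /=;
    by rewrite [(x + c)%R](_ : _ = x)//; apply/rowP => -[].
move=> mA; rewrite !lebesgue_rVS.
pose c0 := c ord0 ord0; pose c' : 'rV[R]_n := \row_i c ord0 (lift ord0 i).
have cE (x : R) (v : 'rV[R]_n) : (row_mx (x%:M : 'rV[R]_1) v + c =
    row_mx ((x + c0)%:M : 'rV[R]_1) (v + c'))%R.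
  apply/rowP => i; rewrite !mxE; case: splitP => j /= ij.
    rewrite (ord1 j) !mxE !eqxx !mulr1n; congr (_ + c _ _)%R.
    by apply/val_inj => /=; rewrite ij (ord1 j).
  rewrite !mxE; congr (_ + c _ _)%R.
  by apply/val_inj => /=; rewrite ij.
pose B (x : R) := [set v : 'rV[R]_n | A (row_mx (x%:M : 'rV[R]_1) v)].
have mB : measurable [set p : measurableTypeR R * 'rV[R]_n | B p.1 p.2].
  rewrite -[X in measurable X]setTI; exact: measurable_rcons.
have mBx x : measurable (B x).
  have := measurable_xsection x mB.
  rewrite (_ : xsection _ _ = B x)//.
  by apply/seteqP; split => v; rewrite /xsection/= inE.
transitivity (\int[leb]_x lebesgue_rV (B (x + c0)%R)).
  apply: eq_integral => x _; rewrite -(IH c' (B (x + c0)%R))//.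
  by congr (lebesgue_rV _); apply/seteqP; split => v; rewrite /B/= cE.
apply: (@ge0_integralD_shift c0 (fun x => lebesgue_rV (B x))) => //.
have := lebesgue_integral_fubini.measurable_fun_xsection (@lebesgue_rV R n) mB.
congr measurable_fun; apply/funext => x /=; congr (lebesgue_rV _).
by apply/seteqP; split => v; rewrite /xsection/= inE.
Qed.

Lemma ge0_integral_rV_translation n (c : 'rV[R]_n) (f : 'rV[R]_n -> \bar R) :
  measurable_fun setT f -> (forall x, 0 <= f x) ->
  \int[@lebesgue_rV R n]_x f (x + c)%R = \int[@lebesgue_rV R n]_x f x.
Proof.
move=> mf f0.
have mc : measurable_fun setT (fun x : 'rV[R]_n => x + c)%R.
  apply: measurable_fun_rV => i; under eq_fun do rewrite mxE.
  by apply: measurable_funD => //; exact: measurable_fun_coord.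
rewrite -[LHS](@ge0_integral_pushforward _ _ _ _ R _ mc (@lebesgue_rV R n) setT f)//.
apply: eq_measure_integral => A mA _; exact: lebesgue_rV_translation.
Qed.

Lemma lebesgue_rV_bounded n (k : nat) :
  lebesgue_rV [set v : 'rV[R]_n | forall i, (`|v ord0 i| <= k%:R)%R] < +oo.
Proof. by have [m -> mf] := lebesgue_rV_spec R n; exact: mf. Qed.

Section slicing.
Variables (n : nat) (nu : 'rV[R]_n).
Hypothesis nu1 : edot nu nu = 1%R.
Local Notation lam := (@lebesgue_rV R n).

Definition slab : set 'rV[R]_n := [set x | 0 <= edot x nu <= 1]%R.

Lemma edotDZl (x y : 'rV[R]_n) t (z : 'rV[R]_n) :
  edot (x + t *: y)%R z = (edot x z + t * edot y z)%R.
Proof.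
rewrite /edot mulr_sumr -big_split/=; apply: eq_bigr => i _.
by rewrite !mxE mulrDl mulrA.
Qed.

(** Tonelli and a translation give each point [y] as weight the measure of the [t] with
    [y - t *: nu] in the slab, an interval of length 1. The slab thus plays the role of [nu^perp],
    and [nu] need not be a coordinate direction. *)
Lemma ge0_integral_slab (f : 'rV[R]_n -> \bar R) :
  measurable_fun setT f -> (forall x, 0 <= f x) ->
  \int[lam]_(x in slab) \int[leb]_t f (x + t *: nu)%R = \int[lam]_x f x.
Proof.
move=> mf f0.
pose g (z : 'rV[R]_n * measurableTypeR R) := (\1_slab z.1)%:E * f (z.1 + z.2 *: nu)%R.
have mslab : measurable slab by exact: measurable_slab.
have mline : measurable_fun setT (fun z : 'rV[R]_n * measurableTypeR R => z.1 + z.2 *: nu)%R.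
  apply: (@measurable_fun_line _ _ _ _ fst (cst nu) snd) => //; exact: measurable_cst.
have mg : measurable_fun setT g.
  apply: emeasurable_funM.
    by apply: (measurable_indic_comp (f := fst) mslab).
  exact: measurableT_comp mf mline.
have g0 z : 0 <= g z by rewrite /g mule_ge0// lee_fin.
transitivity (\int[lam]_x \int[leb]_t g (x, t)).
  rewrite integral_mkcond; apply: eq_integral => x _; rewrite /patch.
  case: ifPn => xs.
    by apply: eq_integral => t _; rewrite /g indicE/= xs mul1e.
  by rewrite integral0_eq// => t _; rewrite /g indicE/= (negbTE xs) mul0e.
rewrite (fubini_tonelli (m1 := lam) (m2 := leb) g)//.
transitivity (\int[leb]_t \int[lam]_y ((\1_slab (y - t *: nu)%R)%:E * f y)).
  apply: eq_integral => t _.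
  rewrite -(ge0_integral_rV_translation (t *: nu)%R (f := fun y => (\1_slab (y - t *: nu)%R)%:E * f y)).
  - by apply: eq_integral => x _; rewrite /g/= addrK.
  - apply: emeasurable_funM => //.
    apply: (measurable_indic_comp (f := fun x : 'rV[R]_n => x - t *: nu)%R mslab).
    apply: measurable_fun_rV => i; under eq_fun do rewrite !mxE.
    by apply: measurable_funB => //; exact: measurable_fun_coord.
  - by move=> x; rewrite mule_ge0// lee_fin.
pose k (z : measurableTypeR R * 'rV[R]_n) := (\1_slab (z.2 - z.1 *: nu)%R)%:E * f z.2.
have mk : measurable_fun setT k.
  apply: emeasurable_funM; last exact: measurableT_comp mf measurable_snd.
  apply: (measurable_indic_comp (f := fun z : measurableTypeR R * 'rV[R]_n => z.2 - z.1 *: nu)%R mslab).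
  under eq_fun do rewrite -scaleNr.
  apply: (@measurable_fun_line _ _ _ _ snd (cst nu) (fun z : measurableTypeR R * 'rV[R]_n => - z.1)%R) => //.
  exact: measurable_funN.
rewrite (fubini_tonelli (m1 := leb) (m2 := lam) k)//; last first.
  by move=> z; rewrite mule_ge0// lee_fin.
apply: eq_integral => y _.
transitivity (\int[leb]_t ((\1_([set` `[edot y nu - 1, edot y nu]%R] : set R) t)%:E * f y)).
  apply: eq_integral => t _; rewrite /k/= !indicE; congr ((nat_of_bool _)%:R%:E * _).
  rewrite /slab; apply/idP/idP; rewrite !inE/= in_itv/= -scaleNr edotDZl nu1 mulr1.
    by move=> /andP[a b]; apply/andP; split; lra.
  by move=> /andP[a b]; apply/andP; split; lra.
rewrite ge0_integralZr//; last first.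
- by apply/measurable_EFinP; apply: measurable_indic; exact: measurable_itv.
rewrite integral_indic//= setIT lebesgue_measure_itv/= lte_fin ltrBlDr ltrDl ltr01.
by rewrite -EFinD opprB addrCA subrr addr0 mul1e.
Qed.

Lemma ge0_integral_hyperplane (h : 'rV[R]_n -> \bar R) :
  measurable_fun setT h -> (forall x, 0 <= h x) ->
  \int[hyperplane_measure nu]_(x in hyperplane nu) h x =
  \int[lam]_(x in slab) h (proj_hyperplane nu x).
Proof.
move=> mh h0.
have mP := measurable_proj_hyperplane nu.
have mH : measurable (hyperplane nu).
  rewrite (_ : hyperplane nu = (fun x => edot x nu) @^-1` [set 0%R])//.
  rewrite -[X in measurable X]setTI.
  by apply: (measurable_fun_edot (f := id) (g := cst nu)) => //; exact: measurable_cst.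
pose m1 := mrestr lam (measurable_slab nu).
transitivity (\int[pushforward m1 (proj_hyperplane nu)]_(x in hyperplane nu) h x).
  by apply: eq_measure_integral.
rewrite ge0_integral_pushforward//; last exact: measurable_funS mh.
rewrite (_ : _ @^-1` _ = setT); last first.
  apply/seteqP; split => // x _ /=; rewrite /hyperplane/= /proj_hyperplane.
  by rewrite -scaleNr edotDZl nu1 mulr1 subrr.
rewrite ge0_integral_mrestr//; [exact: (measurableT_comp mh mP)|by move=> x; exact: h0].
Qed.

End slicing.
End translation.

(** * Distances along lines *)

Section one_sided_distance.
Context {R : realType} {n : nat}.
Variable Omega : set 'rV[R]_n.
Hypothesis oOmega : open Omega.
Implicit Types nu x : 'rV[R]_n.

(** One-sided distance: the component of the line through a point [x] of [Omega] is the interval of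
    parameters from [- rhop (- nu) x] to [rhop nu x], so two functions of (direction, point)
    describe all chords. *)
Definition rhop nu x : \bar R :=
  ereal_inf [set s%:E | s in [set s : R | 0 <= s /\ ~ Omega (x + s *: nu)]].

Lemma rhop_ge0 nu x : (0 <= rhop nu x)%E.
Proof. by apply/le_ereal_inf_tmp => _ [s [s0 _] <-]; rewrite lee_fin. Qed.

Lemma rhop_rho nu x : rho Omega nu x = mine (rhop nu x) (rhop (- nu) x).
Proof.
apply/eqP; rewrite eq_le; apply/andP; split.
  rewrite le_min; apply/andP; split; apply/le_ereal_inf_tmp => _ [s [s0 sO] <-];
    apply: ereal_inf_lbound.
    by exists s => //; rewrite ger0_norm.
  by exists (- s); rewrite ?normrN ?ger0_norm //=; rewrite scaleNr -scalerN.
apply/le_ereal_inf_tmp => _ [s sO <-]; rewrite ge_min; apply/orP.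
have [s0|s0] := leP 0 s; [left|right]; apply: ereal_inf_lbound.
  by exists s => //; rewrite ger0_norm.
exists (- s); last by rewrite ltr0_norm.
by split; [rewrite oppr_ge0 ltW|rewrite scaleNr scalerN opprK].
Qed.

Lemma lt_rhop_in nu x (s : R) : 0 <= s -> (s%:E < rhop nu x)%E -> Omega (x + s *: nu).
Proof.
move=> s0 sr; apply: contrapT => sO.
by move: sr; rewrite ltNge => /negP; apply; apply: ereal_inf_lbound; exists s.
Qed.

Lemma line_continuous nu x : continuous (fun s : R => x + s *: nu).
Proof.
by move=> s; apply: cvgD; [exact: cvg_cst|apply: cvgZr_tmp; exact: cvg_id].
Qed.

(** The infimum is attained: were the endpoint in the open set [Omega], the parameters just beyond
    it would be as well. *)
Lemma rhop_fin_notin nu x (r : R) : rhop nu x = r%:E -> ~ Omega (x + r *: nu).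
Proof.
move=> rE xO.
have : nbhs (x + r *: nu) Omega by exact: open_nbhs_nbhs.
move=> /(@line_continuous nu x r) /nbhs_ballP[e /= e0 eO].
have : ((r + e)%:E <= rhop nu x)%E.
  apply/le_ereal_inf_tmp => _ [s [s0 sO] <-]; rewrite lee_fin.
  rewrite leNgt; apply/negP => sre; apply: sO.
  have [sr|rs] := ltP s r; first by apply: lt_rhop_in => //; rewrite rE lte_fin.
  by apply: eO => /=; rewrite /ball/= distrC ger0_norm ?subr_ge0// ltrBlDl.
by rewrite rE lee_fin gerDl leNgt e0.
Qed.

Lemma lt_rhopP nu x (r : R) : 0 <= r ->
  (r%:E < rhop nu x)%E <-> forall s, 0 <= s <= r -> Omega (x + s *: nu).
Proof.
move=> r0; split=> [h s /andP[s0 sr]|h].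
  by apply: lt_rhop_in => //; apply: le_lt_trans h; rewrite lee_fin.
rewrite ltNge; apply/negP => h'.
have := rhop_ge0 nu x; case E : (rhop nu x) h' => [r'||]//; rewrite !lee_fin => h' r'0.
by apply: (rhop_fin_notin E); apply: h; rewrite r'0.
Qed.

Lemma rhop_gt0 nu x : Omega x -> (0 < rhop nu x)%E.
Proof.
move=> xO; apply/lt_rhopP => // s; rewrite -eq_le => /eqP <-.
by rewrite scale0r addr0.
Qed.

Lemma rho_gt0 nu x : Omega x -> (0 < rho Omega nu x)%E.
Proof. by move=> xO; rewrite rhop_rho lt_min !rhop_gt0. Qed.

Lemma rhopNE nu x (s : R) : x + s *: - nu = x + (- s) *: nu.
Proof. by rewrite scaleNr scalerN. Qed.

Definition seg nu x : set R := [set s | (s%:E < rhop nu x)%E /\ ((- s)%:E < rhop (- nu) x)%E].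

Lemma segN nu x s : seg (- nu) x s = seg nu x (- s).
Proof. by rewrite /seg/= !opprK; apply/propext; split => -[]. Qed.

Lemma seg0 nu x : Omega x -> seg nu x 0.
Proof. by move=> xO; rewrite /seg/= oppr0; split; exact: rhop_gt0. Qed.

Lemma seg_in nu x s : seg nu x s -> Omega (x + s *: nu).
Proof.
move=> [h1 h2]; have [s0|s0] := leP 0 s; first exact: lt_rhop_in.
by have := @lt_rhop_in (- nu) x (- s); rewrite rhopNE opprK; apply => //; rewrite oppr_ge0 ltW.
Qed.

Lemma seg_itv nu x s t u : seg nu x s -> seg nu x t -> s <= u <= t -> seg nu x u.
Proof.
move=> [s1 s2] [t1 t2] /andP[su ut]; split.
  by apply: le_lt_trans t1; rewrite lee_fin.
by apply: le_lt_trans s2; rewrite lee_fin lerN2.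
Qed.

Lemma segP nu x s : Omega x ->
  seg nu x s <-> forall t, (0 <= t <= s) \/ (s <= t <= 0) -> Omega (x + t *: nu).
Proof.
move=> xO; split=> [ss t ht|h].
  have s0 := seg0 nu xO.
  by apply: seg_in; case: ht => ht; [exact: (seg_itv s0 ss)|exact: (seg_itv ss s0)].
split; have [s0|s0] := leP 0 s.
- by apply/lt_rhopP => // t ht; apply: h; left.
- by apply: lt_trans (rhop_gt0 nu xO); rewrite lte_fin.
- by apply: le_lt_trans (rhop_gt0 (- nu) xO); rewrite lee_fin oppr_le0.
- apply/lt_rhopP => [|t /andP[t0 ts]]; first by rewrite oppr_ge0 ltW.
  by rewrite rhopNE; apply: h; right; rewrite lerNr ts oppr_le0.
Qed.

Lemma ereal_eq_lt (a b : \bar R) : (0 <= a)%E -> (0 <= b)%E ->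
  (forall r, 0 <= r -> (r%:E < a)%E <-> (r%:E < b)%E) -> a = b.
Proof.
move=> a0 b0 ab; apply/eqP; rewrite eq_le.
have H (c d : \bar R) : (0 <= d)%E -> (forall r, 0 <= r -> (r%:E < c)%E -> (r%:E < d)%E) -> (c <= d)%E.
  move=> d0 cd; rewrite leNgt; apply/negP => dc.
  move: dc cd d0; case: d => [d dc cd d0|dc _ _|//]; last by case: c dc.
  by have := cd d d0 dc; rewrite ltxx.
by apply/andP; split; apply: H => // r r0 /ab; apply.
Qed.

Lemma fin_seg_itv nu x a b : rhop (- nu) x = a%:E -> rhop nu x = b%:E ->
  seg nu x = `](- a)%R, b[%classic.
Proof.
move=> aE bE; apply/seteqP; split => s; rewrite /seg/= aE bE !lte_fin in_itv/= ltrNl.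
  by move=> [-> ->].
by move=> /andP[-> ->].
Qed.

(** Within a component, one distance loses what the other gains. Hence [rho] is a minimum of two
    affine functions of the parameter, and the length and midpoint of a bounded component do not
    depend on the base point. *)
Lemma rhop_shift nu x s : Omega x -> seg nu x s ->
  rhop nu (x + s *: nu) = (rhop nu x - s%:E)%E.
Proof.
move=> xO ss; have [s1 s2] := ss.
apply: ereal_eq_lt; first exact: rhop_ge0.
  by rewrite sube_ge0// ltW.
move=> r r0; rewrite lteBrDr// -EFinD.
have E (t : R) : x + s *: nu + t *: nu = x + (s + t) *: nu by rewrite scalerDl addrA.
split.
  move/lt_rhopP => /(_ r0) h.
  suff [] : seg nu x (r + s) by [].
  apply/segP => // t ht.
  have [ts|st] := leP t s.
    by move/segP : ss; apply => //; case: ht => /andP[t1 t2]; [left|right]; lra.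
  case: ht => /andP[t1 t2]; last by move/segP : ss; apply => //; right; lra.
  rewrite -[t](subrKC s) -E; apply: h; rewrite subr_ge0 (ltW st)/= lerBlDr//.
move=> h; apply/lt_rhopP => // t /andP[t0 tr]; rewrite E.
apply: seg_in; apply: (@seg_itv nu x s (r + s)) => //; last by apply/andP; split; lra.
by split => //; apply: le_lt_trans s2; rewrite lee_fin; lra.
Qed.

Lemma rhopN_shift nu x s : Omega x -> seg nu x s ->
  rhop (- nu) (x + s *: nu) = (rhop (- nu) x + s%:E)%E.
Proof.
move=> xO ss; have := @rhop_shift (- nu) x (- s) xO.
by rewrite segN opprK rhopNE opprK EFinN oppeK => ->.
Qed.

(** Connected subsets of the line are intervals, so the component consists of the parameters
    reachable from [t0] inside [Omega]. This translates the components of the statement into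
    one-sided distances. *)
Lemma component_seg nu x t0 : chord Omega nu x t0 ->
  connected_component (chord Omega nu x) t0 =
  [set t | seg nu (x + t0 *: nu) (t - t0)].
Proof.
move=> ct0.
have E (t : R) : x + t0 *: nu + (t - t0) *: nu = x + t *: nu.
  by rewrite -addrA -scalerDl subrKC.
apply/seteqP; split=> [t|t ts /=].
  move=> [C [Ct0 Cc cC] Ct]; apply/(segP _ _ ct0) => u hu.
  rewrite -addrA -scalerDl; apply: (Cc (t0 + u)).
  move/connected_intervalP : cC => cC.
  by case: hu => /andP[a b]; [apply: (cC t0 t)|apply: (cC t t0)] => //; apply/andP; split; lra.
exists [set t | seg nu (x + t0 *: nu) (t - t0)] => //; split.
- by rewrite /= subrr; exact: seg0.
- by move=> u /seg_in; rewrite E.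
- apply/connected_intervalP => a b /= ha hb c /andP[ac cb].
  by apply: (seg_itv ha hb); rewrite !lerD2r ac.
Qed.

End one_sided_distance.

(** * Joint measurability in direction and point *)

Section joint_measurability.
Context {R : realType} {n : nat}.
Variable Omega : set 'rV[R]_n.
Hypothesis oOmega : open Omega.
Local Notation T := ('rV[R]_n * 'rV[R]_n)%type.

Lemma line2_continuous : continuous (fun w : R * T => w.2.2 + w.1 *: w.2.1).
Proof.
move=> [s [nu x]].
have c2 : (fun w : R * T => w.2) @ nbhs (s, (nu, x)) --> (nu, x) by exact: cvg_snd.
apply: (@cvgD _ _ _ (nbhs (s, (nu, x))) _ (fun w : R * T => w.2.2)
  (fun w : R * T => w.1 *: w.2.1)).
  exact: (cvg_comp (fun w : R * T => w.2) snd c2 cvg_snd).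
apply: (@cvgZ _ _ _ (nbhs (s, (nu, x)))); first exact: cvg_fst.
exact: (cvg_comp (fun w : R * T => w.2) fst c2 cvg_fst).
Qed.

(** Tube-lemma argument: by compactness of [[0, r]], a segment contained in [Omega] stays there when
    direction and base point are perturbed together, so [rhop] is lower semicontinuous. *)
Lemma open_lt_rhop (r : R) : open [set z : T | (r%:E < rhop Omega z.1 z.2)%E].
Proof.
have [r0|r0] := ltP r 0.
  rewrite (_ : [set _ | _] = setT); first exact: openT.
  apply/seteqP; split => // z _ /=.
  by apply: lt_le_trans (rhop_ge0 _ _ _); rewrite lte_fin.
rewrite openE => -[nu x] /= /(lt_rhopP oOmega _ _ r0) h.
have := (compact_near_coveringP `[0%R, r]).1 (@segment_compact R 0 r).
move=> /(_ T (nbhs (nu, x)) (fun z s => Omega (z.2 + s *: z.1)) _) K.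
have : \forall z \near nbhs (nu, x), `[0%R, r]%classic `<=` (fun s => Omega (z.2 + s *: z.1)).
  apply: K => s; rewrite /= in_itv/= => sr.
  have : nbhs (x + s *: nu) Omega by apply: open_nbhs_nbhs; split => //; exact: h.
  exact: (@line2_continuous (s, (nu, x))).
apply: filterS => z /= zs; apply/(lt_rhopP oOmega _ _ r0) => s sr.
by apply: zs => /=; rewrite in_itv.
Qed.

Lemma measurable_rhop : measurable_fun setT (fun z : T => rhop Omega z.1 z.2).
Proof.
apply: (measurability _ (ErealGenOInfty.measurableE R)).
move=> _ [_ [a ->] <-]; rewrite setTI; apply: open_measurable_rVX.
rewrite preimage_itvoy; exact: open_lt_rhop.
Qed.

Lemma measurable_rhopN : measurable_fun setT (fun z : T => rhop Omega (- z.1) z.2).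
Proof.
have mo : measurable_fun setT (fun z : T => (- z.1, z.2)).
  apply/measurable_fun_pairP; split; last exact: measurable_snd.
  apply: measurable_fun_rV => i; under eq_fun do rewrite mxE.
  by apply: measurable_funN; exact: measurableT_comp (measurable_fun_coord i) measurable_fst.
exact: measurableT_comp measurable_rhop mo.
Qed.

Lemma rho_rhop_fun :
  (fun z : T => rho Omega z.1 z.2) =
  (fun z : T => mine (rhop Omega z.1 z.2) (rhop Omega (- z.1) z.2)).
Proof. by apply/funext => z; rewrite rhop_rho. Qed.

Lemma measurable_rho : measurable_fun setT (fun z : T => rho Omega z.1 z.2).
Proof.
rewrite rho_rhop_fun.
by apply: measurable_mine; [exact: measurable_rhop|exact: measurable_rhopN].
Qed.

(* Saturated along the lines of direction [z.1], so that it can be discarded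
   line by line. *)
Definition bad (d : \bar R) : set T :=
  [set z | exists t, (d < rho Omega z.1 (z.2 + t *: z.1))%E].

Lemma open_bad d : (0 <= d)%E -> open (bad d).
Proof.
case: d => [d d0|_|//]; last first.
  rewrite (_ : bad _ = set0); first exact: open0.
  by apply/seteqP; split => // z [t]; rewrite ltNge leey.
rewrite (_ : bad _ = \bigcup_(t in setT)
   ((fun z : T => (z.1, z.2 + t *: z.1)) @^-1`
     ([set z : T | (d%:E < rhop Omega z.1 z.2)%E] `&`
      (fun z : T => (- z.1, z.2)) @^-1` [set z : T | (d%:E < rhop Omega z.1 z.2)%E]))).
  apply: bigcup_open => t _; apply: open_comp.
    move=> [nu x] _; apply: (@cvg_pair _ _ _ (nbhs (nu, x)) (nbhs nu) (nbhs (x + t *: nu))); first exact: cvg_fst.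
    by apply: cvgD; [exact: cvg_snd|apply: cvgZl_tmp; exact: cvg_fst].
  apply: openI; first exact: open_lt_rhop.
  apply: open_comp; last exact: open_lt_rhop.
  move=> [nu x] _; apply: (@cvg_pair _ _ _ (nbhs (nu, x)) (nbhs (- nu)) (nbhs x)); last exact: cvg_snd.
  by apply: cvgN; exact: cvg_fst.
apply/seteqP; split => [z [t]|z [t _]].
  by rewrite rhop_rho lt_min => /andP[h1 h2]; exists t.
by move=> [h1 h2]; exists t; rewrite rhop_rho lt_min h1.
Qed.

Lemma bad_shift d nu x s : bad d (nu, x + s *: nu) <-> bad d (nu, x).
Proof.
split=> -[t /=].
  by rewrite -addrA -scalerDl => h; exists (s + t).
by move=> h; exists (t - s) => /=; rewrite -addrA -scalerDl subrKC.
Qed.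

(** [fine] sends [+oo] to 0, so this length and the midpoint below have their geometric meaning only
    on bounded components. *)
Definition seg_len nu x : R := fine (rhop Omega nu x) + fine (rhop Omega (- nu) x).

Definition seg_mid nu x : 'rV[R]_n :=
  x + ((fine (rhop Omega nu x) - fine (rhop Omega (- nu) x)) / 2) *: nu.

Lemma measurable_seg_len : measurable_fun setT (fun z : T => seg_len z.1 z.2).
Proof.
apply: measurable_funD.
  exact: measurableT_comp (fine_measurable measurableT) measurable_rhop.
exact: measurableT_comp (fine_measurable measurableT) measurable_rhopN.
Qed.

Lemma measurable_seg_mid : measurable_fun setT (fun z : T => seg_mid z.1 z.2).
Proof.
apply: (@measurable_fun_line _ _ _ _ snd fst (fun z : T =>
  (fine (rhop Omega z.1 z.2) - fine (rhop Omega (- z.1) z.2)) / 2)) => //.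
apply: measurable_funM; last exact: measurable_cst.
apply: measurable_funB.
  exact: measurableT_comp (fine_measurable measurableT) measurable_rhop.
exact: measurableT_comp (fine_measurable measurableT) measurable_rhopN.
Qed.

Lemma measurable_rhop1 nu : measurable_fun setT (rhop Omega nu).
Proof. exact: (measurableT_comp measurable_rhop (measurable_pair1 nu)). Qed.

End joint_measurability.

(** * Picone's identity for Bessel pairs *)

Section signed_power.
Context {R : realType}.
Variable p : R.
Hypothesis p1 : 1 < p.
Let p0 : 0 < p. Proof. exact: lt_trans p1. Qed.

Lemma spow0 : spow p 0 = 0 :> R.
Proof. by rewrite /spow mulr0. Qed.

Lemma spowMr (t : R) : spow p t * t = `|t| `^ p.
Proof.
rewrite /spow; have [->|t0] := eqVneq t 0.
  by rewrite mulr0 normr0 powR0// gt_eqF.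
rewrite -mulrA -expr2 -(real_normK (num_real t)) -powR_mulrn//.
by rewrite -powRD ?subrK// normr_eq0 t0 implybT.
Qed.

Lemma norm_spow (t : R) : `|spow p t| = `|t| `^ (p - 1).
Proof.
have [->|t0] := eqVneq t 0.
  by rewrite spow0 normr0 powR0// subr_eq0 gt_eqF.
apply: (@mulIf _ `|t|); first by rewrite normr_eq0.
rewrite -normrM spowMr ger0_norm ?powR_ge0// mulrC mulr_powRB1//.
Qed.

Lemma spowM (a b : R) : spow p (a * b) = spow p a * spow p b.
Proof. by rewrite /spow normrM powRM// mulrACA. Qed.

Lemma spow_gt0 (t : R) : 0 < t -> spow p t = t `^ (p - 1).
Proof.
move=> t0; have s0 : 0 <= spow p t by rewrite /spow mulr_ge0 ?powR_ge0 ?ltW.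
by rewrite -(ger0_norm s0) norm_spow gtr0_norm.
Qed.

Lemma spowN (t : R) : spow p (- t) = - spow p t.
Proof. by rewrite /spow normrN mulrN. Qed.

Lemma spow_ge0 (t : R) : 0 <= t -> 0 <= spow p t.
Proof. by move=> t0; rewrite /spow mulr_ge0 ?powR_ge0. Qed.

Lemma spow_lt0 (t : R) : t < 0 -> spow p t < 0.
Proof.
move=> t0; rewrite /spow pmulr_rlt0// powR_gt0// normr_gt0 lt_eqF//.
Qed.

Lemma spow_div (a f : R) : 0 < f -> spow p (a / f) = spow p a * f `^ (1 - p).
Proof.
move=> f0; rewrite spowM (@spow_gt0 f^-1) ?invr_gt0//; congr (_ * _).
by rewrite -powR_inv1 ?ltW// -powRrM; congr (_ `^ _); ring.
Qed.

Lemma continuous_normr_powR (q x : R) : x != 0 -> {for x, continuous (fun t : R => `|t| `^ q)}.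
Proof.
move=> x0; apply: (@continuous_comp _ _ _ (fun t : R => `|t|) (fun y => y `^ q)).
  exact: norm_continuous.
apply/differentiable_continuous/derivable1_diffP/derivable_powR.
by rewrite in_itv/= normr_gt0 x0.
Qed.

(** For [p < 2] the factor [|t|^(p-2)] is unbounded near 0; continuity there comes from
    [|spow p t| = |t|^(p-1)] with [p > 1]. *)
Lemma continuous_spow : continuous (spow p : R -> R).
Proof.
move=> x; have [->|x0] := eqVneq x 0; last first.
  by apply: cvgM; [exact: continuous_normr_powR|exact: cvg_id].
rewrite /continuous_at spow0; apply/cvgr0Pnorm_lt => e e0.
have p10 : 0 < p - 1 by rewrite subr_gt0.
have d0 : 0 < e `^ (p - 1)^-1 by rewrite powR_gt0.
apply/nbhs_ballP; exists (e `^ (p - 1)^-1) => //= t.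
rewrite /ball/= sub0r normrN => tl.
rewrite norm_spow.
have -> : e = (e `^ (p - 1)^-1) `^ (p - 1).
  by rewrite -powRrM mulVf ?gt_eqF// powRr1// ltW.
by apply: gt0_ltr_powR => //; rewrite ?nnegrE// ?ltW.
Qed.

(** At 0 the Caratheodory slope is [spow p] itself, since [spow p t * t = |t|^p]; elsewhere [|t|] is
    locally [t] or [- t]. *)
Lemma is_derive_normr_powR (x : R) : is_derive x 1 (fun t : R => `|t| `^ p) (p * spow p x).
Proof.
have [->|x0] := eqVneq x 0.
  rewrite spow0 mulr0; apply/is_derive1_caratheodory; exists (spow p); split.
  - by move=> z; rewrite subr0 spowMr normr0 powR0 ?subr0// gt_eqF.
  - exact: continuous_spow.
  - exact: spow0.
have [xp|xn] := ltP 0 x.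
  rewrite spow_gt0//.
  apply: near_eq_is_derive (is_derive1_powR p xp).
  near=> t; rewrite ger0_norm//.
  by near: t; apply: filterS (lt_nbhsr xp) => // z /ltW.
have {}xn : x < 0 by rewrite lt_neqAle x0.
have nx : 0 < - x by rewrite oppr_gt0.
have -> : p * spow p x = p * (- x) `^ (p - 1) * (-1).
  by rewrite -[x in LHS]opprK spowN spow_gt0//; ring.
apply: (@near_eq_is_derive _ _ _ (fun t => (- t) `^ p)).
  near=> t; rewrite ltr0_norm//.
  by near: t; exact: lt_nbhsl.
apply: (@is_derive1_comp _ (fun t => t `^ p) -%R).
exact: is_derive1_powR.
Unshelve. all: end_near. Qed.

Lemma continuous_norm_powR : continuous (fun t : R => `|t| `^ p).
Proof.
move=> x; apply/differentiable_continuous/derivable1_diffP.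
by have [] := is_derive_normr_powR x.
Qed.

(** In the variable [z], the functional [C_p] is the defect in Young's inequality for [x] and
    [spow p z], scaled by [p]; Picone's identity and positivity both use this form. *)
Lemma CpE (x z : R) :
  Cp p x (x - z) = `|x| `^ p + (p - 1) * `|z| `^ p - p * (spow p z * x).
Proof.
rewrite /Cp opprB addrCA subrr addr0 -(spowMr z) /spow.
ring.
Qed.

(** Young's inequality with exponents [p] and [p / (p - 1)], the second of which turns [|spow p z|]
    into [|z|^p]. *)
Lemma Cp_ge0 (x y : R) : 0 <= Cp p x y.
Proof.
have -> : y = x - (x - y) by rewrite opprB addrCA subrr addr0.
move: (x - y) => z; rewrite CpE subr_ge0.
have p10 : 0 < p - 1 by rewrite subr_gt0.
have q0 : 0 < p / (p - 1) by rewrite divr_gt0.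
have := @conjugate_powR _ `|x| `|spow p z| p (p / (p - 1)) (normr_ge0 _) (normr_ge0 _) p0 q0.
have -> : p^-1 + (p / (p - 1))^-1 = 1.
  by field; rewrite !gt_eqF.
move=> /(_ erefl); rewrite norm_spow -powRrM (_ : (p - 1) * (p / (p - 1)) = p); last first.
  by field; rewrite gt_eqF.
move=> H; apply: (@le_trans _ _ (p * (`|x| * `|spow p z|))).
  rewrite ler_pM2l// mulrC -normrM; exact: ler_norm.
apply: (@le_trans _ _ (p * (`|x| `^ p / p + `|z| `^ p / (p / (p - 1))))).
  by rewrite ler_pM2l// norm_spow.
rewrite le_eqVlt; apply/orP; left; apply/eqP; field; rewrite !gt_eqF//.
Qed.

Lemma Cp_id (x : R) : Cp p x x = `|x| `^ p.
Proof.
by rewrite -[in Cp p x x](subr0 x) {1}subr0 CpE spow0 normr0 powR0 ?gt_eqF//; ring.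
Qed.

End signed_power.

Lemma ge0_adde_eq0 (R : realType) (a b : \bar R) (c : R) :
  (0 <= a -> 0 <= b -> 0 = a + b + c%:E -> a <= (- c)%:E)%E.
Proof.
move: a b => [a| |]// [b| |]//; rewrite !lee_fin => a0 b0.
by rewrite -!EFinD => -[E]; lra.
Qed.

Section bessel.
Context {R : realType}.
Variables (p : R) (rad : \bar R) (V W phi : R -> R).
Hypothesis p1 : 1 < p.
Hypothesis VW0 : forall r, in_interval rad r -> 0 < V r /\ 0 < W r.
Hypothesis VC1 : C1_on rad V.
Hypothesis WC1 : C1_on rad W.
Hypothesis sol : positive_solution p rad V W phi.
Local Notation I := (in_interval rad).
Local Notation leb := (@lebesgue_measure R).

Lemma in_interval_open : open [set r | I r].
Proof.
rewrite (_ : [set _ | _] = [set r | 0 < r] `&` [set r | (r%:E < rad)%E]); last by [].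
apply: openI; first exact: open_gt.
case: rad => [d| |].
- exact: open_lt.
- rewrite (_ : [set _ | _] = setT); first exact: openT.
  by apply/seteqP; split => // r _ /=; rewrite ltry.
- by rewrite (_ : [set _ | _] = set0) ?open0//; apply/seteqP; split.
Qed.

Lemma in_interval_itv a b c : I a -> I b -> a <= c <= b -> I c.
Proof.
move=> [a0 _] [_ br] /andP[ac cb]; split; first exact: lt_le_trans ac.
by apply: le_lt_trans br; rewrite lee_fin.
Qed.

Let phi_gt0 r : I r -> 0 < phi r. Proof. by case: sol => h _ _ _; exact: h. Qed.
Let phi_der r : I r -> is_derive r 1 phi (derive1 phi r).
Proof.
case: sol => _ h _ _ Ir; have [d _] := h r Ir.
by rewrite derive1E; exact: DeriveDef.
Qed.

Let phi'_cont r : I r -> {for r, continuous (derive1 phi)}.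
Proof. by case: sol => _ h _ _ Ir; have [] := h r Ir. Qed.

Lemma C1_continuous f r : C1_on rad f -> I r -> {for r, continuous f}.
Proof.
move=> fC Ir; have [d _] := fC r Ir.
exact/differentiable_continuous/derivable1_diffP.
Qed.

(** The Bessel equation gives [flux] the derivative [- W phi^(p-1)], so it is nonincreasing.
    Multiplied by [phi^(1-p)] it becomes [skel], the coefficient of [|u|^p] in the boundary terms
    ([skelE]). *)
Definition flux r := V r * spow p (derive1 phi r).
Definition log_slope r := derive1 phi r / phi r.
Definition skel r := V r * spow p (log_slope r).

Lemma flux_der r : I r -> is_derive r 1 flux (- (W r * phi r `^ (p - 1))).
Proof.
move=> Ir; rewrite -spow_gt0//; last exact: phi_gt0.
by case: sol => _ _ h _; exact: h.
Qed.

Lemma skelE r : I r -> skel r = flux r * phi r `^ (1 - p).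
Proof. by move=> Ir; rewrite /skel /log_slope spow_div ?phi_gt0// mulrA. Qed.

Lemma continuous_log_slope r : I r -> {for r, continuous log_slope}.
Proof.
move=> Ir; apply: cvgM; first exact: phi'_cont.
apply: cvgV; first by rewrite gt_eqF ?phi_gt0.
by case: sol => _ h _ _; exact: C1_continuous.
Qed.

Lemma continuous_skel r : I r -> {for r, continuous skel}.
Proof.
move=> Ir; apply: cvgM; first exact: C1_continuous.
apply: continuous_comp; first exact: continuous_log_slope.
exact: continuous_spow.
Qed.

Lemma spowZ_sgn (e t : R) : `|e| = 1 -> spow p (e * t) = e * spow p t.
Proof. by move=> e1; rewrite spowM; congr (_ * _); rewrite /spow e1 powR1 mul1r. Qed.

Section line.
Variables (r0 e : R) (v dv : R -> R).
Hypothesis e1 : `|e| = 1.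
Hypothesis vder : forall s : R, is_derive s 1 v (dv s).
Hypothesis cdv : continuous dv.
Let rr (s : R) := r0 + e * s.
Let ee : e * e = 1. Proof. by rewrite -expr2 -real_normK ?num_real// e1 expr1n. Qed.

(** The sign [e] handles both halves of a chord: the distance grows with [s] for [e = 1] and
    decreases for [e = -1], and the outer factor [e] cancels the one from the chain rule. The
    equation for [flux] produces the [W] term because [phi^(p-1) * phi^(1-p) = 1]; the rest is
    [CpE]. *)
Lemma picone_derive s : I (rr s) ->
  is_derive s 1 (fun s => e * (flux (rr s) * phi (rr s) `^ (1 - p) * `|v s| `^ p))
   (V (rr s) * `|dv s| `^ p - W (rr s) * `|v s| `^ p
    - V (rr s) * Cp p (dv s) (dv s - e * v s * log_slope (rr s))).
Proof.
move=> Ir; set r := rr s.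
have f0 : 0 < phi r by exact: phi_gt0.
have drr : is_derive s 1 rr e.
  rewrite /rr; have := is_deriveD (is_derive_cst r0 s 1) (is_deriveZ e (is_derive_id s 1)).
  by rewrite add0r scaler1.
have d1 : is_derive s 1 (flux \o rr) (- (W r * phi r `^ (p - 1)) * e).
  apply: is_derive1_comp; exact: flux_der.
have d2 : is_derive s 1 ((fun f => f `^ (1 - p)) \o (phi \o rr))
   ((1 - p) * phi r `^ (1 - p - 1) * (derive1 phi r * e)).
  apply: is_derive1_comp; first exact: is_derive1_powR.
  by apply: is_derive1_comp; exact: phi_der.
have d3 : is_derive s 1 ((fun t => `|t| `^ p) \o v) (p * spow p (v s) * dv s).
  by apply: is_derive1_comp; exact: is_derive_normr_powR.
apply: is_derive_eq (is_deriveZ e (is_deriveM (is_deriveM d1 d2) d3)) _.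
rewrite /GRing.scale /= fctE /= -/r.
rewrite CpE// -/r.
rewrite -!(mulrA e) (spowZ_sgn _ e1) spowM.
have -> : `|e * (v s * log_slope r)| `^ p = `|v s| `^ p * `|log_slope r| `^ p.
  by rewrite !normrM e1 mul1r powRM.
rewrite -(spowMr p1 (log_slope r)).
have E1 : phi r `^ (1 - p - 1) = phi r `^ (1 - p) / phi r.
  by rewrite powRD ?(gt_eqF f0) ?implybT// powR_inv1 ?ltW.
have E2 : phi r `^ (p - 1) * phi r `^ (1 - p) = 1.
  rewrite -powRD; last by rewrite (gt_eqF f0) implybT.
  by rewrite addrA subrK subrr powRr0.
have E3 : flux r * phi r `^ (1 - p) = V r * spow p (log_slope r) by rewrite -skelE.
transitivity (e * (flux r * phi r `^ (1 - p)) * (p * spow p (v s) * dv s) +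
   (e * e) * (1 - p) * `|v s| `^ p * (flux r * phi r `^ (1 - p)) * (derive1 phi r / phi r) -
   (e * e) * W r * `|v s| `^ p * (phi r `^ (p - 1) * phi r `^ (1 - p))).
  rewrite E1; ring.
rewrite E2 E3 ee -/(log_slope r); ring.
Qed.

Let cv : continuous v.
Proof. by move=> s; apply/differentiable_continuous/derivable1_diffP; have [] := vder s. Qed.

Let crr : continuous rr.
Proof.
by move=> s; apply: cvgD; [exact: cvg_cst|apply: cvgM; [exact: cvg_cst|exact: cvg_id]].
Qed.

Let crad f s : I (rr s) -> C1_on rad f -> {for s, continuous (f \o rr)}.
Proof. by move=> Is fC; apply: continuous_comp; [exact: crr|exact: C1_continuous]. Qed.

Let cvp (w : R -> R) s : {for s, continuous w} -> {for s, continuous (fun t => `|w t| `^ p)}.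
Proof.
by move=> cw; apply: (@continuous_comp _ _ _ w (fun t => `|t| `^ p)) => //; exact: continuous_norm_powR.
Qed.

(** On a compact interval inside the domain of the pair every integrand is continuous, hence every
    integral is finite; this permits the rearrangement without differences of integrals. *)
Lemma picone_integral (a b : R) : a < b -> (forall s, a <= s <= b -> I (rr s)) ->
  (\int[leb]_(s in `[a, b]) (V (rr s) * `|dv s| `^ p)%:E =
   \int[leb]_(s in `[a, b]) (W (rr s) * `|v s| `^ p)%:E +
   \int[leb]_(s in `[a, b]) (V (rr s) * Cp p (dv s) (dv s - e * v s * log_slope (rr s)))%:E +
   (e * (skel (rr b) * `|v b| `^ p) - e * (skel (rr a) * `|v a| `^ p))%:E)%E.
Proof.
move=> ab abI.
have cG s : a <= s <= b -> {for s, continuous (fun s => V (rr s) * `|dv s| `^ p)}.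
  by move=> /abI Is; apply: cvgM; [exact: crad|apply: cvp; exact: cdv].
have cP s : a <= s <= b -> {for s, continuous (fun s => W (rr s) * `|v s| `^ p)}.
  by move=> /abI Is; apply: cvgM; [exact: crad|apply: cvp; exact: cv].
have cC s : a <= s <= b ->
    {for s, continuous (fun s => V (rr s) * Cp p (dv s) (dv s - e * v s * log_slope (rr s)))}.
  move=> /abI Is; apply: cvgM; first exact: crad.
  have cz : {for s, continuous (fun s => e * v s * log_slope (rr s))}.
    apply: cvgM; first by apply: cvgM; [exact: cvg_cst|exact: cv].
    apply: (@continuous_comp _ _ _ rr log_slope); first exact: crr.
    exact: continuous_log_slope.
  have E : (fun s => Cp p (dv s) (dv s - e * v s * log_slope (rr s))) = (fun s => `|dv s| `^ p +
      (p - 1) * `|e * v s * log_slope (rr s)| `^ p - p * (spow p (e * v s * log_slope (rr s)) * dv s)).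
    by apply/funext => t; rewrite CpE.
  suff : {for s, continuous (fun s => `|dv s| `^ p +
      (p - 1) * `|e * v s * log_slope (rr s)| `^ p - p * (spow p (e * v s * log_slope (rr s)) * dv s))}.
    by rewrite -E.
  apply: cvgB; last first.
    apply: cvgM; first exact: cvg_cst.
    apply: cvgM; last exact: cdv.
    apply: (@continuous_comp _ _ _ (fun s => e * v s * log_slope (rr s)) (spow p)) => //.
    exact: continuous_spow.
  apply: cvgD; first by apply: cvp; exact: cdv.
  by apply: cvgM; [exact: cvg_cst|exact: (cvp cz)].
have within (f : R -> R) : (forall s, a <= s <= b -> {for s, continuous f}) ->
    {within `[a, b], continuous f}.
  move=> cf; apply: continuous_in_subspaceT => s; rewrite inE/= in_itv/=; exact: cf.
have int (f : R -> R) : (forall s, a <= s <= b -> {for s, continuous f}) ->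
    leb.-integrable `[a, b] (EFin \o f).
  by move=> cf; apply: continuous_compact_integrable; [exact: segment_compact|exact: within].
pose gG := fun s => V (rr s) * `|dv s| `^ p.
pose gP := fun s => W (rr s) * `|v s| `^ p.
pose gC := fun s => V (rr s) * Cp p (dv s) (dv s - e * v s * log_slope (rr s)).
pose H := fun s => e * (flux (rr s) * phi (rr s) `^ (1 - p) * `|v s| `^ p).
have dH s : a <= s <= b -> is_derive s 1 H (gG s - gP s - gC s).
  by move=> /abI Is; exact: picone_derive.
have cH s : a <= s <= b -> {for s, continuous H}.
  by move=> /dH [d _]; exact/differentiable_continuous/derivable1_diffP.
have ina : a <= a <= b by rewrite lexx ltW.
have inb : a <= b <= b by rewrite lexx ltW.
have key : (\int[leb]_(s in `[a, b]) (gG s - gP s - gC s)%:E = (H b)%:E - (H a)%:E)%E.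
  apply: continuous_FTC2 => //.
  - apply: within => s sab; apply: cvgB; last exact: cC.
    by apply: cvgB; [exact: cG|exact: cP].
  - split.
    + by move=> s; rewrite in_itv/= => /andP[h1 h2]; have [] := dH s _; rewrite ?ltW.
    + by apply: cvg_at_right_filter; exact: cH.
    + by apply: cvg_at_left_filter; exact: cH.
  - move=> s; rewrite in_itv/= => /andP[h1 h2].
    have sab : a <= s <= b by rewrite !ltW.
    by rewrite derive1E; have [_ ->] := dH s sab.
have iG := int _ cG; have iP := int _ cP; have iC := int _ cC.
have mab : measurable (`[a, b]%classic : set (measurableTypeR R)) by exact: measurable_itv.
have fin f : leb.-integrable `[a, b] (EFin \o f) ->
  (\int[leb]_(s in `[a, b]) (f s)%:E)%E \is a fin_num.
  by move=> fi; exact: integrable_fin_num.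
move: key; rewrite (_ : (fun s => (gG s - gP s - gC s)%:E) =
   (fun s => ((EFin \o gG) \- (EFin \o gP)) s - (EFin \o gC) s)%E); last by apply/funext.
rewrite integralB//; last exact: integrableB.
rewrite integralB// /H -!skelE; [|exact: abI..].
move: (fin _ iG) (fin _ iP) (fin _ iC).
rewrite /gG /gP /gC /=.
case: (\int[leb]_(s in _) (V _ * `|_| `^ p)%:E)%E => // x _.
case: (\int[leb]_(s in _) (W _ * _)%:E)%E => // y _.
case: (\int[leb]_(s in _) _)%E => // z _.
rewrite -!EFinB -!EFinD => -[E]; congr (_%:E).
by rewrite -E; ring.
Qed.

End line.

Lemma is_derive_continuous (f : R -> R) (x d : R) : is_derive x 1 f d -> {for x, continuous f}.
Proof. by move=> [h _]; exact/differentiable_continuous/derivable1_diffP. Qed.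

Lemma MVT_in (f df : R -> R) (a b : R) : a < b ->
  (forall x, a <= x <= b -> is_derive x 1 f (df x)) ->
  exists2 c, a < c < b & f b - f a = df c * (b - a).
Proof.
move=> ab fd; have [||c + E] := @MVT R f df a b ab.
- by move=> x; rewrite in_itv/= => /andP[h1 h2]; apply: fd; rewrite !ltW.
- apply: continuous_in_subspaceT => x; rewrite inE/= in_itv/= => /fd.
  exact: is_derive_continuous.
- by rewrite in_itv/= => cab; exists c.
Qed.

Lemma flux_le r s : I r -> I s -> r <= s -> flux s <= flux r.
Proof.
move=> Ir Is; rewrite le_eqVlt => /orP[/eqP->//|rs].
have [|c /andP[c1 c2] E] := @MVT_in flux (fun r => - (W r * phi r `^ (p - 1))) r s rs.
- by move=> x xrs; apply: flux_der; exact: in_interval_itv xrs.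
have Ic : I c by apply: (in_interval_itv Ir Is); rewrite !ltW.
have [_ Wc] := VW0 Ic.
rewrite -subr_le0 E mulNr oppr_le0 mulr_ge0//; last by rewrite subr_ge0 (ltW rs).
by rewrite mulr_ge0 ?powR_ge0// (ltW Wc).
Qed.

Section increasing_solution.
Hypothesis incr : forall r s, I r -> I s -> r <= s -> phi r <= phi s.

Lemma increasing_derive_ge0 r : I r -> 0 <= derive1 phi r.
Proof.
move=> Ir; have [dr _] := phi_der Ir.
have /nbhs_ballP[e /= e0 eI] : nbhs r [set r | I r].
  by apply: open_nbhs_nbhs; split => //; exact: in_interval_open.
rewrite derive1E /derive; apply: limr_ge; first exact: dr.
near=> h.
have h0 : h != 0 by near: h; exact: nbhs_dnbhs_neq.
have Ih : I (h + r).
  apply: eI; rewrite /ball/= opprD addrCA subrr addr0 normrN.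
  by near: h; apply: dnbhs0_lt.
rewrite /GRing.scale/= mulr1.
have [hp|hn] := ltP 0 h.
  by rewrite mulr_ge0 ?invr_ge0 ?(ltW hp)// subr_ge0 incr// lerDr (ltW hp).
have {}hn : h < 0 by rewrite lt_neqAle h0.
by rewrite mulr_le0 ?invr_le0 ?(ltW hn)// subr_le0 incr// gerDr (ltW hn).
Unshelve. all: end_near. Qed.

Lemma increasing_skel_ge0 r : I r -> 0 <= skel r.
Proof.
move=> Ir; have [V0 _] := VW0 Ir.
rewrite mulr_ge0 ?(ltW V0)// spow_ge0// divr_ge0 ?increasing_derive_ge0// ltW//.
exact: phi_gt0.
Qed.

(** Both factors in [skelE] are nonnegative and nonincreasing: [flux] by the equation, [phi^(1-p)]
    because [phi] increases. *)
Lemma increasing_skel_le r s : I r -> I s -> r <= s -> skel s <= skel r.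
Proof.
move=> Ir Is rs; rewrite !skelE//.
have fs0 : 0 <= flux s.
  by have [V0 _] := VW0 Is; rewrite mulr_ge0 ?(ltW V0)// spow_ge0// increasing_derive_ge0.
apply: ler_pM => //; [exact: powR_ge0|exact: flux_le|].
have p10 : 0 < p - 1 by rewrite subr_gt0.
rewrite -[1 - p]opprB !powRN lef_pV2 ?posrE ?powR_gt0 ?phi_gt0//.
by apply: ge0_ler_powR; [exact: ltW|rewrite nnegrE ltW ?phi_gt0|rewrite nnegrE ltW ?phi_gt0|exact: incr].
Qed.

(** Picone's identity for the constant function 1: the gradient term is 0 and the [C_p] term is
    nonnegative, so the integral of [W] is at most a difference of boundary values, one with a
    favourable sign and the other at most [skel c]. The bound does not depend on the length of the
    interval. *)
Lemma potential_line_bound (c r0 e a b : R) : `|e| = 1 -> a < b -> I c ->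
  (forall s, a <= s <= b -> c <= r0 + e * s /\ I (r0 + e * s)) ->
  (\int[leb]_(s in `[a, b]) (W (r0 + e * s))%:E <= (skel c)%:E)%E.
Proof.
move=> e1 ab Ic abI.
have ina : a <= a <= b by rewrite lexx ltW.
have inb : a <= b <= b by rewrite lexx ltW.
have [ca Ia] := abI _ ina; have [cb Ib] := abI _ inb.
have H := @picone_integral r0 e (cst 1) (cst 0) e1 (fun s => is_derive_cst _ _ _)
  (@cst_continuous _ _ 0) a b ab (fun s sab => (abI s sab).2).
move: H; rewrite integral0_eq; last first.
  by move=> s _; rewrite /= normr0 powR0 ?mulr0// gt_eqF// (lt_trans _ p1).
under eq_integral => s _ do rewrite /= normr1 powR1 mulr1.
rewrite /= normr1 powR1 !mulr1 => H.
have C0 : (0 <= \int[leb]_(s in `[a, b])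
    (V (r0 + e * s) * Cp p 0 (0 - e * log_slope (r0 + e * s)))%:E)%E.
  apply: integral_ge0 => s; rewrite /= in_itv/= => /abI [_ Is].
  have [V0 _] := VW0 Is.
  by rewrite lee_fin mulr_ge0 ?(ltW V0)// Cp_ge0.
have W0 : (0 <= \int[leb]_(s in `[a, b]) (W (r0 + e * s))%:E)%E.
  apply: integral_ge0 => s; rewrite /= in_itv/= => /abI [_ Is].
  by have [_ W0] := VW0 Is; rewrite lee_fin ltW.
apply: le_trans (ge0_adde_eq0 W0 C0 _) _.
  rewrite {1}H; congr (_ + _ + _)%E; apply: eq_integral => s _; by rewrite mulr1.
rewrite lee_fin.
have ska := increasing_skel_le Ic Ia ca; have skb := increasing_skel_le Ic Ib cb.
have ska0 := increasing_skel_ge0 Ia; have skb0 := increasing_skel_ge0 Ib.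
have : e = 1 \/ e = -1.
  by move/eqP: e1; rewrite eqr_norml => /andP[/orP[/eqP|/eqP] h _]; [left|right].
by case=> ee; rewrite ee in ska skb ska0 skb0 *; lra.
Qed.

(** A positive lower limit would give [W >= eta] beyond some [c], and an interval of length
    [(skel c + 1) / eta] would violate [potential_line_bound]. *)
Lemma W_at_pinfty_increasing : rad = +oo%E -> W_at W +oo%E = 0%E.
Proof.
move=> radoo; rewrite /W_at /at_ext limf_einfE; apply/eqP; rewrite eq_le; apply/andP; split; last first.
  apply: le_ereal_sup_tmp; exists (ereal_inf [set (EFin \o W) x | x in [set x | 0 < x]]).
    by exists [set x | 0 < x] => //; exists 0; split; rewrite ?num_real.
  apply/le_ereal_inf_tmp => _ [x /= x0 <-].
  have [|_ W0] := @VW0 x; last by rewrite lee_fin ltW.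
  by split => //; rewrite radoo ltry.
apply: ge_ereal_sup => _ [A [M [_ MA]] <-]; rewrite leNgt; apply/negP => H.
have [eta eta0 etaW] : exists2 eta, 0 < eta & forall r, M < r -> eta <= W r.
  move: H; case E : (ereal_inf _) => [y| |]//; rewrite ?lte_fin => y0.
    exists y => // r Mr; rewrite -lee_fin -E; apply: ereal_inf_lbound; exists r => //.
    exact: MA.
  exists 1 => // r Mr; rewrite -lee_fin; apply: (@le_trans _ _ +oo%E); first by rewrite leey.
  rewrite -E; apply: ereal_inf_lbound; exists r => //; exact: MA.
pose c := Num.max M 0 + 1.
have Mc : M < c by rewrite /c ltr_pwDr// le_max lexx.
have c0 : 0 < c by rewrite /c ltr_pwDr// le_max lexx orbT.
have Ioo r : 0 < r -> I r by move=> r0; split => //; rewrite radoo ltry.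
pose k := (skel c + 1) / eta.
have skc := increasing_skel_ge0 (Ioo _ c0).
have k0 : 0 < k by rewrite divr_gt0// ltr_pwDr.
have := @potential_line_bound c 0 1 c (c + k) (normr1 _) _ (Ioo _ c0) _.
rewrite ltrDl => /(_ k0) /(_ _) H2.
have {H2} : (\int[leb]_(s in `[c, (c + k)%R]) (W (0 + 1 * s))%:E <= (skel c)%:E)%E.
  apply: H2 => s /andP[cs _]; rewrite add0r mul1r; split => //.
  by apply: Ioo; exact: lt_le_trans cs.
rewrite leNgt => /negP; apply.
apply: (@lt_le_trans _ _ (\int[leb]_(s in `[c, (c + k)%R]) (eta%:E))%E).
  rewrite integral_cst//= lebesgue_measure_itv/= lte_fin ltrDl k0.
  rewrite -EFinD -EFinM lte_fin (addrC c) addrK /k mulrC divfK ?gt_eqF//.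
  by rewrite ltrDl.
apply: ge0_le_integral => //.
- by move=> s _; rewrite lee_fin ltW.
- apply: (@measurable_int _ _ _ leb); apply: continuous_compact_integrable.
    exact: segment_compact.
  apply: continuous_in_subspaceT => s; rewrite inE/= in_itv/= => /andP[cs _].
  apply: (@continuous_comp _ _ _ (fun s : R => 0 + 1 * s) W).
    by apply: cvgD; [exact: cvg_cst|apply: cvgM; [exact: cvg_cst|exact: cvg_id]].
  apply: C1_continuous => //; rewrite add0r mul1r.
  by apply: Ioo; exact: lt_le_trans cs.
- move=> s; rewrite /= in_itv/= => /andP[cs _]; rewrite lee_fin add0r mul1r.
  by apply: etaW; exact: lt_le_trans cs.
Qed.

End increasing_solution.

Section not_increasing_solution.
Hypothesis nincr : ~ (forall r s, I r -> I s -> r <= s -> phi r <= phi s).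

(** Where [phi] decreases, the mean value theorem finds a negative derivative. Since [flux] is
    nonincreasing, it stays negative to the right of [xi]. *)
Lemma not_increasing_flux : exists2 xi, I xi & flux xi < 0.
Proof.
apply: contrapT => H; apply: nincr => r s Ir Is; rewrite le_eqVlt => /orP[/eqP->//|rs].
have [|c /andP[c1 c2] E] := @MVT_in phi (derive1 phi) r s rs.
- by move=> x xrs; apply: phi_der; exact: in_interval_itv xrs.
have Ic : I c by apply: (in_interval_itv Ir Is); rewrite !ltW.
rewrite -subr_ge0 E mulr_ge0 ?subr_ge0 ?(ltW rs)// leNgt; apply/negP => p0.
apply: H; exists c => //; have [Vc _] := VW0 Ic.
by rewrite /flux pmulr_rlt0// spow_lt0.
Qed.

Lemma skel_le0 xi r : I xi -> I r -> flux xi < 0 -> xi <= r -> skel r <= 0.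
Proof.
move=> Ixi Ir fxi xir; rewrite skelE// mulr_le0_ge0 ?powR_ge0//.
exact: le_trans (flux_le Ixi Ir xir) (ltW fxi).
Qed.

(** If [V] were bounded by [B] near infinity, [flux <= - eta] would force [phi' <= - k] with
    [k^(p-1) = eta / B], and the positive function [phi] would become negative within a distance
    [(phi a + 1) / k]. *)
Lemma V_at_pinfty_not_increasing : rad = +oo%E -> V_at V +oo%E = +oo%E.
Proof.
move=> radoo; rewrite /V_at /at_ext limf_esupE; apply/eqP; rewrite -leye_eq.
apply/le_ereal_inf_tmp => _ [A [M [_ MA]] <-]; rewrite leye_eq; apply/eqP.
apply: contrapT => Hsup.
have [xi Ixi fxi] := not_increasing_flux.
have Ioo r : 0 < r -> I r by move=> r0; split => //; rewrite radoo ltry.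
pose a := Num.max (Num.max M xi) 0 + 1.
have Ma : M < a by rewrite /a ltr_pwDr// !le_max lexx.
have xia : xi <= a by rewrite /a ltW// ltr_pwDr// !le_max lexx orbT.
have a0 : 0 < a by rewrite /a ltr_pwDr// le_max lexx orbT.
have [B BV] : exists B, forall r, M < r -> V r <= B.
  move: Hsup; case E : (ereal_sup _) => [y| |]// _.
    exists y => r Mr; rewrite -lee_fin -E; apply: ereal_sup_ubound; exists r => //.
    exact: MA.
  exists 0 => r Mr; rewrite -lee_fin; apply: (@le_trans _ _ -oo%E); last by rewrite leNye.
  by rewrite -E; apply: ereal_sup_ubound; exists r => //; exact: MA.
have B0 : 0 < B by have [V0 _] := VW0 (Ioo _ a0); exact: lt_le_trans V0 (BV _ Ma).
pose eta := - flux xi; have eta0 : 0 < eta by rewrite oppr_gt0.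
pose k := (eta / B) `^ (p - 1)^-1.
have k0 : 0 < k by rewrite powR_gt0// divr_gt0.
have p10 : 0 < p - 1 by rewrite subr_gt0.
have slope r : a <= r -> derive1 phi r <= - k.
  move=> ar; have r0 : 0 < r := lt_le_trans a0 ar.
  have fr : flux r <= - eta by rewrite opprK flux_le// ?(le_trans xia)//; exact: Ioo.
  have [Vr _] := VW0 (Ioo _ r0).
  have VB : V r <= B by apply: BV; exact: lt_le_trans ar.
  have dneg : derive1 phi r < 0.
    rewrite ltNge; apply/negP => d0; have : 0 <= flux r.
      by rewrite mulr_ge0 ?spow_ge0// (ltW Vr).
    by move=> h; move: (le_trans h fr); rewrite lerNr oppr0 leNgt eta0.
  rewrite lerNr leNgt; apply/negP => dk.
  have : (- derive1 phi r) `^ (p - 1) < k `^ (p - 1).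
    by apply: gt0_ltr_powR => //; rewrite nnegrE ?oppr_ge0 ltW.
  rewrite /k -powRrM mulVf ?gt_eqF// powRr1 ?divr_ge0 ?(ltW eta0) ?(ltW B0)//.
  rewrite -(spow_gt0 p1) ?oppr_gt0// spowN ltr_pdivlMr//.
  apply/negP; rewrite -leNgt.
  apply: (@le_trans _ _ (- spow p (derive1 phi r) * V r)).
    by move: fr; rewrite /flux lerNr mulrC mulNr.
  by apply: ler_wpM2l => //; rewrite oppr_ge0 ltW// spow_lt0.
pose b := a + (phi a + 1) / k.
have pa := phi_gt0 (Ioo _ a0).
have ab : a < b by rewrite ltrDl divr_gt0// ltr_pwDr// ltW.
have [|c /andP[c1 c2] E] := @MVT_in phi (derive1 phi) a b ab.
  by move=> x /andP[x1 _]; apply: phi_der; apply: Ioo; exact: lt_le_trans x1.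
have pb : 0 < phi b by apply: phi_gt0; apply: Ioo; exact: lt_trans ab.
have : phi b - phi a <= - k * (b - a).
  by rewrite E ler_wpM2r ?subr_ge0 ?(ltW ab)// slope// ltW.
have -> : b - a = (phi a + 1) / k by rewrite /b addrC addKr.
by rewrite mulNr mulrC divfK ?gt_eqF//; lra.
Qed.

End not_increasing_solution.

Lemma V_at_pinfty_ge0 : rad = +oo%E -> (0 <= V_at V +oo%E)%E.
Proof.
move=> radoo; rewrite /V_at /at_ext limf_esupE.
apply/le_ereal_inf_tmp => _ [A [M [_ MA]] <-].
pose a := Num.max M 0 + 1.
have Ma : M < a by rewrite /a ltr_pwDr// !le_max lexx.
have a0 : 0 < a by rewrite /a ltr_pwDr// le_max lexx orbT.
apply: (@le_trans _ _ (V a)%:E); last by apply: ereal_sup_ubound; exists a => //; exact: MA.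
by have [|V0 _] := @VW0 a; [split => //; rewrite radoo ltry|rewrite lee_fin ltW].
Qed.

Lemma W_at_pinfty_ge0 : rad = +oo%E -> (0 <= W_at W +oo%E)%E.
Proof.
move=> radoo; rewrite /W_at /at_ext limf_einfE.
apply: le_ereal_sup_tmp; exists (ereal_inf [set (EFin \o W) x | x in [set x | 0 < x]]).
  by exists [set x | 0 < x] => //; exists 0; split; rewrite ?num_real.
apply/le_ereal_inf_tmp => _ [x /= x0 <-].
have [|_ W0] := @VW0 x; last by rewrite lee_fin ltW.
by split => //; rewrite radoo ltry.
Qed.
End bessel.

(** * Test functions along lines *)

Section line_derivative.
Context {R : realType} {n : nat}.
Implicit Types (u : 'rV[R]_n -> R) (x v : 'rV[R]_n).

Let line_quotient u x v (s : R) :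
  (fun h : R => h^-1 *: (((fun t : R => u (x + t *: v)) \o shift s) (h *: 1) - u (x + s *: v))) =
  (fun h : R => h^-1 *: ((u \o shift (x + s *: v)) (h *: v) - u (x + s *: v))).
Proof.
apply/funext => h /=; congr (_ *: (u _ - _)).
have -> : h *: (1 : R) = h by exact: mulr1.
by rewrite scalerDl addrCA.
Qed.

Lemma derivable_lineE u x v (s : R) :
  derivable (fun t : R => u (x + t *: v)) s 1 = derivable u (x + s *: v) v.
Proof. by rewrite /derivable line_quotient. Qed.

Lemma derive_lineE u x v (s : R) :
  'D_1 (fun t : R => u (x + t *: v)) s = 'D_v u (x + s *: v).
Proof. by rewrite /derive line_quotient. Qed.

Lemma is_derive_lineP u x v (s d : R) :
  is_derive s 1 (fun t : R => u (x + t *: v)) d <-> is_derive (x + s *: v) v u d.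
Proof.
split=> -[h E]; apply: DeriveDef.
- by move: h; rewrite derivable_lineE.
- by rewrite -E derive_lineE.
- by rewrite derivable_lineE.
- by rewrite derive_lineE.
Qed.

Variable u : 'rV[R]_n -> R.
Hypothesis uC1 : Ck 1 u.

Let u_der x i : derivable u x (delta_mx ord0 i).
Proof. by have [_ /(_ i) []] := uC1. Qed.

Let cpartial i : continuous (partial i u).
Proof. by have [_ /(_ i) [_ []]] := uC1. Qed.

Definition dirder v x : R := edot (gradient u x) v.

Lemma mvt_coord x i (h : R) :
  exists2 c : R, `|c| <= `|h| &
    u (x + h *: delta_mx ord0 i) - u x = h * partial i u (x + c *: delta_mx ord0 i).
Proof.
pose f (t : R) := u (x + t *: delta_mx ord0 i).
pose df (t : R) := partial i u (x + t *: delta_mx ord0 i).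
have fd (t : R) : is_derive t 1 f (df t).
  by apply/is_derive_lineP; apply: DeriveDef => //; exact: u_der.
have cf : continuous f.
  by move=> t; apply/differentiable_continuous/derivable1_diffP; have [] := fd t.
have f0 : f 0 = u x by rewrite /f scale0r addr0.
have [h0|h0|h0] := ltgtP 0 h.
- have [c] := @MVT _ f df 0 h h0 (fun t _ => fd t) (continuous_subspaceT cf).
  rewrite in_itv/= => /andP[c0 ch]; rewrite f0 subr0 mulrC => E.
  by exists c => //; rewrite !ger0_norm ?ltW.
- have [c] := @MVT _ f df h 0 h0 (fun t _ => fd t) (continuous_subspaceT cf).
  rewrite in_itv/= => /andP[hc c0]; rewrite f0 sub0r => E.
  exists c; first by rewrite !ltr0_norm// lerN2 ltW.
  by rewrite -/(f h) -/(df c) -opprB E; ring.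
- by exists 0; rewrite -h0 ?normr0// scale0r addr0 subrr mul0r.
Qed.

(** [Ck] only speaks of partial derivatives along the coordinates. The increment along [v] is
    telescoped: [y k t] has moved in the first [k] coordinates, each step is a mean value taken at
    the offset [c k t], and continuity of the partial derivatives gives the limit. *)
Lemma is_derive_dirder0 x v : is_derive (0 : R) 1 (fun t : R => u (x + t *: v)) (dirder v x).
Proof.
pose y (k : nat) (t : R) : 'rV[R]_n := x + t *: (\row_i (if (i < k)%N then v ord0 i else 0)).
pose c (k : 'I_n) (t : R) := sval (cid2 (mvt_coord (y k t) k (t * v ord0 k))).
have cP k t : `|c k t| <= `|t * v ord0 k| /\
   u (y k t + (t * v ord0 k) *: delta_mx ord0 k) - u (y k t) =
   t * v ord0 k * partial k u (y k t + c k t *: delta_mx ord0 k).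
  by rewrite /c; case: cid2.
have yS (k : 'I_n) t : y k.+1 t = y k t + (t * v ord0 k) *: delta_mx ord0 k.
  rewrite /y -addrA; congr (x + _); apply/rowP => i; rewrite !mxE eqxx/=.
  have [->|ik] := eqVneq i k; first by rewrite ltnS leqnn ltnn mulr0 add0r mulr1.
  rewrite mulr0 addr0 ltnS leq_eqVlt.
  by rewrite (_ : (i == k :> nat) = false)//; apply/negbTE.
apply/is_derive1_caratheodory.
exists (fun t => \sum_(k < n) v ord0 k * partial k u (y k t + c k t *: delta_mx ord0 k)).
have y0 k : y k 0 = x by rewrite /y scale0r addr0.
have c0 k : c k 0 = 0.
  by have [] := cP k 0; rewrite mul0r normr0 normr_le0 => /eqP.
split.
- move=> z; rewrite subr0 scale0r addr0.
  have -> : x + z *: v = y n z.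
    by rewrite /y; congr (_ + _ *: _); apply/rowP => i; rewrite !mxE ltn_ord.
  rewrite -[in u x](y0 0%N).
  have -> : y 0%N 0 = y 0%N z.
    by rewrite y0 /y; apply/rowP => i; rewrite !mxE ltn0 mulr0 addr0.
  rewrite -(telescope_sumr (fun k => u (y k z)) (leq0n n)) big_mkord mulr_suml.
  by apply: eq_bigr => k _; rewrite yS (cP k z).2; ring.
- rewrite /continuous_at.
  apply: cvg_big => [|k _]; first exact: add_continuous.
  apply: cvgM; first exact: cvg_cst.
  apply: (@continuous_comp _ _ _ (fun t => y k t + c k t *: delta_mx ord0 k) (partial k u)); last first.
    exact: cpartial.
  change (y k t + c k t *: delta_mx ord0 k @[t --> (0 : R)] -->
    y k 0 + c k 0 *: (delta_mx ord0 k : 'rV[R]_n)).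
  rewrite y0 c0 scale0r addr0.
  rewrite -[X in _ --> X]addr0; apply: cvgD.
    rewrite -[X in _ --> X](y0 k); exact: line_continuous.
  rewrite -(scale0r (delta_mx ord0 k : 'rV[R]_n)); apply: cvgZr_tmp.
  apply/cvgr0Pnorm_le => e e0.
  have v0 : 0 < `|v ord0 k| + 1 by rewrite ltr_pwDr.
  apply/nbhs_ballP; exists (e / (`|v ord0 k| + 1)) => /=; first by rewrite divr_gt0.
  move=> t; rewrite /ball/= sub0r normrN ltr_pdivlMr// => /ltW te.
  apply: le_trans te; apply: le_trans (cP k t).1 _.
  by rewrite normrM ler_wpM2l// lerDl.
- by rewrite /dirder /edot; apply: eq_bigr => k _; rewrite y0 c0 scale0r addr0 mxE mulrC.
Qed.

Lemma is_derive_dirder x v (s : R) :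
  is_derive s 1 (fun t : R => u (x + t *: v)) (dirder v (x + s *: v)).
Proof.
apply/is_derive_lineP; rewrite -[X in is_derive X](addr0 (x + s *: v)) -(scale0r v).
apply/is_derive_lineP; exact: is_derive_dirder0.
Qed.

Lemma deriveE_dirder x v : 'D_v u x = dirder v x.
Proof.
have := is_derive_dirder x v 0; rewrite scale0r addr0 => -[_ <-].
by rewrite derive_lineE scale0r addr0.
Qed.

Lemma continuous_dirder : continuous (fun z : 'rV[R]_n * 'rV[R]_n => dirder z.1 z.2).
Proof.
move=> [v x]; rewrite /continuous_at /dirder /edot.
apply: cvg_big => [|i _]; first exact: add_continuous.
apply: cvgM; last first.
  apply: (@continuous_comp _ _ _ fst (fun w : 'rV[R]_n => w ord0 i)); first exact: cvg_fst.
  exact: coord_continuous.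
under eq_fun do rewrite mxE.
rewrite mxE.
apply: (@continuous_comp _ _ _ snd (partial i u)); [exact: cvg_snd|exact: cpartial].
Qed.

Lemma continuous_dirder_line x v : continuous (fun t : R => dirder v (x + t *: v)).
Proof.
move=> t; apply: (@continuous_comp _ _ _ (fun t : R => x + t *: v) (dirder v)); first exact: line_continuous.
apply: (@continuous_comp _ _ _ (fun y => (v, y)) (fun z : 'rV[R]_n * 'rV[R]_n => dirder z.1 z.2)).
  by apply: (@cvg_pair _ _ _ (nbhs (x + t *: v)) (nbhs v) (nbhs (x + t *: v))); [exact: cvg_cst|exact: cvg_id].
exact: continuous_dirder.
Qed.

End line_derivative.

Section test_function.
Context {R : realType} {n : nat}.
Variables (Omega : set 'rV[R]_n) (u : 'rV[R]_n -> R).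
Hypothesis oOmega : open Omega.
Hypothesis tu : test_function Omega u.

Definition supp : set 'rV[R]_n := closure [set x | u x != 0].

Lemma test_function_C1 : Ck 1 u. Proof. by have [] := tu. Qed.

Lemma test_function_continuous : continuous u. Proof. by have [+ _] := tu; move=> /(_ 0%N) []. Qed.

Lemma supp_compact : compact supp. Proof. by have [_ []] := tu. Qed.

Lemma notin_supp0 x : ~ supp x -> u x = 0.
Proof.
by move=> xK; apply/eqP; rewrite -[_ == _]negbK; apply/negP => ux; apply: xK; exact: subset_closure.
Qed.

Lemma notin_supp_dirder0 v x : ~ supp x -> dirder u v x = 0.
Proof.
move=> xK.
have oC : open (~` supp) by apply: closed_openC; exact: closed_closure.
have := is_derive_dirder test_function_C1 x v 0; rewrite scale0r addr0 => -[_ <-].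
rewrite (@near_eq_derive _ _ _ _ (cst 0)) ?derive_cst//.
have : nbhs (x + (0 : R) *: v) (~` supp).
  by rewrite scale0r addr0; exact: open_nbhs_nbhs.
move=> H; have H2 : \forall a \near (0 : R), (~` supp) (x + a *: v) := @line_continuous _ _ v x 0 _ H.
by near=> a; apply: notin_supp0; near: a.
Unshelve. all: end_near.
Qed.

(** A ball around each point of the support fits in [Omega], and compactness makes the radius
    uniform. This keeps the support away from the ends of all chords at once, whatever their
    direction. *)
Lemma supp_gap : exists2 c : R, 0 < c & forall (x y : 'rV[R]_n),
  supp x -> (forall i, `|x ord0 i - y ord0 i| < c) -> Omega y.
Proof.
have := (compact_near_coveringP supp).1 supp_compact.
move=> /(_ R (0^'+) (fun e x => forall y : 'rV[R]_n, (forall i, `|x ord0 i - y ord0 i| < e) -> Omega y) _) K.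
have : \forall e \near (0 : R)^'+, supp `<=` (fun x => forall y : 'rV[R]_n, (forall i, `|x ord0 i - y ord0 i| < e) -> Omega y).
  apply: K => x xK.
  have : nbhs x Omega.
    by apply: open_nbhs_nbhs; split => //; have [_ [_]] := tu; exact.
  move=> /nbhs_ballP[e /= e0 eO].
  have e20 : 0 < e / 2 by rewrite divr_gt0.
  near=> z a.
  have ae : a <= e / 2 by near: a; exact: nbhs_right_le.
  move=> y zy; apply: eO; apply/(rV_ballE _ _ e0) => i.
  rewrite (le_lt_trans (ler_distD (z ord0 i) _ _))// (splitr e) ltrD//.
    have : ball x (e / 2) z by near: z; exact: nbhsx_ballx.
    by move=> /(rV_ballE _ _ e20).
  exact: (lt_le_trans (zy i)).
move=> H.
have [c c0 cP] : exists2 c : R, 0 < c & supp `<=` (fun x => forall y : 'rV[R]_n, (forall i, `|x ord0 i - y ord0 i| < c) -> Omega y).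
  near (0 : R)^'+ => c; exists c => //.
  by near: c.
by exists c => // x y xK; exact: cP.
Unshelve. all: end_near. Qed.

Lemma supp_bounded : exists k : nat, forall x, supp x -> forall i, `|x ord0 i| <= k%:R.
Proof.
have [M [_ MP]] := compact_bounded supp_compact.
pose B := Num.max M 0 + 1.
exists (Num.trunc B).+1 => x xK i.
have B0 : M < B by rewrite /B ltr_pwDr// le_max lexx.
apply: le_trans (ltW (truncnS_gt B)).
apply: le_trans (MP _ B0 _ xK).
rewrite /Num.norm/= mx_normrE; exact: (le_bigmax _ (fun ij => `|x ij.1 ij.2|) (ord0, i)).
Qed.

Lemma test_function_bounded : exists2 M : R, 0 <= M & forall x, `|u x| <= M.
Proof.
have cu := test_function_continuous.
have := @compact_bounded _ _ _ (continuous_compact (continuous_subspaceT cu) supp_compact).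
move=> [M [_ MP]].
pose B := Num.max M 0 + 1.
have B0 : M < B by rewrite /B ltr_pwDr// le_max lexx.
exists B; first by rewrite /B addr_ge0// le_max lexx orbT.
move=> x; have [xK|xK] := pselect (supp x).
  by apply: (MP _ B0); exists x.
by rewrite (notin_supp0 xK) normr0 /B addr_ge0// le_max lexx orbT.
Qed.

End test_function.

(** * Reflections and shifts of integrals on the line *)

Section reflection.
Context {R : realType}.
Local Open Scope ereal_scope.
Local Notation leb := (@lebesgue_measure R).

Lemma ge0_integral_opp (f : R -> \bar R) :
  measurable_fun [set: R] f -> (forall x, 0 <= f x) ->
  \int[leb]_x f (- x)%R = \int[leb]_x f x.
Proof.
move=> mf f0.
have mc : measurable_fun setT (fun x : measurableTypeR R => - x : measurableTypeR R)%R.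
  exact: measurable_funN.
rewrite -[LHS](@ge0_integral_pushforward _ _ _ _ R _ mc leb setT f)//.
apply: eq_measure_integral => A mA _; exact: lebesgue_measureN.
Qed.

Lemma integral_set_opp (D : set R) (f : R -> \bar R) :
  measurable D -> measurable_fun [set: R] f -> (forall x, 0 <= f x) ->
  \int[leb]_(x in [set x | D (- x)%R]) f (- x)%R = \int[leb]_(x in D) f x.
Proof.
move=> mD mf f0; rewrite integral_mkcond [RHS]integral_mkcond.
rewrite -(@ge0_integral_opp (f \_ D)).
- by apply: eq_integral => x _; rewrite /patch; congr (if _ then _ else _);
    apply/idP/idP; rewrite !inE.
- by apply/(measurable_restrictT _ _).1 => //; exact: measurable_funS mf.
- by move=> x; rewrite /patch; case: ifP.
Qed.

Lemma integral_set_shift (D : set R) (c : R) (f : R -> \bar R) :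
  measurable D -> measurable_fun [set: R] f -> (forall x, 0 <= f x) ->
  \int[leb]_(x in [set x | D (x + c)%R]) f (x + c)%R = \int[leb]_(x in D) f x.
Proof.
move=> mD mf f0; rewrite integral_mkcond [RHS]integral_mkcond.
rewrite -(@ge0_integralD_shift _ c (f \_ D)).
- by apply: eq_integral => x _; rewrite /patch; congr (if _ then _ else _);
    apply/idP/idP; rewrite !inE.
- by apply/(measurable_restrictT _ _).1 => //; exact: measurable_funS mf.
- by move=> x; rewrite /patch; case: ifP.
Qed.

End reflection.

(** * The identity on a line *)

Section component_principle.
Context {R : realType} {n : nat}.
Variable Omega : set 'rV[R]_n.
Hypothesis oOmega : open Omega.
Local Open Scope ereal_scope.
Local Notation leb := (@lebesgue_measure R).
Implicit Types nu x : 'rV[R]_n.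

Lemma chord_open nu x : open (chord Omega nu x).
Proof.
rewrite (_ : chord _ _ _ = (fun s : R => x + s *: nu)%R @^-1` Omega)//.
by apply: open_comp => // s _; exact: line_continuous.
Qed.

Lemma measurable_line nu x : measurable_fun [set: R] (fun s : R => x + s *: nu)%R.
Proof. by apply: measurable_fun_line => //; exact: measurable_cst. Qed.

(** An interval of the decomposition and the union of the others are open and disjoint, hence
    separated, so a connected set meeting the first stays inside it. This enumerates the components,
    so that integrals over them can be summed. *)
Lemma open_disjoint_itv_component (U : set R) (oU : open U) k t : open_disjoint_itv oU k t ->
  open_disjoint_itv oU k = connected_component U t.
Proof.
set I := open_disjoint_itv oU => It.
have UI : U = \bigcup_q I q := open_disjoint_itv_bigcup oU.
have tI : trivIset setT I := @open_disjoint_itv_trivIset _ _ oU.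
apply/seteqP; split.
  apply: connected_component_max => //.
    by rewrite UI => s Is; exists k.
  by apply/connected_intervalP; exact: open_disjoint_itv_is_interval.
pose J := \bigcup_(j in [set j | j != k]) I j.
have oI j : open (I j) by exact: open_disjoint_itv_open.
have oJ : open J by apply: bigcup_open => j _.
have IJ0 : I k `&` J = set0.
  apply/seteqP; split => // s [Is [j /= jk Js]].
  by move: jk; rewrite (tI j k Logic.I Logic.I)// ?eqxx//; exists s.
have clo (A B : set R) : open B -> A `&` B = set0 -> closure A `&` B = set0.
  move=> oB AB; apply/seteqP; split => // s [cA Bs].
  have [w Hw] := cA _ (open_nbhs_nbhs (conj oB Bs)).
  by move: Hw; rewrite AB.
have [|||//|CJ] := @connected_subset _ (I k) J (connected_component U t).
- split; first by apply: clo.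
  by rewrite setIC; apply: clo => //; rewrite setIC.
- move=> s /connected_component_sub; rewrite UI => -[j _ Ijs].
  by have [jk|jk] := eqVneq j k; [left; rewrite -jk|right; exists j].
- exact: component_connected.
- have : J t by apply: CJ; apply: connected_component_refl; rewrite UI; exists k.
  by move=> Jt; have : (I k `&` J) t by []; rewrite IJ0.
Qed.

Lemma measurable_seg nu x : measurable (seg Omega nu x).
Proof.
apply: is_interval_measurable => a b /= ha hb c cab.
exact: (seg_itv ha hb).
Qed.

(** Both functions vanish off [Omega], so each line integral is a countable sum over components;
    re-basing a component at one of its points turns it into a [seg]. *)
Lemma integral_line_components (A B : 'rV[R]_n -> \bar R) nu :
  measurable_fun setT A -> measurable_fun setT B ->
  (forall x, 0 <= A x) -> (forall x, 0 <= B x) ->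
  (forall x, ~ Omega x -> A x = 0) -> (forall x, ~ Omega x -> B x = 0) ->
  (forall x, Omega x -> \int[leb]_(s in seg Omega nu x) A (x + s *: nu)%R =
                        \int[leb]_(s in seg Omega nu x) B (x + s *: nu)%R) ->
  forall x, \int[leb]_s A (x + s *: nu)%R = \int[leb]_s B (x + s *: nu)%R.
Proof.
move=> mA mB A0 B0 AO BO AB x.
have oU : open (chord Omega nu x) := @chord_open nu x.
pose I := open_disjoint_itv oU.
have mI k : measurable (I k : set (measurableTypeR R)).
  by apply: is_interval_measurable; exact: open_disjoint_itv_is_interval.
have mU : measurable (chord Omega nu x : set (measurableTypeR R)) by exact: open_measurable.
have reduce (C : 'rV[R]_n -> \bar R) : measurable_fun setT C -> (forall x, 0 <= C x) ->
    (forall x, ~ Omega x -> C x = 0) ->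
    \int[leb]_s C (x + s *: nu)%R = \sum_(k <oo) \int[leb]_(s in I k) C (x + s *: nu)%R.
  move=> mC C0 CO.
  have mCl : measurable_fun setT (fun s : R => C (x + s *: nu)%R).
    exact: measurableT_comp mC (measurable_line nu x).
  rewrite -ge0_integral_bigcup//.
  - rewrite -(open_disjoint_itv_bigcup oU) [RHS]integral_mkcond.
    apply: eq_integral => s _; rewrite /patch; case: ifPn => // sU.
    by apply: CO => xO; move: sU; rewrite notin_setE.
  - exact: measurable_funS mCl.
  - exact: open_disjoint_itv_trivIset.
rewrite (reduce A)// (reduce B)//; apply: eq_eseriesr => k _.
have [->|/set0P[t It]] := eqVneq (I k) set0; first by rewrite !integral_set0.
have xtO : Omega (x + t *: nu)%R.
  have : (\bigcup_q I q) t by exists k.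
  by rewrite -(open_disjoint_itv_bigcup oU).
have IE : I k = [set s | seg Omega nu (x + t *: nu)%R (s - t)%R].
  by rewrite /I (open_disjoint_itv_component It) component_seg.
have key (C : 'rV[R]_n -> \bar R) : measurable_fun setT C -> (forall x, 0 <= C x) ->
    \int[leb]_(s in I k) C (x + s *: nu)%R =
    \int[leb]_(s in seg Omega nu (x + t *: nu)%R) C (x + t *: nu + s *: nu)%R.
  move=> mC C0.
  rewrite -[RHS](@integral_set_shift _ _ (- t)%R) => [|||//].
  - rewrite -IE; apply: eq_integral => s _; congr (C _).
    by rewrite -addrA -scalerDl subrKC.
  - exact: measurable_seg.
  - exact: measurableT_comp mC (measurable_line _ _).
by rewrite !key// AB.
Qed.

End component_principle.

Section mid_density.
Context {R : realType} {n : nat}.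
Variable Omega : set 'rV[R]_n.
Local Notation T2 := ('rV[R]_n * 'rV[R]_n)%type.

(* The density [1/L] averages out along a component to a point mass at its
   midpoint. *)
Definition mid_density (g : 'rV[R]_n -> R) (nu x : 'rV[R]_n) : \bar R :=
  if (rhop Omega nu x < +oo)%E && (rhop Omega (- nu) x < +oo)%E
  then (g (seg_mid Omega nu x) / seg_len Omega nu x)%:E else 0%E.

Lemma mid_density_ge0 g nu x : (forall y, 0 <= g y) -> (0 <= mid_density g nu x)%E.
Proof.
move=> g0; rewrite /mid_density; case: ifP => // _; rewrite lee_fin divr_ge0//.
by rewrite /seg_len addr_ge0// fine_ge0// rhop_ge0.
Qed.

Hypothesis oOmega : open Omega.

Lemma measurable_mid_density (g : T2 -> R) : measurable_fun setT g ->
  measurable_fun setT (fun z : T2 => mid_density (fun m => g (z.1, m)) z.1 z.2).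
Proof.
move=> mg; rewrite /mid_density.
have m1 := measurable_rhop oOmega; have m2 := measurable_rhopN oOmega.
apply: measurable_fun_ifT; last exact: measurable_cst.
  by apply: measurable_and; apply: measurable_fun_lte => //; exact: measurable_cst.
apply/measurable_EFinP; apply: measurable_funM.
  apply: (measurableT_comp mg); apply/measurable_fun_pairP; split; first exact: measurable_fst.
  exact: measurable_seg_mid.
(* Lengths are nonnegative, so the inverse is the power of exponent -1, which is a measurable
   function. *)
rewrite (_ : (fun z : T2 => (seg_len Omega z.1 z.2)^-1) =
             (fun z : T2 => seg_len Omega z.1 z.2 `^ (-1))).
  exact: measurableT_comp (measurable_powR (-1)) (measurable_seg_len oOmega).
by apply/funext => z; rewrite powR_inv1// addr_ge0// fine_ge0// rhop_ge0.
Qed.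

End mid_density.

(** * Borel densities of the energies, the remainder and the skeletal terms *)

Section densities.
Context {R : realType} {n : nat}.
Variables (p : R) (rad : \bar R) (V W phi : R -> R).
Variables (Omega : set 'rV[R]_n) (d : \bar R) (u : 'rV[R]_n -> R).
Local Notation T2 := ('rV[R]_n * 'rV[R]_n)%type.
Local Notation I := (in_interval rad).

(* The restriction to the interval makes an arbitrary [f] Borel; [c] stands for
   the value of [f] at [+oo]. *)
Definition ext (f : R -> R) (c r : \bar R) : \bar R :=
  if r == +oo%E then (if rad == +oo%E then c else 0%E)
  else ((f \_ [set t | I t]) (fine r))%:E.

(** Because [bad] is saturated along lines, membership is constant on each component and the mask
    factors out of integrals over components. *)
Definition good : set T2 := [set z | Omega z.2 /\ ~ bad Omega d z].

(** The slope of [rho] along the line: 1 if the nearer end lies behind, -1 if it lies ahead. The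
    value 0 is taken at midpoints, which are negligible, and on full lines, where [rho] is
    constant. *)
Definition orient (z : T2) : R :=
  if (rhop Omega (- z.1)%R z.2 < rhop Omega z.1 z.2)%E then 1
  else if (rhop Omega z.1 z.2 < rhop Omega (- z.1)%R z.2)%E then -1 else 0.

Definition dG (z : T2) : \bar R :=
  (ext V (V_at V +oo) (rho Omega z.1 z.2) * (`|dirder u z.1 z.2| `^ p)%:E)%E.

(** The potential is split in two: [dP] takes the points at finite distance and [dF] the full lines,
    which may contribute to the potential energy but do not appear in the one-dimensional
    identity. *)
Definition dP (z : T2) : \bar R :=
  (ext W 0 (rho Omega z.1 z.2) * (`|u z.2| `^ p)%:E)%E.

Definition dF (z : T2) : \bar R :=
  (ext (cst 0%R) (W_at W +oo) (rho Omega z.1 z.2) * (`|u z.2| `^ p)%:E)%E.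

(** The second argument of [Cp] is [phi * D_nu (u / phi)] after the quotient rule, with [orient] for
    the derivative of [rho]; in this form measurability follows from that of its ingredients. *)
Definition dC (z : T2) : \bar R :=
  (ext V (V_at V +oo) (rho Omega z.1 z.2) *
   (Cp p (dirder u z.1 z.2) (dirder u z.1 z.2 -
      orient z * u z.2 * (log_slope phi \_ [set t | I t]) (fine (rho Omega z.1 z.2))))%:E)%E.

Definition skel_fun (h : R -> R) (nu m : 'rV[R]_n) : R :=
  (h \_ [set t | I t]) (fine (rho Omega nu m)) * `|u m| `^ p.

Definition dS (h : R -> R) (z : T2) : \bar R := mid_density Omega (skel_fun h z.1) z.1 z.2.

Definition skelp (r : R) : R := Num.max (skel p V phi r) 0.
Definition skeln (r : R) : R := Num.max (- skel p V phi r) 0.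

(** [d] bounds [rho] on good pairs, and [adm_d] then places every finite such distance in the
    interval of the pair ([good_in]). The second alternative in [adm_d] accommodates an infinite
    essential diameter. *)
Record admissible : Prop := Admissible {
  adm_open : open Omega;
  adm_p : 1 < p;
  adm_pos : forall r, I r -> 0 < V r /\ 0 < W r;
  adm_V : C1_on rad V;
  adm_W : C1_on rad W;
  adm_sol : positive_solution p rad V W phi;
  adm_test : test_function Omega u;
  adm_d0 : (0 <= d)%E;
  adm_d : (d < rad)%E \/ (rad = +oo%E /\ d = +oo%E) }.

Hypothesis adm : admissible.
Let oOmega := adm_open adm.
Let p1 := adm_p adm.
Let VW0 := adm_pos adm.
Let VC1 := adm_V adm.
Let WC1 := adm_W adm.
Let sol := adm_sol adm.
Let tu := adm_test adm.
Let d0 := adm_d0 adm.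
Let drad := adm_d adm.

Lemma measurable_ext f c : {in [set t | I t], continuous f} ->
  measurable_fun setT (fun z : T2 => ext f c (rho Omega z.1 z.2)).
Proof.
move=> cf; rewrite /ext.
have mr := measurable_rho oOmega.
apply: measurable_fun_ifT.
- by apply: measurable_fun_eqe => //; exact: measurable_cst.
- exact: measurable_cst.
apply/measurable_EFinP.
have oI : open [set t | I t] by exact: in_interval_open.
have mf : measurable_fun setT (f \_ [set t | I t]).
  apply/(measurable_restrictT _ _).1; first exact: open_measurable.
  by apply: open_continuous_measurable_fun.
exact: measurableT_comp mf (measurableT_comp (fine_measurable measurableT) mr).
Qed.

Lemma ext_ge0 f c r : (forall t, I t -> 0 <= f t) -> (rad = +oo%E -> (0 <= c)%E) ->
  (0 <= ext f c r)%E.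
Proof.
move=> f0 c0; rewrite /ext; case: ifP => _; first by case: eqP => // /c0.
by rewrite lee_fin /patch; case: ifPn => //; rewrite inE => /f0.
Qed.

Lemma ext_in f c t : I t -> ext f c t%:E = (f t)%:E.
Proof. by move=> It; rewrite /ext/= patchE mem_set. Qed.

Lemma dG_ge0 z : (0 <= dG z)%E.
Proof.
rewrite mule_ge0 ?lee_fin ?powR_ge0//; apply: ext_ge0 => [t /VW0 [/ltW]//|].
exact: (V_at_pinfty_ge0 VW0).
Qed.

Lemma dP_ge0 z : (0 <= dP z)%E.
Proof.
by rewrite mule_ge0 ?lee_fin ?powR_ge0//; apply: ext_ge0 => [t /VW0 [_ /ltW]|].
Qed.

Lemma dF_ge0 z : (0 <= dF z)%E.
Proof.
rewrite mule_ge0 ?lee_fin ?powR_ge0//; apply: ext_ge0 => [t //|].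
exact: (W_at_pinfty_ge0 VW0).
Qed.

Lemma dC_ge0 z : (0 <= dC z)%E.
Proof.
rewrite mule_ge0 ?lee_fin ?Cp_ge0//; apply: ext_ge0 => [t /VW0 [/ltW]//|].
exact: (V_at_pinfty_ge0 VW0).
Qed.

Lemma skel_fun_ge0 h nu m : (forall t, I t -> 0 <= h t) -> 0 <= skel_fun h nu m.
Proof.
move=> h0; rewrite /skel_fun mulr_ge0 ?powR_ge0// patchE; case: ifPn => //.
by rewrite inE => /h0.
Qed.

Lemma skelp_ge0 r : 0 <= skelp r. Proof. by rewrite /skelp le_max lexx orbT. Qed.
Lemma skeln_ge0 r : 0 <= skeln r. Proof. by rewrite /skeln le_max lexx orbT. Qed.

Lemma continuous_V : {in [set t | I t], continuous V}.
Proof. by move=> t; rewrite inE => It; apply: C1_continuous VC1 It. Qed.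
Lemma continuous_W : {in [set t | I t], continuous W}.
Proof. by move=> t; rewrite inE => It; apply: C1_continuous WC1 It. Qed.

Lemma measurable_dirder : measurable_fun setT (fun z : T2 => dirder u z.1 z.2).
Proof. by apply: continuous_measurable_rVX; apply: continuous_dirder; exact: (test_function_C1 tu). Qed.

Lemma measurable_test : measurable_fun setT u.
Proof. by apply: continuous_measurable_rVR; exact: (test_function_continuous tu). Qed.

Lemma measurable_fun_norm_powR dd (T : measurableType dd) (f : T -> R) (q : R) :
  measurable_fun setT f -> measurable_fun setT (fun x => `|f x| `^ q).
Proof.
move=> mf; apply: (measurableT_comp (measurable_powR q)).
rewrite (_ : (fun x => `|f x|) = (fun x => Num.max (f x) (- f x))).
  by apply: measurable_maxr => //; exact: measurable_funN.
apply/funext => x; have [h|h] := leP 0 (f x).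
  by rewrite ger0_norm// max_l// (le_trans _ h)// oppr_le0.
by rewrite ltr0_norm// max_r// (le_trans (ltW h))// oppr_ge0 ltW.
Qed.

Lemma measurable_dG : measurable_fun setT dG.
Proof.
apply: emeasurable_funM; first exact: measurable_ext continuous_V.
by apply/measurable_EFinP; apply: measurable_fun_norm_powR; exact: measurable_dirder.
Qed.

Lemma measurable_test2 : measurable_fun setT (fun z : T2 => u z.2).
Proof. exact: measurableT_comp measurable_test measurable_snd. Qed.

Lemma measurable_dP : measurable_fun setT dP.
Proof.
apply: emeasurable_funM; first exact: measurable_ext continuous_W.
by apply/measurable_EFinP; apply: measurable_fun_norm_powR; exact: measurable_test2.
Qed.

Lemma measurable_dF : measurable_fun setT dF.
Proof.
apply: emeasurable_funM.
  by apply: measurable_ext => t _; exact: cst_continuous.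
by apply/measurable_EFinP; apply: measurable_fun_norm_powR; exact: measurable_test2.
Qed.

Lemma measurable_orient : measurable_fun setT orient.
Proof.
have m1 := measurable_rhop oOmega; have m2 := measurable_rhopN oOmega.
apply: measurable_fun_ifT; [exact: measurable_fun_lte|exact: measurable_cst|].
by apply: measurable_fun_ifT; [exact: measurable_fun_lte|exact: measurable_cst|exact: measurable_cst].
Qed.

Lemma measurable_Cp dd (T : measurableType dd) (f g : T -> R) :
  measurable_fun setT f -> measurable_fun setT g ->
  measurable_fun setT (fun x => Cp p (f x) (g x)).
Proof.
move=> mf mg; have mfg := measurable_funB mf mg.
apply: measurable_funB.
  by apply: measurable_funB; exact: measurable_fun_norm_powR.
apply: measurable_funM; last by apply: measurable_funM.
apply: measurable_funM; first exact: measurable_cst.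
exact: measurable_fun_norm_powR.
Qed.

Lemma measurable_restrict_I (f : R -> R) : {in [set t | I t], continuous f} ->
  measurable_fun setT (f \_ [set t | I t]).
Proof.
move=> cf; have oI : open [set t | I t] by exact: in_interval_open.
apply/(measurable_restrictT _ _).1; first exact: open_measurable.
by apply: open_continuous_measurable_fun.
Qed.

Lemma measurable_fine_rho : measurable_fun setT (fun z : T2 => fine (rho Omega z.1 z.2)).
Proof. exact: measurableT_comp (fine_measurable measurableT) (measurable_rho oOmega). Qed.

Lemma measurable_dC : measurable_fun setT dC.
Proof.
apply: emeasurable_funM; first exact: measurable_ext continuous_V.
apply/measurable_EFinP; apply: measurable_Cp; first exact: measurable_dirder.
apply: measurable_funB; first exact: measurable_dirder.
apply: measurable_funM.
  by apply: measurable_funM; [exact: measurable_orient|exact: measurable_test2].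
have mq : measurable_fun setT (log_slope phi \_ [set t | I t]).
  apply: measurable_restrict_I => t; rewrite inE => It.
  by apply: continuous_log_slope sol _ It.
exact: measurableT_comp mq measurable_fine_rho.
Qed.

Lemma measurable_skel_fun h : {in [set t | I t], continuous h} ->
  measurable_fun setT (fun z : T2 => skel_fun h z.1 z.2).
Proof.
move=> ch; apply: measurable_funM.
  exact: measurableT_comp (measurable_restrict_I ch) measurable_fine_rho.
by apply: measurable_fun_norm_powR; exact: measurable_test2.
Qed.

Lemma measurable_dS h : {in [set t | I t], continuous h} -> measurable_fun setT (dS h).
Proof. by move=> ch; exact: (measurable_mid_density oOmega) (measurable_skel_fun ch). Qed.

Lemma continuous_skelp : {in [set t | I t], continuous skelp}.
Proof.
move=> t; rewrite inE => It; apply: continuous_max; last exact: cvg_cst.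
exact: (continuous_skel p1 VC1 sol It).
Qed.

Lemma continuous_skeln : {in [set t | I t], continuous skeln}.
Proof.
move=> t; rewrite inE => It; apply: (@continuous_max _ _ (fun r => - skel p V phi r) (fun=> 0)); last exact: cvg_cst.
by apply: cvgN; exact: (continuous_skel p1 VC1 sol It).
Qed.

Lemma measurable_good : measurable good.
Proof.
rewrite (_ : good = (snd @^-1` Omega) `&` ~` bad Omega d); last by [].
apply: measurableI; last by apply: measurableC; apply: open_measurable_rVX; exact: open_bad.
by rewrite -[X in measurable X]setTI; apply: measurable_snd => //; exact: open_measurable_rV.
Qed.

Lemma good_rho nu x : good (nu, x) -> (rho Omega nu x <= d)%E.
Proof.
move=> [_ h]; rewrite leNgt; apply/negP => dr; apply: h; exists 0.
by rewrite /= scale0r addr0.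
Qed.

Lemma good_shift nu x s : Omega x -> seg Omega nu x s -> good (nu, x + s *: nu) <-> good (nu, x).
Proof.
move=> xO ss; split => -[_ h].
  by split => //= H; apply: h; exact/bad_shift.
split => /=; first exact: (seg_in ss).
by move/bad_shift.
Qed.

Lemma good_in nu x t : good (nu, x) -> rho Omega nu x = t%:E -> I t.
Proof.
move=> g E; split.
  by have := rho_gt0 oOmega nu g.1; rewrite E lte_fin.
have := good_rho g; rewrite E; case: drad => [dr td|[-> _] _]; last by rewrite ltry.
exact: le_lt_trans dr.
Qed.

End densities.

Lemma integral_vanish d (T : measurableType d) (R : realType) (m : {measure set T -> \bar R})
    (D E : set T) (f : T -> \bar R) : E `<=` D -> (forall x, D x -> ~ E x -> f x = 0%E) ->
  (\int[m]_(x in D) f x = \int[m]_(x in E) f x)%E.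
Proof.
move=> ED f0; rewrite integral_mkcond [RHS]integral_mkcond; apply: eq_integral => x _.
rewrite !patchE; case: ifPn => xD; case: ifPn => xE //.
  by apply: f0; [rewrite inE in xD|rewrite notin_setE in xE].
by move: xD; rewrite notin_setE; case; apply: ED; rewrite inE in xE.
Qed.

Section line_identity.
Context {R : realType} {n : nat}.
Variables (p : R) (rad : \bar R) (V W phi : R -> R).
Variables (Omega : set 'rV[R]_n) (d : \bar R) (u : 'rV[R]_n -> R).
Hypothesis adm : admissible p rad V W phi Omega d u.
Local Notation T2 := ('rV[R]_n * 'rV[R]_n)%type.
Local Notation I := (in_interval rad).
Local Notation leb := (@lebesgue_measure R).
Local Notation dG := (dG p rad V Omega u).
Local Notation dP := (dP p rad W Omega u).
Local Notation dC := (dC p rad V phi Omega u).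
Local Notation dS := (dS p rad Omega u).
Local Notation skel := (skel p V phi).
Local Notation skelp := (skelp p V phi).
Local Notation skeln := (skeln p V phi).
Let oOmega := adm_open adm.
Let p1 := adm_p adm.
Let VW0 := adm_pos adm.
Let VC1 := adm_V adm.
Let WC1 := adm_W adm.
Let sol := adm_sol adm.
Let tu := adm_test adm.
Let d0 := adm_d0 adm.
Let drad := adm_d adm.
Let pn0 : p != 0. Proof. by rewrite gt_eqF// (lt_trans _ p1). Qed.
Implicit Types (nu x : 'rV[R]_n).

Lemma edot1_coord nu i : edot nu nu = 1 -> `|nu ord0 i| <= 1.
Proof.
move=> nu1; rewrite -(@ler_pXn2r _ 2)// ?nnegrE// expr1n real_normK ?num_real//.
by rewrite -nu1 le_edot_coord.
Qed.

(** The coordinates of a unit vector are at most 1 in absolute value, so the sup-norm gap of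
    [supp_gap] bounds the one-sided distances from below in every unit direction. *)
Lemma supp_rhop_gap : exists2 c : R, 0 < c &
  forall nu x, edot nu nu = 1 -> supp u x -> (c%:E <= rhop Omega nu x)%E.
Proof.
have [c c0 cP] := supp_gap oOmega tu; exists c => // nu x nu1 xK.
have := rhop_ge0 Omega nu x.
case E : (rhop Omega nu x) => [r| |]// r0; last by rewrite leey.
rewrite lee_fin leNgt; apply/negP => rc; apply: (rhop_fin_notin oOmega E).
apply: (cP x) => // i; rewrite !mxE opprD addrA subrr sub0r normrN normrM.
rewrite lee_fin in r0; rewrite ger0_norm//.
by apply: le_lt_trans rc; rewrite ler_piMr// edot1_coord.
Qed.

Lemma line_supp_bounded nu x : edot nu nu = 1 ->
  exists2 B : R, 0 < B & forall s, supp u (x + s *: nu) -> `|s| <= B.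
Proof.
move=> nu1; have [k kP] := supp_bounded tu.
exists (\sum_(i < n) k%:R + `|edot x nu| + 1); first by rewrite ltr_pwDr// addr_ge0// sumr_ge0.
move=> s sK.
have E : s = edot (x + s *: nu) nu - edot x nu by rewrite edotDZl nu1 mulr1 addrC addKr.
rewrite {1}E (le_trans (ler_normB _ _))// ler_wpDr// lerD2r.
rewrite /edot (le_trans (ler_norm_sum _ _ _))// ler_sum// => i _.
by rewrite -[leRHS]mulr1 normrM ler_pM// ?kP// edot1_coord.
Qed.

Section fixed_line.
Variables (nu x : 'rV[R]_n).
Hypothesis nu1 : edot nu nu = 1.
Hypothesis gx : good Omega d (nu, x).
Let xO : Omega x. Proof. by have [] := gx. Qed.

Lemma measurable_on_line (F : T2 -> \bar R) : measurable_fun setT F ->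
  measurable_fun [set: R] (fun s : R => F (nu, x + s *: nu)).
Proof.
move=> mF; apply: (measurableT_comp mF); apply/measurable_fun_pairP; split.
  exact: measurable_cst.
exact: measurable_line.
Qed.

Lemma vanish_off_supp s : ~ supp u (x + s *: nu) ->
  [/\ dG (nu, x + s *: nu) = 0%E, dP (nu, x + s *: nu) = 0%E & dC (nu, x + s *: nu) = 0%E].
Proof.
move=> sK; have u0 := notin_supp0 sK; have du0 := notin_supp_dirder0 tu nu sK.
by split; rewrite /dG /dP /dC /= ?u0 ?du0 ?mulr0 ?mul0r ?subr0 ?(Cp_id p1) normr0 powR0// mule0.
Qed.

(** The hypothesis on [m + m + a] says that [m] does not pass the midpoint, so that [rho = a + s] on
    the interval. It serves with [m] at the midpoint of a bounded component and with [m] beyond the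
    support on a half-line. The end [- a] gives no boundary term because [u] vanishes near it. *)
Lemma left_half a m : rhop Omega (- nu) x = a%:E -> - a < m ->
  ((m + m + a)%:E <= rhop Omega nu x)%E ->
  (\int[leb]_(s in `](- a)%R, m[) dG (nu, x + s *: nu)%R =
   \int[leb]_(s in `](- a)%R, m[) dP (nu, x + s *: nu)%R +
   \int[leb]_(s in `](- a)%R, m[) dC (nu, x + s *: nu)%R +
   (skel (a + m) * `|u (x + m *: nu)| `^ p)%R%:E)%E.
Proof.
move=> aE am mb.
have [c c0 cP] := supp_rhop_gap.
(* The lower limit moves into the open interval: below [- a + c] the function [u] vanishes, so half
   the gap is safe, and [(m - a) / 2], halfway between [- a] and [m], ensures [al < m]. *)
pose al := Num.min (- a + c / 2) ((m - a) / 2).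
have al1 : - a < al by rewrite lt_min; apply/andP; split; [rewrite ltrDl divr_gt0|lra].
have al2 : al < - a + c by rewrite gt_min; apply/orP; left; lra.
have alm : al < m by rewrite gt_min; apply/orP; right; lra.
have sseg s : - a < s -> s <= m -> seg Omega nu x s.
  move=> h1 h2; split; last by rewrite aE lte_fin; lra.
  by apply: lt_le_trans mb; rewrite lte_fin; lra.
have aS s : - a < s -> s <= m -> rhop Omega (- nu) (x + s *: nu) = (a + s)%:E.
  by move=> h1 h2; rewrite (rhopN_shift oOmega xO (sseg _ h1 h2)) aE.
have bS s : - a < s -> s <= m -> ((m + m + a - s)%:E <= rhop Omega nu (x + s *: nu))%E.
  by move=> h1 h2; rewrite (rhop_shift oOmega xO (sseg _ h1 h2)) EFinB leeB.
have rS s : - a < s -> s <= m -> rho Omega nu (x + s *: nu) = (a + s)%:E.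
  move=> h1 h2; rewrite rhop_rho aS//; apply/min_idPr.
  by apply: le_trans (bS _ h1 h2); rewrite lee_fin; lra.
have gS s : - a < s -> s <= m -> good Omega d (nu, x + s *: nu).
  by move=> h1 h2; apply/(good_shift d xO (sseg _ h1 h2)).
have IS s : - a < s -> s <= m -> I (a + s).
  by move=> h1 h2; apply: (good_in adm (gS _ h1 h2)); exact: rS.
have oS s : - a < s -> s < m -> orient Omega (nu, x + s *: nu) = 1.
  move=> h1 h2; rewrite /orient /= aS ?(ltW h2)//.
  rewrite ifT//; apply: lt_le_trans (bS _ h1 (ltW h2)).
  by rewrite lte_fin; lra.
have key (F : R -> \bar R) (g : R -> R) : measurable_fun [set: R] F ->
    (forall s, ~ supp u (x + s *: nu) -> F s = 0%E) ->
    (forall s, - a < s -> s < m -> F s = (g s)%:E) ->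
    (\int[leb]_(s in `](- a)%R, m[) F s = \int[leb]_(s in `[al, m]) (g s)%:E)%E.
  move=> mF F0 Fg.
  transitivity (\int[leb]_(s in `[al, m[) F s)%E.
    apply: integral_vanish => s; rewrite /= !in_itv/=.
      by move=> /andP[h1 h2]; rewrite h2 (lt_le_trans al1 h1).
    move=> /andP[h1 h2] /negP; rewrite h2 andbT -ltNge => sal.
    apply: F0 => sK.
    have := cP (- nu) _ _ sK; rewrite aS ?(ltW h2)// lee_fin => H.
    have : c <= a + s.
      by apply: H; rewrite /edot; under eq_bigr do rewrite !mxE mulrNN.
    by lra.
  have Fg' : {in `[al, m[%classic, F =1 EFin \o g}.
    move=> s; rewrite inE/= in_itv/= => /andP[h1 h2]; apply: Fg => //.
    exact: lt_le_trans h1.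
  rewrite -integral_itv_bndo_bndc; first exact: eq_integral.
  by apply: eq_measurable_fun Fg' _; exact: measurable_funS mF.
have mline := measurable_on_line.
rewrite (key _ (fun s => V (a + 1 * s) * `|dirder u nu (x + s *: nu)| `^ p)); last 3 first.
- exact: mline (measurable_dG adm).
- by move=> s /vanish_off_supp[].
- move=> s h1 h2; rewrite /dG /= rS ?(ltW h2)// mul1r ext_in//.
  by apply: IS => //; exact: ltW.
rewrite (key _ (fun s => W (a + 1 * s) * `|u (x + s *: nu)| `^ p)); last 3 first.
- exact: mline (measurable_dP adm).
- by move=> s /vanish_off_supp[].
- move=> s h1 h2; rewrite /dP /= rS ?(ltW h2)// mul1r ext_in//.
  by apply: IS => //; exact: ltW.
rewrite (key _ (fun s => V (a + 1 * s) * Cp p (dirder u nu (x + s *: nu))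
    (dirder u nu (x + s *: nu) - 1 * u (x + s *: nu) * log_slope phi (a + 1 * s)))); last 3 first.
- exact: mline (measurable_dC adm).
- by move=> s /vanish_off_supp[].
- move=> s h1 h2; have Is := IS _ h1 (ltW h2).
  by rewrite /dC /= rS ?(ltW h2)// !mul1r ext_in// oS//= patchE mem_set// !mul1r.
rewrite (picone_integral p1 VC1 WC1 sol (normr1 _)
  (is_derive_dirder (test_function_C1 tu) x nu)
  (@continuous_dirder_line _ _ _ (test_function_C1 tu) x nu) alm); last first.
  by move=> s /andP[h1 h2]; rewrite mul1r; apply: IS => //; exact: lt_le_trans h1.
congr (_ + _%:E)%E; rewrite !mul1r.
have -> : u (x + al *: nu) = 0.
  apply: notin_supp0 => alK.
  have : (c%:E <= rhop Omega (- nu) (x + al *: nu))%E.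
    by apply: cP => //; rewrite /edot; under eq_bigr do rewrite !mxE mulrNN.
  by rewrite aS ?(ltW alm)// lee_fin; lra.
by rewrite normr0 powR0// mulr0 subr0.
Qed.

(** Here [orient] is 0, so both arguments of [Cp] equal the directional derivative and [Cp_id]
    identifies the two densities. *)
Lemma full_line : rhop Omega (- nu) x = +oo%E -> rhop Omega nu x = +oo%E ->
  (forall s, [/\ dG (nu, x + s *: nu) = dC (nu, x + s *: nu),
     dP (nu, x + s *: nu) = 0%E & forall h, dS h (nu, x + s *: nu) = 0%E]).
Proof.
move=> aE bE s.
have ss : seg Omega nu x s by rewrite /seg/= aE bE !ltry.
have a'E : rhop Omega (- nu) (x + s *: nu) = +oo%E by rewrite (rhopN_shift oOmega xO ss) aE.
have b'E : rhop Omega nu (x + s *: nu) = +oo%E by rewrite (rhop_shift oOmega xO ss) bE.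
split.
- rewrite /dG /dC /orient /= a'E b'E ltxx !mul0r subr0.
  by rewrite Cp_id.
- rewrite /dP /= rhop_rho a'E b'E minxx /ext/=; by case: ifP => _; rewrite mul0e.
- by move=> h; rewrite /dS /mid_density /= a'E b'E ltxx.
Qed.

End fixed_line.

Lemma half_line nu x a : edot nu nu = 1 -> good Omega d (nu, x) ->
  rhop Omega (- nu) x = a%:E -> rhop Omega nu x = +oo%E ->
  (\int[leb]_(s in seg Omega nu x) dG (nu, x + s *: nu)%R =
   \int[leb]_(s in seg Omega nu x) dP (nu, x + s *: nu)%R +
   \int[leb]_(s in seg Omega nu x) dC (nu, x + s *: nu)%R)%E /\
  (forall s, seg Omega nu x s -> forall h, dS h (nu, x + s *: nu)%R = 0%E).
Proof.
move=> nu1 gx aE bE; have xO : Omega x by case: gx.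
split; last first.
  move=> s ss h; rewrite /dS /mid_density /=.
  by rewrite (rhop_shift oOmega xO ss) bE.
have [B B0 BP] := line_supp_bounded x nu1.
pose m := Num.max B (- a) + 1.
have am : - a < m by rewrite /m ltr_pwDr// le_max lexx orbT.
have Bm : B < m by rewrite /m ltr_pwDr// le_max lexx.
have van s : seg Omega nu x s -> ~ `](- a)%R, m[%classic s -> ~ supp u (x + s *: nu).
  move=> [s1 s2] sm sK; apply: sm; rewrite /= in_itv/=; apply/andP; split.
    by move: s2; rewrite aE lte_fin ltrNl.
  by apply: le_lt_trans Bm; apply: le_trans (BP _ sK); exact: ler_norm.
have sub : `](- a)%R, m[%classic `<=` seg Omega nu x.
  move=> s; rewrite /= in_itv/= => /andP[h1 h2]; split; first by rewrite bE ltry.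
  by rewrite aE lte_fin ltrNl.
have red (f : R -> \bar R) : (forall s, seg Omega nu x s -> ~ `](- a)%R, m[%classic s -> f s = 0%E) ->
    (\int[leb]_(s in seg Omega nu x) f s = \int[leb]_(s in `](- a)%R, m[) f s)%E.
  by move=> h; apply: integral_vanish.
rewrite (red (fun s => dG (nu, x + s *: nu))); last first.
  by move=> s s1 /(van _ s1) /vanish_off_supp[].
rewrite (red (fun s => dP (nu, x + s *: nu))); last first.
  by move=> s s1 /(van _ s1) /vanish_off_supp[].
rewrite (red (fun s => dC (nu, x + s *: nu))); last first.
  by move=> s s1 /(van _ s1) /vanish_off_supp[].
rewrite (@left_half nu x nu1 gx a m)//; last by rewrite bE leey.
rewrite (@notin_supp0 _ _ u (x + m *: nu)).
  by rewrite normr0 powR0// mulr0 adde0.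
have m0 : 0 <= m by apply: ltW; exact: lt_trans Bm.
by move=> /BP; rewrite ger0_norm// leNgt Bm.
Qed.

Lemma edotNN nu : edot (- nu) (- nu) = edot nu nu.
Proof. by rewrite /edot; apply: eq_bigr => i _; rewrite !mxE mulrNN. Qed.

Lemma rhoN nu y : rho Omega (- nu) y = rho Omega nu y.
Proof. by rewrite !rhop_rho opprK minC. Qed.

Lemma dirderN nu y : dirder u (- nu) y = - dirder u nu y.
Proof. by rewrite /dirder /edot -sumrN; apply: eq_bigr => i _; rewrite !mxE mulrN. Qed.

Lemma orientN nu y : orient Omega (- nu, y) = - orient Omega (nu, y).
Proof.
rewrite /orient /= opprK.
by case: (ltgtP (rhop Omega (- nu) y) (rhop Omega nu y)) => //; rewrite ?opprK ?oppr0.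
Qed.

Lemma CpN a b : Cp p (- a) (- b) = Cp p a b :> R.
Proof.
rewrite /Cp (_ : - a - - b = - (a - b)); last by ring.
by rewrite !normrN mulrNN.
Qed.

Lemma dG_opp nu y : dG (- nu, y) = dG (nu, y).
Proof. by rewrite /dG /= rhoN dirderN normrN. Qed.

Lemma dP_opp nu y : dP (- nu, y) = dP (nu, y).
Proof. by rewrite /dP /= rhoN. Qed.

Lemma dC_opp nu y : dC (- nu, y) = dC (nu, y).
Proof.
rewrite /dC /= rhoN dirderN orientN; congr (_ * _%:E)%E.
by rewrite !mulNr -opprD CpN.
Qed.

Lemma good_opp nu y : good Omega d (- nu, y) <-> good Omega d (nu, y).
Proof.
suff H v : good Omega d (v, y) -> good Omega d (- v, y).
  by split; [rewrite -[in X in _ -> X](opprK nu); exact: H|exact: H].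
move=> [yO h]; split => // -[t]; rewrite /= rhoN rhopNE => ht.
by apply: h; exists (- t).
Qed.

Lemma reflect_line (F : T2 -> \bar R) nu x (D : set R) : measurable D ->
  measurable_fun setT F -> (forall z, 0 <= F z)%E -> (forall v y, F (- v, y) = F (v, y)) ->
  (\int[leb]_(s in [set s | D (- s)%R]) F (- nu, x + s *: - nu)%R =
   \int[leb]_(s in D) F (nu, x + s *: nu)%R)%E.
Proof.
move=> mD mF F0 FN.
rewrite -(@integral_set_opp _ D (fun s => F (nu, x + s *: nu)))//.
  by apply: eq_integral => s _; rewrite FN rhopNE.
exact: measurable_on_line.
Qed.

(** The right half of a bounded component is the left half for the direction [- nu], under which the
    densities are invariant ([reflect_line]). On components with an infinite end [dS] is 0, in
    accordance with the absence of a midpoint. *)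
Lemma seg_identity nu x : edot nu nu = 1 -> good Omega d (nu, x) ->
  (\int[leb]_(s in seg Omega nu x) dG (nu, x + s *: nu)%R +
   2%:E * \int[leb]_(s in seg Omega nu x) dS skeln (nu, x + s *: nu)%R =
   \int[leb]_(s in seg Omega nu x) dP (nu, x + s *: nu)%R +
   2%:E * \int[leb]_(s in seg Omega nu x) dS skelp (nu, x + s *: nu)%R +
   \int[leb]_(s in seg Omega nu x) dC (nu, x + s *: nu)%R)%E.
Proof.
move=> nu1 gx; have xO : Omega x by case: gx.
have nu1' : edot (- nu) (- nu) = 1 by rewrite edotNN.
have gx' : good Omega d (- nu, x) by apply/good_opp.
have mseg v : measurable (seg Omega v x) by exact: measurable_seg.
have refl (F : T2 -> \bar R) : measurable_fun setT F -> (forall z, 0 <= F z)%E ->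
   (forall v y, F (- v, y) = F (v, y)) ->
   (\int[leb]_(s in seg Omega (- nu) x) F (- nu, x + s *: - nu)%R =
    \int[leb]_(s in seg Omega nu x) F (nu, x + s *: nu)%R)%E.
  move=> mF F0 FN; rewrite -[RHS](@reflect_line F nu x _ (mseg nu) mF F0 FN).
  have -> // : [set s : R | seg Omega nu x (- s)] = seg Omega (- nu) x.
  by apply/seteqP; split => s /=; rewrite segN.
have [mG mP mC] := And3 (measurable_dG adm) (measurable_dP adm) (measurable_dC adm).
have [G0 P0 C0] := And3 (dG_ge0 adm) (dP_ge0 adm) (dC_ge0 adm).
have I0 (f : R -> \bar R) : (forall s, seg Omega nu x s -> f s = 0%E) ->
    (\int[leb]_(s in seg Omega nu x) f s = 0)%E.
  move=> f0; rewrite (eq_integral (cst 0%E)) ?integral0// => s; rewrite inE; exact: f0.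
have fin (G P C S1 S2 : \bar R) : S1 = 0%E -> S2 = 0%E -> G = (P + C)%E ->
    (G + 2%:E * S1 = P + 2%:E * S2 + C)%E.
  by move=> -> -> ->; rewrite mule0 !adde0.
have a0 := rhop_ge0 Omega (- nu) x; have b0 := rhop_ge0 Omega nu x.
case bE : (rhop Omega nu x) b0 => [b| |]// b0; case aE : (rhop Omega (- nu) x) a0 => [a| |]// a0.
- have segE := fin_seg_itv aE bE.
  (* [m] is the parameter of the midpoint relative to [x], and [l] is half the length, which is the
     value of [rho] there. *)
  pose m := (b - a) / 2; pose l := (a + b) / 2.
  have ab0 : 0 < a + b.
    have : (0 < a%:E)%E by rewrite -aE rhop_gt0.
    have : (0 < b%:E)%E by rewrite -bE rhop_gt0.
    by rewrite !lte_fin; lra.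
  have m1 : - a < m by rewrite /m; lra.
  have m2 : m < b by rewrite /m; lra.
  have halves (F : T2 -> \bar R) : measurable_fun setT F -> (forall z, 0 <= F z)%E ->
      (forall v y, F (- v, y) = F (v, y)) ->
      (\int[leb]_(s in seg Omega nu x) F (nu, x + s *: nu)%R =
       \int[leb]_(s in `](- a)%R, m[) F (nu, x + s *: nu)%R +
       \int[leb]_(s in `](- b)%R, (- m)%R[) F (- nu, x + s *: - nu)%R)%E.
    move=> mF F0 FN; have mFl := @measurable_on_line nu x _ mF.
    rewrite segE.
    have -> : `](- a)%R, b[%classic = `](- a)%R, m[%classic `|` `[m, b[%classic.
      apply/seteqP; split => s /=; rewrite !in_itv/=.
        by move=> /andP[h1 h2]; have [h|h] := ltP s m; [left; rewrite h1|right].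
      by move=> [/andP[h1 h2]|/andP[h1 h2]]; apply/andP; split => //; lra.
    rewrite ge0_integral_setU//; last 2 first.
    - exact: measurable_funS mFl.
    - rewrite disj_set2E; apply/eqP/seteqP; split => // s [] /=; rewrite !in_itv/=; lra.
    congr (_ + _)%E; rewrite -integral_itv_obnd_cbnd; last exact: measurable_funS mFl.
    rewrite -(@reflect_line F nu x `]m, b[%classic (measurable_itv _) mF F0 FN).
    have -> // : [set s : R | `]m, b[%classic (- s)] = `](- b)%R, (- m)%R[%classic.
    by apply/seteqP; split => s /=; rewrite !in_itv/= => /andP[h1 h2]; apply/andP; split; lra.
  have gm : seg Omega nu x m by rewrite segE /= in_itv/= m1 m2.
  have rm : rho Omega nu (x + m *: nu) = l%:E.
    rewrite rhop_rho (rhop_shift oOmega xO gm) (rhopN_shift oOmega xO gm) aE bE.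
    have e1 : b - m = l by rewrite /l /m; lra.
    have e2 : a + m = l by rewrite /l /m; lra.
    by rewrite -EFinB -EFinD e1 e2 minxx.
  have Il : I l by apply: (good_in adm _ rm); apply/(good_shift d xO gm).
  have Sval h : (\int[leb]_(s in seg Omega nu x) dS h (nu, x + s *: nu)%R)%E =
      (h l * `|u (x + m *: nu)| `^ p)%:E.
    transitivity (\int[leb]_(s in seg Omega nu x) ((h l * `|u (x + m *: nu)| `^ p / (a + b))%:E))%E.
      apply: eq_integral => s; rewrite inE => ss.
      rewrite /dS /mid_density /= (rhop_shift oOmega xO ss) (rhopN_shift oOmega xO ss) aE bE.
      rewrite -EFinB -EFinD !ltry/= /seg_len /seg_mid (rhop_shift oOmega xO ss) (rhopN_shift oOmega xO ss) aE bE /=.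
      rewrite -addrA -scalerDl (_ : s + (b - s - (a + s)) / 2 = m); last by rewrite /m; lra.
      rewrite /skel_fun rm /= patchE mem_set//.
      by rewrite (_ : b - s + (a + s) = a + b)//; ring.
    have LE : leb (seg Omega nu x) = (a + b)%:E.
      by rewrite segE lebesgue_measure_itv/= lte_fin (lt_trans m1 m2) -EFinD opprK addrC.
    rewrite integral_cst; last exact: measurable_seg.
    rewrite [X in (_ * X)%E](_ : _ = (a + b)%:E); last exact: LE.
    by rewrite -EFinM divfK ?gt_eqF.
  rewrite !Sval (halves _ mG G0 dG_opp) (halves _ mP P0 dP_opp) (halves _ mC C0 dC_opp).
  rewrite (left_half nu1 gx aE m1); last by rewrite bE lee_fin /m; lra.
  rewrite (@left_half _ _ nu1' gx' b (- m)); last 3 first.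
  - by rewrite opprK.
  - by rewrite ltrN2.
  - by rewrite aE lee_fin /m; lra.
  rewrite rhopNE opprK (_ : b - m = l); last by rewrite /l /m; lra.
  rewrite (_ : a + m = l); last by rewrite /l /m; lra.
  (* Adding the finite quantity [skeln] to both sides makes every term nonnegative, so the identity
     needs no subtraction of integrals. *)
  have SX : skelp l = skel l + skeln l.
    by rewrite /skelp /skeln addr_maxr subrr addr0 maxC.
  rewrite SX; set X := `|_| `^ p; move: (skel l) (skeln l) => k kn.
  set P1 := (integral _ _ (fun s => dP (nu, _)))%E; set P2 := (integral _ _ (fun s => dP _))%E.
  set C1 := (integral _ _ (fun s => dC (nu, _)))%E; set C2 := (integral _ _ (fun s => dC _))%E.
  have P10 : (0 <= P1)%E by apply: integral_ge0.
  have P20 : (0 <= P2)%E by apply: integral_ge0.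
  have C10 : (0 <= C1)%E by apply: integral_ge0.
  have C20 : (0 <= C2)%E by apply: integral_ge0.
  move: P1 P2 C1 C2 P10 P20 C10 C20 => [q1| |] [q2| |] [q3| |] [q4| |] //= _ _ _ _.
  by rewrite -!EFinM -!EFinD; congr (_%:E); ring.
- have [E _] := half_line nu1' gx' (etrans (congr1 (rhop Omega ^~ x) (opprK nu)) bE) aE.
  rewrite (refl _ mG G0 dG_opp) (refl _ mP P0 dP_opp) (refl _ mC C0 dC_opp) in E.
  have S0 s h : seg Omega nu x s -> dS h (nu, x + s *: nu) = 0%E.
    by move=> ss; rewrite /dS /mid_density /= (rhopN_shift oOmega xO ss) aE andbF.
  by apply: fin; [apply: I0 => s; exact: S0|apply: I0 => s; exact: S0|exact: E].
- have [E S0] := half_line nu1 gx aE bE.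
  by apply: fin; [apply: I0 => s ss; exact: S0|apply: I0 => s ss; exact: S0|exact: E].
- have F := full_line gx aE bE.
  apply: fin; [apply: I0 => s _|apply: I0 => s _|]; try by have [_ _ ->] := F s.
  rewrite (I0 (fun s => dP (nu, x + s *: nu)%R)); last by move=> s _; have [] := F s.
  by rewrite add0e; apply: eq_integral => s _; have [] := F s.
Qed.

End line_identity.

(** * Integration over lines and directions *)

Section sphere.
Context {R : realType} {n : nat}.
Local Open Scope ereal_scope.

Lemma lebesgue_unit_ball_lty : lebesgue_rV (@unit_ball R n) < +oo.
Proof.
apply: (@le_lt_trans _ _ (lebesgue_rV [set v : 'rV[R]_n | forall i, `|v ord0 i| <= 1%:R]%R)); last first.
  exact: lebesgue_rV_bounded.
apply: le_measure; rewrite ?inE; [exact: measurable_unit_ball|exact: measurable_cube|].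
move=> v; rewrite /unit_ball /enorm /= => v1 i.
rewrite -(@ler_pXn2r _ 2)// ?nnegrE// expr1n real_normK ?num_real//.
apply: le_trans (le_edot_coord v i) _.
by rewrite -(sqr_sqrtr (edot_ge0 v)) expr_le1// ?sqrtr_ge0// ltW.
Qed.

Lemma sphere_measure_fin : fin_num_fun (@sphere_measure R n).
Proof.
move=> A mA; rewrite /sphere_measure fin_numM// ge0_fin_numE//.
apply: le_lt_trans lebesgue_unit_ball_lty.
apply: le_measure; rewrite ?inE //; last exact: measurable_unit_ball.
apply: measurableI; last exact: measurable_unit_ball.
by rewrite -[X in measurable X]setTI; exact: measurable_direction.
Qed.

HB.instance Definition _ := @Measure_isFinite.Build _ _ _ (@sphere_measure R n) sphere_measure_fin.

Lemma measurable_unit_sphere : measurable (@unit_sphere R n).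
Proof.
rewrite -[unit_sphere]setCK; apply: measurableC; apply: open_measurable_rV.
rewrite (_ : ~` _ = enorm @^-1` [set y | y != 1%R]); last first.
  by apply/seteqP; split => x /= /eqP.
apply: open_comp; last exact: open_neq.
by move=> x _; exact: enorm_continuous.
Qed.

Lemma unit_sphere_edot (nu : 'rV[R]_n) : unit_sphere nu -> (edot nu nu = 1)%R.
Proof.
rewrite /unit_sphere /enorm /= => h.
by rewrite -(sqr_sqrtr (edot_ge0 nu)) h expr1n.
Qed.

End sphere.

Section linear_combination.
Context {R : realType} {dd : measure_display} {T : measurableType dd}.
Variables (m : {measure set T -> \bar R}) (D : set T) (f g h : T -> \bar R).
Hypothesis mD : measurable D.
Hypotheses (mf : measurable_fun D f) (mg : measurable_fun D g) (mh : measurable_fun D h).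
Local Open Scope ereal_scope.
Hypotheses (f0 : forall x, 0 <= f x) (g0 : forall x, 0 <= g x) (h0 : forall x, 0 <= h x).

Lemma ge0_integralDZ : \int[m]_(x in D) (f x + 2%:E * g x) =
  \int[m]_(x in D) f x + 2%:E * \int[m]_(x in D) g x.
Proof.
rewrite ge0_integralD ?ge0_integralZl//.
- by move=> x _; rewrite mule_ge0.
- by apply: emeasurable_funM => //; exact: measurable_cst.
Qed.

Lemma ge0_integralDZD : \int[m]_(x in D) (f x + 2%:E * g x + h x) =
  \int[m]_(x in D) f x + 2%:E * \int[m]_(x in D) g x + \int[m]_(x in D) h x.
Proof.
have mZ : measurable_fun D (fun x => 2%:E * g x).
  by apply: emeasurable_funM => //; exact: measurable_cst.
rewrite ge0_integralD ?ge0_integralDZ//.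
- by move=> x _; rewrite adde_ge0// mule_ge0.
- exact: emeasurable_funD.
Qed.

End linear_combination.

Section slice_identity.
Context {R : realType} {n : nat}.
Variables (p : R) (rad : \bar R) (V W phi : R -> R).
Variables (Omega : set 'rV[R]_n) (d : \bar R) (u : 'rV[R]_n -> R).
Hypothesis adm : admissible p rad V W phi Omega d u.
Local Notation T2 := ('rV[R]_n * 'rV[R]_n)%type.
Local Notation good := (good Omega d).
Local Notation leb := (@lebesgue_measure R).
Local Notation lam := (@lebesgue_rV R n).
Local Notation dG := (dG p rad V Omega u).
Local Notation dP := (dP p rad W Omega u).
Local Notation dC := (dC p rad V phi Omega u).
Local Notation dS := (dS p rad Omega u).
Local Notation skelp := (skelp p V phi).
Local Notation skeln := (skeln p V phi).
Local Open Scope ereal_scope.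
Let oOmega := adm_open adm.

Lemma dS_ge0 h z : (forall t, in_interval rad t -> 0 <= h t)%R -> 0 <= dS h z.
Proof. by move=> h0; apply: mid_density_ge0 => y; exact: skel_fun_ge0. Qed.

Lemma measurable_dSp : measurable_fun setT (dS skelp).
Proof. by apply: (measurable_dS adm); exact: continuous_skelp adm. Qed.

Lemma measurable_dSn : measurable_fun setT (dS skeln).
Proof. by apply: (measurable_dS adm); exact: continuous_skeln adm. Qed.

Lemma dSp_ge0 z : 0 <= dS skelp z.
Proof. by apply: dS_ge0 => t _; exact: skelp_ge0. Qed.

Lemma dSn_ge0 z : 0 <= dS skeln z.
Proof. by apply: dS_ge0 => t _; exact: skeln_ge0. Qed.

Lemma measurable_mask (F : T2 -> \bar R) : measurable_fun setT F -> measurable_fun setT (F \_ good).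
Proof.
move=> mF; apply/(measurable_restrictT _ _).1; first exact: measurable_good adm.
exact: measurable_funS mF.
Qed.

Lemma mask_ge0 (F : T2 -> \bar R) z : (forall z, 0 <= F z) -> 0 <= (F \_ good) z.
Proof. by move=> F0; rewrite patchE; case: ifP. Qed.

Lemma measurable_slice (F : T2 -> \bar R) nu : measurable_fun setT F -> measurable_fun setT (fun x => F (nu, x)).
Proof. by move=> mF; apply: (measurableT_comp mF); exact: measurable_pair1. Qed.

(** The slab formula reduces the claim to lines and [integral_line_components] reduces it to
    components; on each of these the mask is identically 0 or 1, and [seg_identity] applies in the
    second case. *)
Lemma slice_identity nu : edot nu nu = 1%R ->
  \int[lam]_x (dG \_ good) (nu, x) + 2%:E * \int[lam]_x (dS skeln \_ good) (nu, x) =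
  \int[lam]_x (dP \_ good) (nu, x) + 2%:E * \int[lam]_x (dS skelp \_ good) (nu, x) +
  \int[lam]_x (dC \_ good) (nu, x).
Proof.
move=> nu1.
have [mG mP mC] := And3 (measurable_dG adm) (measurable_dP adm) (measurable_dC adm).
have [G0 P0 C0] := And3 (dG_ge0 adm) (dP_ge0 adm) (dC_ge0 adm).
pose s2 (h : T2 -> \bar R) z := 2%:E * h z.
have ms h : measurable_fun setT h -> measurable_fun setT (s2 h).
  by move=> mh; apply: emeasurable_funM => //; exact: measurable_cst.
have s20 h : (forall z, 0 <= h z) -> forall z, 0 <= s2 h z by move=> h0 z; rewrite mule_ge0.
pose A := (dG \+ s2 (dS skeln))%E; pose B := (dP \+ s2 (dS skelp) \+ dC)%E.
have mA : measurable_fun setT A by apply: emeasurable_funD => //; apply: ms; exact: measurable_dSn.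
have mB : measurable_fun setT B.
  by apply: emeasurable_funD => //; apply: emeasurable_funD => //; apply: ms; exact: measurable_dSp.
have A0 z : 0 <= A z by rewrite adde_ge0// s20//; exact: dSn_ge0.
have B0 z : 0 <= B z by rewrite !adde_ge0// s20//; exact: dSp_ge0.
have int_slice (F : T2 -> \bar R) : measurable_fun setT F -> (forall z, 0 <= F z) ->
   \int[lam]_x (F \_ good) (nu, x) =
   \int[lam]_(x in slab nu) \int[leb]_t (F \_ good) (nu, x + t *: nu)%R.
  move=> mF F0; apply/esym.
  apply: (@ge0_integral_slab _ _ nu nu1 (fun x => (F \_ good) (nu, x))).
    exact: measurable_slice (measurable_mask mF).
  by move=> x; exact: mask_ge0.
have main : \int[lam]_x (A \_ good) (nu, x) = \int[lam]_x (B \_ good) (nu, x).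
  apply: (etrans (int_slice A mA A0)); apply/esym.
  apply: (etrans (int_slice B mB B0)); apply/esym.
  apply: eq_integral => x _.
  apply: (@integral_line_components _ _ Omega oOmega (fun x => (A \_ good) (nu, x)) (fun x => (B \_ good) (nu, x))).
  - exact: measurable_slice (measurable_mask mA).
  - exact: measurable_slice (measurable_mask mB).
  - by move=> y; exact: mask_ge0.
  - by move=> y; exact: mask_ge0.
  - by move=> y yO; rewrite patchE memNset// => -[].
  - by move=> y yO; rewrite patchE memNset// => -[].
  move=> y yO.
  have mseg : measurable (seg Omega nu y) by exact: measurable_seg.
  have [gy|gy] := pselect (good (nu, y)); last first.
    have z0 F : \int[leb]_(s in seg Omega nu y) (F \_ good) (nu, y + s *: nu)%R = 0.
      transitivity (\int[leb]_(s in seg Omega nu y) (cst 0 s : \bar R)); last exact: integral0.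
      apply: eq_integral => s; rewrite inE => ss.
      by rewrite patchE memNset// => /(good_shift d yO ss).
    exact: etrans (z0 A) (esym (z0 B)).
  have z1 F : \int[leb]_(s in seg Omega nu y) (F \_ good) (nu, y + s *: nu)%R =
      \int[leb]_(s in seg Omega nu y) F (nu, y + s *: nu)%R.
    apply: eq_integral => s; rewrite inE => ss.
    by rewrite patchE mem_set//; exact/(good_shift d yO ss).
  apply: (etrans (z1 A)); apply/esym; apply: (etrans (z1 B)); apply/esym.
  have mline (F : T2 -> \bar R) : measurable_fun setT F ->
      measurable_fun (seg Omega nu y) (fun s : R => F (nu, y + s *: nu)%R).
    by move=> mF; exact: measurable_funS (measurable_on_line nu y mF).
  have EA := @ge0_integralDZ _ _ _ leb _ (fun s => dG (nu, y + s *: nu)%R)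
    (fun s => dS skeln (nu, y + s *: nu)%R) mseg (mline _ mG) (mline _ measurable_dSn)
    (fun s => G0 _) (fun s => dSn_ge0 _).
  have EB := @ge0_integralDZD _ _ _ leb _ (fun s => dP (nu, y + s *: nu)%R)
      (fun s => dS skelp (nu, y + s *: nu)%R) (fun s => dC (nu, y + s *: nu)%R)
      mseg (mline _ mP) (mline _ measurable_dSp) (mline _ mC)
      (fun s => P0 _) (fun s => dSp_ge0 _) (fun s => C0 _).
  exact: etrans EA (etrans (seg_identity adm nu1 gy) (esym EB)).
have msl (F : T2 -> \bar R) : measurable_fun setT F -> measurable_fun setT (fun x => (F \_ good) (nu, x)).
  by move=> mF; exact: measurable_slice (measurable_mask mF).
have EA := @ge0_integralDZ _ _ _ lam setT (fun x => (dG \_ good) (nu, x))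
    (fun x => (dS skeln \_ good) (nu, x)) measurableT (msl _ mG) (msl _ measurable_dSn)
    (fun x => mask_ge0 _ G0) (fun x => mask_ge0 _ dSn_ge0).
have EB := @ge0_integralDZD _ _ _ lam setT (fun x => (dP \_ good) (nu, x))
    (fun x => (dS skelp \_ good) (nu, x)) (fun x => (dC \_ good) (nu, x))
    measurableT (msl _ mP) (msl _ measurable_dSp) (msl _ mC)
    (fun x => mask_ge0 _ P0) (fun x => mask_ge0 _ dSp_ge0) (fun x => mask_ge0 _ C0).
apply: (etrans (esym EA)); apply/esym; apply: (etrans (esym EB)); apply/esym.
etransitivity; [|etransitivity; [exact: main|]]; apply: eq_integral => x _; rewrite !patchE; case: ifP => //.
  by rewrite mule0 adde0.
by rewrite mule0 !adde0.
Qed.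

End slice_identity.

(** * Negligibility of the chords longer than the essential diameter *)

Section bad_null.
Context {R : realType} {n : nat}.
Variable Omega : set 'rV[R]_n.
Hypothesis oOmega : open Omega.
Local Notation lam := (@lebesgue_rV R n).
Local Notation leb := (@lebesgue_measure R).
Local Open Scope ereal_scope.
Implicit Types (nu x : 'rV[R]_n).

(** If [rho > r > d] at a point, its component contains the points at distance [r] on both sides, so
    the length is at least [2 r > 2 d], contrary to [D <= 2 d]. *)
Lemma rho_le_max_length nu x (t0 : R) (D d : \bar R) : max_length Omega nu x <= D ->
  0 <= d -> 2^-1%:E * D <= d -> rho Omega nu (x + t0 *: nu)%R <= d.
Proof.
move=> LD d0 Dd; rewrite leNgt; apply/negP => dr.
set y := (x + t0 *: nu)%R in dr *.
have yO : Omega y.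
  apply: contrapT => yO.
  have : rho Omega nu y <= `|0%R : R|%:E by apply: ereal_inf_lbound; exists 0%R => //=; rewrite scale0r addr0.
  by rewrite normr0 leNgt (le_lt_trans d0 dr).
case: d d0 Dd dr => [d| |]// d0 Dd dr; last by rewrite ltNge leey in dr.
have [r dr1 rr] : exists2 r : R, (d < r)%R & r%:E < rho Omega nu y.
  case: (rho Omega nu y) dr => [q| |]//.
    by rewrite lte_fin => dq; exists ((d + q) / 2)%R; rewrite ?lte_fin; lra.
  by move=> _; exists (d + 1)%R; [lra|exact: ltry].
have r0 : (0 <= r)%R by rewrite lee_fin in d0; lra.
have c0 : chord Omega nu x t0 by [].
pose I := connected_component (chord Omega nu x) t0.
have II (s : R) : (`|s| = r)%R -> I (t0 + s)%R.
  move=> sr; rewrite /I (component_seg oOmega c0) /= addrAC subrr add0r.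
  move: rr; rewrite rhop_rho lt_min => /andP[h1 h2].
  by split; [apply: le_lt_trans h1|apply: le_lt_trans h2]; rewrite lee_fin -sr ?ler_norm// -normrN ler_norm.
have : (r + r)%:E <= max_length Omega nu x.
  apply: (@le_trans _ _ (seg_length I)); last first.
    by apply: ereal_sup_ubound; right; exists I => //; exists t0.
  have h1 : (t0 + r)%:E <= ereal_sup (EFin @` I).
    by apply: ereal_sup_ubound; exists (t0 + r)%R => //; apply: II; rewrite ger0_norm.
  have h2 : ereal_inf (EFin @` I) <= (t0 - r)%:E.
    by apply: ereal_inf_lbound; exists (t0 - r)%R => //; apply: II; rewrite normrN ger0_norm.
  rewrite /seg_length (_ : r + r = (t0 + r) - (t0 - r))%R; last by ring.
  by rewrite EFinB leeB.
move=> h; have {}h := le_trans h LD.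
have : 2^-1%:E * (r + r)%:E <= 2^-1%:E * D by rewrite lee_wpmul2l// lee_fin invr_ge0.
move/le_trans => /(_ _ Dd); rewrite -EFinM lee_fin; lra.
Qed.

Lemma proj_hyperplane_shift nu x (t : R) : edot nu nu = 1%R ->
  proj_hyperplane nu (x + t *: nu)%R = proj_hyperplane nu x.
Proof.
by move=> nu1; rewrite /proj_hyperplane edotDZl nu1 mulr1 scalerDl opprD addrACA subrr addr0.
Qed.

(** The hyperplane measure only sees a cylinder of height 1; the slab formula for the indicator of
    the full cylinder carries nullity over to infinite height. *)
Lemma cylinder_null nu (M : set 'rV[R]_n) : edot nu nu = 1%R -> measurable M ->
  hyperplane_measure nu M = 0 -> lam (proj_hyperplane nu @^-1` M) = 0.
Proof.
move=> nu1 mM M0.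
have mP : measurable (proj_hyperplane nu @^-1` M).
  by rewrite -[X in measurable X]setTI; exact: measurable_proj_hyperplane.
pose f x := (\1_(proj_hyperplane nu @^-1` M) x)%:E : \bar R.
have mf : measurable_fun setT f.
  by apply/measurable_EFinP; exact: measurable_indic.
have f0 x : 0 <= f x by rewrite lee_fin.
transitivity (\int[lam]_x f x); first by rewrite integral_indic// setIT.
rewrite -(ge0_integral_slab nu1 mf f0).
rewrite (@eq_integral_null_set _ _ _ lam (slab nu) (proj_hyperplane nu @^-1` M `&` slab nu) _ (cst 0))//.
- by rewrite integral0.
- by apply: measurableI => //; exact: measurable_slab.
- move=> x xs xM; rewrite (eq_integral (cst 0)) ?integral0// => t _.
  by rewrite /f indicE memNset//= (proj_hyperplane_shift _ _ nu1) => h; apply: xM.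
Qed.

(** The outer essential supremum gives a null set of directions and the inner one, for every other
    direction, a null set of base points; off the cylinder over the latter, [rho <= d] along the
    whole line. *)
Lemma bad_null (d : \bar R) : 0 <= d -> 2^-1%:E * essential_diameter Omega <= d ->
  exists N : set 'rV[R]_n, [/\ measurable N, sphere_measure N = 0 &
    forall nu, unit_sphere nu -> ~ N nu -> lam [set x | bad Omega d (nu, x)] = 0].
Proof.
move=> d0 Dd.
have [N [mN N0 NP]] := @ess_sup_ge _ _ R (@sphere_measure R n)
  (fun nu => ess_sup (hyperplane_measure nu) (max_length Omega nu)).
exists N; split => // nu /unit_sphere_edot nu1 nuN.
have : ess_sup (hyperplane_measure nu) (max_length Omega nu) <= essential_diameter Omega.
  by apply: contrapT => h; apply: nuN; exact: NP.
move/ess_supP => -[M [mM M0 MP]].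
apply/eqP; rewrite -measure_le0 -(cylinder_null nu1 mM M0).
apply: le_measure; rewrite ?inE.
- rewrite -[X in measurable X]setTI.
  apply: (pair1_measurable nu measurableT (Y := bad Omega d)).
  by apply: open_measurable_rVX; exact: open_bad.
- by rewrite -[X in measurable X]setTI; exact: measurable_proj_hyperplane.
move=> x [t /= bt]; apply: MP => /= LD.
move: bt; rewrite ltNge => /negP; apply.
rewrite (_ : x + t *: nu = proj_hyperplane nu x + (edot x nu + t) *: nu)%R; last first.
  by rewrite /proj_hyperplane scalerDl addrA subrK.
exact: rho_le_max_length LD d0 Dd.
Qed.

End bad_null.

(** * The skeletal measures *)

Section chord_midpoints.
Context {R : realType} {n : nat}.
Variable Omega : set 'rV[R]_n.
Hypothesis oOmega : open Omega.
Local Notation leb := (@lebesgue_measure R).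
Implicit Types (nu x y : 'rV[R]_n).

Definition fin_seg nu y := (rhop Omega nu y < +oo)%E && (rhop Omega (- nu) y < +oo)%E.

Lemma fin_segP nu y : fin_seg nu y ->
  exists a b, [/\ rhop Omega (- nu) y = a%:E, rhop Omega nu y = b%:E, 0 <= a & 0 <= b].
Proof.
rewrite /fin_seg; have := rhop_ge0 Omega nu y; have := rhop_ge0 Omega (- nu) y.
case: (rhop Omega nu y) => [b| |]//; case: (rhop Omega (- nu) y) => [a| |]; rewrite ?ltxx ?andbF// => a0 b0 _.
by exists a, b.
Qed.

Lemma fin_seg_shift nu y s : Omega y -> seg Omega nu y s ->
  fin_seg nu (y + s *: nu) = fin_seg nu y.
Proof.
move=> yO ss; rewrite /fin_seg (rhop_shift oOmega yO ss) (rhopN_shift oOmega yO ss).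
by case: (rhop Omega nu y) => [b| |]; case: (rhop Omega (- nu) y) => [a| |]; rewrite //= ?ltry.
Qed.

Lemma seg_len_shift nu y s : Omega y -> seg Omega nu y s -> fin_seg nu y ->
  seg_len Omega nu (y + s *: nu) = seg_len Omega nu y.
Proof.
move=> yO ss /fin_segP[a [b [aE bE _ _]]].
rewrite /seg_len (rhop_shift oOmega yO ss) (rhopN_shift oOmega yO ss) aE bE -EFinB -EFinD /=.
by ring.
Qed.

Lemma seg_mid_shift nu y s : Omega y -> seg Omega nu y s -> fin_seg nu y ->
  seg_mid Omega nu (y + s *: nu) = seg_mid Omega nu y.
Proof.
move=> yO ss /fin_segP[a [b [aE bE _ _]]].
rewrite /seg_mid (rhop_shift oOmega yO ss) (rhopN_shift oOmega yO ss) aE bE -EFinB -EFinD /=.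
by rewrite -addrA -scalerDl; congr (_ + _ *: _); lra.
Qed.

Lemma mid_density_shift f nu y s : Omega y -> seg Omega nu y s ->
  mid_density Omega f nu (y + s *: nu) = mid_density Omega f nu y.
Proof.
move=> yO ss; rewrite /mid_density -!/(fin_seg _ _) fin_seg_shift//.
by case: ifPn => // h; rewrite seg_len_shift// seg_mid_shift.
Qed.

Lemma integral_mid_density_seg f nu y : Omega y -> (forall m, 0 <= f m) ->
  (\int[leb]_(s in seg Omega nu y) mid_density Omega f nu (y + s *: nu)%R)%E =
  if fin_seg nu y then (f (seg_mid Omega nu y))%:E else 0%E.
Proof.
move=> yO f0; have mseg : measurable (seg Omega nu y) by exact: measurable_seg.
transitivity (\int[leb]_(s in seg Omega nu y) (mid_density Omega f nu y))%E.
  by apply: eq_integral => s; rewrite inE => ss; rewrite mid_density_shift.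
rewrite /mid_density -!/(fin_seg _ _); case: ifPn => h; last by rewrite integral0.
have [a [b [aE bE a0 b0]]] := fin_segP h.
have ab0 : 0 < a + b.
  have : (0 < b%:E)%E by rewrite -bE rhop_gt0.
  by rewrite lte_fin; lra.
have LE : leb (seg Omega nu y) = (a + b)%:E.
  rewrite (fin_seg_itv aE bE) lebesgue_measure_itv/= lte_fin.
  by rewrite (_ : - a < b) -?EFinD ?opprK 1?addrC//; lra.
rewrite integral_cst; last exact: mseg.
rewrite [X in (_ * X)%E](_ : _ = (a + b)%:E); last exact: LE.
rewrite -EFinM /seg_len aE bE /= (addrC b) divfK ?gt_eqF//.
Qed.

Lemma seg_mid_in nu y : Omega y -> fin_seg nu y ->
  seg Omega nu y ((fine (rhop Omega nu y) - fine (rhop Omega (- nu) y)) / 2).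
Proof.
move=> yO h; have [a [b [aE bE a0 b0]]] := fin_segP h.
have : (0 < b%:E)%E by rewrite -bE rhop_gt0.
have : (0 < a%:E)%E by rewrite -aE rhop_gt0.
by rewrite (fin_seg_itv aE bE) aE bE /= in_itv/= !lte_fin => *; apply/andP; split; lra.
Qed.

Lemma component_segE nu x t0 : chord Omega nu x t0 ->
  bounded_set (connected_component (chord Omega nu x) t0) <-> fin_seg nu (x + t0 *: nu).
Proof.
move=> ct0; rewrite (component_seg oOmega ct0); split.
  move=> [M [_ MP]]; pose B := Num.max M 0 + 1.
  have BP t : seg Omega nu (x + t0 *: nu) (t - t0) -> `|t| <= B.
    by move=> st; apply: MP => //; rewrite /B ltr_pwDr// le_max lexx.
  have B0 : 0 < B by rewrite /B ltr_pwDr// le_max lexx orbT.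
  have far s : `|s| = B + `|t0| + 1 -> seg Omega nu (x + t0 *: nu) s -> False.
    move=> sB ss; have := BP (s + t0); rewrite addrK => /(_ ss).
    apply/negP; rewrite -ltNge.
    by have := ler_normB (s + t0) t0; rewrite addrK sB; lra.
  have [s0 s1] := seg0 oOmega nu ct0; rewrite oppr0 in s1.
  have z0 : 0 <= B + `|t0| + 1 by have := normr_ge0 t0; lra.
  rewrite /fin_seg !ltey; apply/andP; split; apply/eqP => h.
    apply: (far (B + `|t0| + 1)); first by rewrite ger0_norm.
    by split; rewrite ?h ?ltry//; apply: le_lt_trans s1; rewrite lee_fin oppr_le0.
  apply: (far (- (B + `|t0| + 1))); first by rewrite normrN ger0_norm.
  by split; rewrite ?opprK ?h ?ltry//; apply: le_lt_trans s0; rewrite lee_fin oppr_le0.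
move=> /fin_segP[a [b [aE bE a0 b0]]].
exists (a + b + `|t0|); split; first exact: num_real.
move=> M aM t /=; rewrite (fin_seg_itv aE bE) /= in_itv/= => /andP[h1 h2].
apply/ltW; apply: le_lt_trans aM.
rewrite -[t in `|t|](subrK t0) (le_trans (ler_normD _ _))// lerD2r ler_norml.
by apply/andP; split; lra.
Qed.

Lemma midpoint_component nu x t0 : chord Omega nu x t0 -> fin_seg nu (x + t0 *: nu) ->
  midpoint nu x (connected_component (chord Omega nu x) t0) = seg_mid Omega nu (x + t0 *: nu).
Proof.
move=> ct0 /fin_segP[a [b [aE bE a0 b0]]].
have : (0 < b%:E)%E by rewrite -bE rhop_gt0.
rewrite lte_fin => b1.
rewrite (component_seg oOmega ct0).
have -> : [set t | seg Omega nu (x + t0 *: nu) (t - t0)] = `](t0 - a), (t0 + b)[%classic.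
  rewrite (fin_seg_itv aE bE); apply/seteqP; split => t /=; rewrite !in_itv/= => /andP[h1 h2];
    by apply/andP; split; lra.
have ab : t0 - a < t0 + b by lra.
rewrite /midpoint (@inf_itv _ (BLeft (t0 + b)) false) ?(@sup_itv _ (BRight (t0 - a)) true) ?bnd_simp//.
rewrite /seg_mid aE bE /= -[RHS]addrA -scalerDl; congr (_ + _ *: _); lra.
Qed.

Section chord_sum.
Variables (f : 'rV[R]_n -> R) (nu x : 'rV[R]_n).
Hypotheses (f0 : forall m, 0 <= f m) (cf : continuous f) (fK : compactly_supported Omega f).
Hypothesis nu1 : edot nu nu = 1.
Local Notation C := (chord Omega nu x).
Let S := [set I | bounded_segments Omega nu x I /\ f (midpoint nu x I) != 0].

Lemma compact_line_supp : compact [set t : R | supp f (x + t *: nu)].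
Proof.
have [cS SO] := fK.
have [M [_ MP]] := compact_bounded cS.
have cl : closed [set t : R | supp f (x + t *: nu)].
  rewrite (_ : [set t | _] = (fun t : R => x + t *: nu) @^-1` supp f)//.
  apply: closed_comp; last exact: closed_closure.
  by move=> t _; exact: line_continuous.
pose B := Num.max M 0 + 1; pose r := \sum_(i < n) B + `|edot x nu|.
apply: (@subclosed_compact _ _ `[- r, r]%classic) => //; first exact: segment_compact.
move=> t /= tS; rewrite in_itv/= -ler_norml.
have E : t = edot (x + t *: nu) nu - edot x nu by rewrite edotDZl nu1 mulr1 addrC addKr.
rewrite {1}E (le_trans (ler_normB _ _))// lerD2r.
rewrite /edot (le_trans (ler_norm_sum _ _ _))// ler_sum// => i _.
rewrite -[leRHS]mulr1 normrM ler_pM//; last exact: edot1_coord.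
have : `|x + t *: nu| <= B by apply: (MP B) => //; rewrite /B ltr_pwDr// le_max lexx.
apply: le_trans.
rewrite [leRHS]/Num.norm/= mx_normrE.
exact: (le_bigmax _ (fun ij => `|(x + t *: nu) ij.1 ij.2|) (ord0, i)).
Qed.

Lemma seg_open y : open (seg Omega nu y).
Proof.
rewrite (_ : seg _ _ _ = [set s : R | (s%:E < rhop Omega nu y)%E] `&`
    (-%R @^-1` [set t : R | (t%:E < rhop Omega (- nu) y)%E]))//.
apply: openI; first exact: open_ereal_lt.
by apply: open_comp => [t _|]; [exact: opp_continuous|exact: open_ereal_lt].
Qed.

Lemma chord_component_open t : C t -> open (connected_component C t).
Proof.
move=> Ct; rewrite (component_seg oOmega Ct).
rewrite (_ : [set s | _] = (fun s => s - t) @^-1` seg Omega nu (x + t *: nu))//.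
apply: open_comp; last exact: seg_open.
by move=> s _; apply: cvgB; [exact: cvg_id|exact: cvg_cst].
Qed.

(** Components are open and cover the compact trace of the support on the line, so finitely many
    suffice. A [\sum_(I \in ...)] with infinitely many nonzero terms is 0 by convention, so
    finiteness gives the chord sum its meaning. *)
Lemma finite_segments : finite_set S.
Proof.
have [cS SO] := fK.
have := compact_line_supp; rewrite compact_cover => K.
have [|D DC KD] := K R C (fun t => connected_component C t) chord_component_open.
  by move=> t /SO Ct; exists t => //; exact: connected_component_refl.
suff SD : S `<=` connected_component C @` [set` D].
  by apply: sub_finite_set SD _; apply: finite_image; exact: finite_fset.
move=> I [[[t0 Ct0 <-] bI] fI].
have ft0 : fin_seg nu (x + t0 *: nu) by apply/component_segE.
rewrite midpoint_component// in fI.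
pose m := t0 + (fine (rhop Omega nu (x + t0 *: nu)) - fine (rhop Omega (- nu) (x + t0 *: nu))) / 2.
have mE : seg_mid Omega nu (x + t0 *: nu) = x + m *: nu.
  by rewrite /seg_mid -addrA -scalerDl.
have Im : connected_component C t0 m.
  by rewrite (component_seg oOmega Ct0) /= /m addrAC subrr add0r; exact: seg_mid_in.
have [|t tD tm] := KD m.
  by apply: subset_closure => /=; rewrite -mE.
exists t => //.
have sub s s' : connected_component C s m -> connected_component C s' m ->
    connected_component C s `<=` connected_component C s'.
  move=> h1 h2 r h3.
  apply: connected_component_trans h2 _; apply: connected_component_trans h3.
  exact: connected_component_sym.
by apply/seteqP; split; exact: sub.
Qed.

(** By [integral_mid_density_seg] a bounded component contributes the value of [f] at its midpoint;
    unbounded components, and those whose midpoint is a zero of [f], contribute nothing. *)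
Lemma chord_sumE : measurable_fun setT (mid_density Omega f nu) ->
  (\sum_(I \in bounded_segments Omega nu x) f (midpoint nu x I))%:E =
  (\int[leb]_s (mid_density Omega f nu \_ Omega) (x + s *: nu)%R)%E.
Proof.
move=> mf.
have fS := finite_segments.
have -> : \sum_(I \in bounded_segments Omega nu x) f (midpoint nu x I) =
   \sum_(I \in S) f (midpoint nu x I).
  apply/esym/fsbig_widen; first by move=> I [].
  by move=> I [bI h] /=; apply/eqP; apply: contrapT => fI; apply: h; split => //; exact/negP.
rewrite fsbig_finite//= -sumEFin.
pose F (s : R) := (mid_density Omega f nu \_ Omega) (x + s *: nu).
have F0 s : (0 <= F s)%E by rewrite /F patchE; case: ifP => // _; exact: mid_density_ge0.
have mF : measurable_fun [set: R] F.
  apply: measurableT_comp (measurable_line nu x).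
  apply/(measurable_restrictT _ _).1; first exact: open_measurable_rV.
  exact: measurable_funS mf.
(* This makes the family measurable at every index: sets of reals that are not selected components
   are replaced by the empty set. *)
pose G (I : set R) : set R := if I \in S then I else set0.
have GS I : S I -> G I = I by move=> SI; rewrite /G mem_set.
have SP I : S I -> exists t0, [/\ C t0, I = connected_component C t0 & fin_seg nu (x + t0 *: nu)].
  by move=> [[[t0 Ct0 <-] bI] _]; exists t0; split => //; exact/component_segE.
have mG I : measurable (G I).
  rewrite /G; case: ifPn => // /set_mem /SP[t0 [Ct0 -> _]].
  exact: open_measurable (chord_component_open Ct0).
pose U := \big[setU/set0]_(I <- fset_set S) G I.
have mU : measurable U by apply: bigsetU_measurable.
rewrite [RHS](_ : _ = \int[leb]_(s in U) F s)%E; last first.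
  apply: integral_vanish => // s _ Us; rewrite /F patchE; case: ifPn => //; rewrite inE => Os.
  rewrite /mid_density -!/(fin_seg _ _); case: ifPn => // fs.
  have [->|fm] := eqVneq (f (seg_mid Omega nu (x + s *: nu))) 0; first by rewrite mul0r.
  exfalso; apply: Us; rewrite /U -bigcup_seq.
  have SI : S (connected_component C s).
    split; last by rewrite midpoint_component.
    by split; [exists s|exact/component_segE].
  exists (connected_component C s); first by rewrite /= in_fset_set// inE.
  by rewrite GS//; exact: connected_component_refl.
rewrite (@ge0_integral_bigsetU _ _ _ leb _ G F)//; last 3 first.
- exact: fset_uniq.
- move=> I J; rewrite /= !in_fset_set// !inE => SI SJ; rewrite !GS// => -[s [Is Js]].
  have [[t0 [Ct0 IE _]] [t1 [Ct1 JE _]]] := (SP _ SI, SP _ SJ).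
  move: Is Js; rewrite IE JE => Is Js.
  have sub r r' : connected_component C r s -> connected_component C r' s ->
      connected_component C r `<=` connected_component C r'.
    move=> h1 h2 q h3.
    apply: connected_component_trans h2 _; apply: connected_component_trans h3.
    exact: connected_component_sym.
  by apply/seteqP; split; exact: sub.
- exact: measurable_funS mF.
rewrite big_seq [RHS]big_seq; apply: eq_bigr => I; rewrite in_fset_set// inE => SI.
rewrite GS//; have [t0 [Ct0 -> ft0]] := SP _ SI.
rewrite midpoint_component//.
have -> : connected_component C t0 = [set s | seg Omega nu (x + t0 *: nu) (s + - t0)].
  exact: component_seg.
have mF' : measurable_fun [set: R] (fun s => F (s + t0)).
  by apply: measurableT_comp mF _; apply: measurable_funD => //; exact: measurable_cst.
have E := @integral_set_shift _ (seg Omega nu (x + t0 *: nu)) (- t0) (fun s => F (s + t0)) (measurable_seg Omega _ _) mF' (fun s => F0 _).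
have EF (s : R) : F (s + - t0 + t0) = F s by rewrite subrK.
transitivity (\int[leb]_(s in [set s | seg Omega nu (x + t0 *: nu)%R (s + - t0)%R]) F (s + - t0 + t0)%R)%E; last first.
  by apply: eq_integral => s _; rewrite EF.
rewrite E; have := @integral_mid_density_seg f nu (x + t0 *: nu) Ct0 f0; rewrite ft0 => <-.
apply: eq_integral => s; rewrite inE => ss; apply: esym.
have yE : x + (s + t0) *: nu = x + t0 *: nu + s *: nu by rewrite scalerDl addrA addrAC.
rewrite /F yE; move: (seg_in ss); move: (x + t0 *: nu + s *: nu) => z zO.
by rewrite patchE mem_set.
Qed.

End chord_sum.

End chord_midpoints.

(** * Determination of measures by bump functions *)

Section bumps.
Context {R : realType} {n : nat}.
Variable U : set 'rV[R]_n.
Hypothesis oU : open U.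

Lemma continuous_pos_part (T : topologicalType) (g : T -> R) :
  continuous g -> continuous (fun x => Num.max (g x) 0).
Proof.
move=> cg x; apply: (@continuous_max _ _ g (fun=> 0)); first exact: cg.
exact: cst_continuous.
Qed.

(** [s k] sums tent functions on the first [k] balls of a decomposition of [U], and [f k] truncates
    [k * s k - 1] to [[0, 1]]. Subtracting 1 confines the support to the closed bounded set
    [k * s k >= 1] inside [U], while the factor [k] makes [f k] eventually reach 1 at each point of
    [U]. *)
Lemma open_bumps : exists f : nat -> 'rV[R]_n -> R,
  [/\ forall k, continuous (f k), forall k x, 0 <= f k x <= 1,
      forall k, compactly_supported U (f k),
      forall x, {homo f ^~ x : k l / (k <= l)%N >-> k <= l} &
      forall x, U x -> exists k, f k x = 1].
Proof.
have [F [F0 UE]] := open_rV_bigcup oU.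
pose s (k : nat) (x : 'rV[R]_n) := \sum_(j < k) Num.max ((F j).2 - `|x - (F j).1|) 0.
pose f k x := Num.min 1 (Num.max (k%:R * s k x - 1) 0).
have s0 k x : 0 <= s k x by apply: sumr_ge0 => j _; rewrite le_max lexx orbT.
have cg j : continuous (fun y : 'rV[R]_n => Num.max ((F j).2 - `|y - (F j).1|) 0).
  apply: continuous_pos_part => y.
  apply: (@cvgB _ _ _ (nbhs y) _ (fun=> (F j).2)); first exact: cst_continuous.
  apply: (@cvg_norm _ _ _ (nbhs y)); apply: (@cvgB _ _ _ (nbhs y) _ id (fun=> (F j).1)).
    exact: cvg_id.
  exact: cst_continuous.
have cs k : continuous (s k).
  elim: k => [|j ih] x.
    by rewrite (_ : s 0%N = fun=> 0); [exact: cst_continuous|apply/funext => y; rewrite /s big_ord0].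
  rewrite (_ : s j.+1 = fun x => s j x + Num.max ((F j).2 - `|x - (F j).1|) 0); last first.
    by apply/funext => y; rewrite /s big_ord_recr.
  by apply: (@cvgD _ _ _ (nbhs x) _ (s j)); [exact: ih|exact: cg].
have cks k : continuous (fun x => k%:R * s k x).
  by move=> x; apply: (@cvgM _ _ (nbhs x) _ (fun=> k%:R) (s k)); [exact: cst_continuous|exact: cs].
have cf k : continuous (f k).
  have ch : continuous (fun x => Num.max (k%:R * s k x - 1) 0).
    apply: continuous_pos_part => x.
    by apply: (@cvgB _ _ _ (nbhs x) _ (fun x => k%:R * s k x) (fun=> 1)); [exact: cks|exact: cst_continuous].
  by move=> x; apply: (@continuous_min _ _ (fun=> 1) _ x); [exact: cst_continuous|exact: ch].
have sU k x : 0 < s k x -> U x.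
  move=> sk; apply: contrapT => Ux; move: sk; apply/negP; rewrite -leNgt.
  rewrite /s; apply: sumr_le0 => j _; rewrite ge_max lexx andbT subr_le0 leNgt.
  apply/negP => h; apply: Ux; rewrite UE; exists j => //.
  have F2 : 0 < (F j).2 by apply: le_lt_trans h.
  by rewrite F2 -ball_normE /= distrC.
have Us x : U x -> exists k, 0 < s k x.
  rewrite UE => -[j _]; case: ifPn => // F2; rewrite -ball_normE /= distrC => h.
  exists j.+1; rewrite /s big_ord_recr/= ltr_wpDl//.
    by apply: sumr_ge0 => i _; rewrite le_max lexx orbT.
  by rewrite lt_max subr_gt0 h.
have s_homo x : {homo s ^~ x : k l / (k <= l)%N >-> k <= l}.
  apply: homo_leq => //; first exact: le_trans.
  by move=> k; rewrite /s big_ord_recr/= lerDl le_max lexx orbT.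
exists f; split => //.
- move=> k x; rewrite /f ge_min lexx/= andbT le_min ler01/= le_max lexx orbT //.
- move=> k.
  pose K := [set x | 1 <= k%:R * s k x].
  have cK : closed K.
    apply: (@closed_comp _ _ (fun x => k%:R * s k x) [set y : R | 1 <= y]); last exact: closed_ge.
    by move=> x _; exact: cks.
  have SK : closure [set x | f k x != 0] `<=` K.
    rewrite [X in _ `<=` X](closure_id K).1//; apply: closure_subset => x /=.
    rewrite /K /f /= => h; rewrite leNgt; apply/negP => h1; move/eqP: h; apply.
    by rewrite max_r ?min_r// ?subr_le0 ?ler01// ltW.
  have K_pos x : K x -> 0 < s k x.
    rewrite /K /= => h; rewrite lt_neqAle s0 andbT eq_sym; apply/eqP => h0.
    by move: h; rewrite h0 mulr0 ler10.
  split; last by move=> x /SK /K_pos; exact: sU.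
  apply: (@subclosed_compact _ _ K) => //; first exact: closed_closure.
  apply: bounded_closed_compact => //.
  exists (\sum_(j < k) (`|(F j).1| + (F j).2)); split; first exact: num_real.
  move=> M hM x /K_pos sx; apply/ltW; apply: le_lt_trans hM.
  have [j hj] : exists j : 'I_k, 0 < (F j).2 - `|x - (F j).1|.
    apply: contrapT => h; move: sx; apply/negP; rewrite -leNgt /s; apply: sumr_le0 => j _.
    by rewrite ge_max lexx andbT leNgt; apply/negP => h1; apply: h; exists j.
  rewrite (bigD1 j)//= (@le_trans _ _ (`|(F j).1| + (F j).2))//; last first.
    by rewrite lerDl sumr_ge0// => i _; rewrite addr_ge0.
  rewrite -[x in `|x|](subrK (F j).1) (le_trans (ler_normD _ _))// addrC lerD2l.
  by rewrite subr_gt0 in hj; exact: ltW.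
- move=> x k l kl; rewrite /f le_min ge_min lexx/= ge_min.
  apply/orP; right; rewrite ge_max !le_max lexx orbT andbT lerD2r.
  by rewrite ler_pM ?ler_nat ?s_homo.
- move=> x /Us[k sk].
  pose m := Num.trunc (2 / s k x).
  exists (maxn k m.+1); rewrite /f min_l// le_max lerBrDr.
  apply/orP; left; apply: (@le_trans _ _ (m.+1%:R * s k x)).
    by rewrite -ler_pdivrMr// ltW// truncnS_gt.
  by rewrite ler_pM ?ler_nat ?leq_maxr// s_homo// leq_maxl.
Qed.

End bumps.

Section bump_uniqueness.
Context {R : realType} {n : nat}.
Local Open Scope ereal_scope.

(** The bumps increase to the indicator of [U], so monotone convergence recovers its measure. *)
Lemma measure_open_bumps (m1 m2 : {measure set 'rV[R]_n -> \bar R}) (U : set 'rV[R]_n) :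
  open U ->
  (forall f : 'rV[R]_n -> R, (forall x, 0 <= f x)%R -> continuous f -> compactly_supported U f ->
     \int[m1]_x (f x)%:E = \int[m2]_x (f x)%:E) ->
  m1 U = m2 U.
Proof.
move=> oU m12; have [f [cf f01 Kf f_homo fU]] := open_bumps oU.
have f0 k x : (0 <= f k x)%R by have /andP[] := f01 k x.
have lim_f x : limn (fun k => (f k x)%:E) = (\1_U x)%:E.
  apply/cvg_lim => //; apply: cvg_EFin; first exact: nearW.
  have [xU|xU] := pselect (U x); rewrite indicE.
    have [k fk] := fU x xU; rewrite mem_set//; apply: cvg_near_cst.
    exists k => // l /= kl; apply/eqP; rewrite eq_le; apply/andP; split.
      by have /andP[] := f01 l x.
    by apply: (@le_trans _ _ (f k x)); [rewrite fk|exact: f_homo].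
  rewrite memNset//; apply: cvg_near_cst; apply: nearW => k /=; apply: notin_supp0 => xK.
  by apply: xU; have [_ ] := Kf k; apply.
have key (m : {measure set 'rV[R]_n -> \bar R}) :
    \int[m]_x (f k x)%:E @[k --> \oo] --> m U.
  have mU : measurable U by exact: open_measurable_rV.
  have := @cvg_monotone_convergence _ _ R m setT measurableT (fun k x => (f k x)%:E).
  under [X in _ -> _ -> _ -> _ --> X]eq_integral do rewrite lim_f.
  rewrite integral_indic// setIT; apply.
  - by move=> k; apply/measurable_EFinP; exact: continuous_measurable_rVR.
  - by move=> k x _; rewrite lee_fin.
  - by move=> x _ k l kl; rewrite lee_fin f_homo.
rewrite -(cvg_lim (@ereal_hausdorff R) (key m1)) -(cvg_lim (@ereal_hausdorff R) (key m2)).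
by congr (limn _); apply/funext => k; exact: m12.
Qed.

End bump_uniqueness.

Section skeletal_measure_integral.
Context {R : realType} {n : nat}.
Variables (Omega : set 'rV[R]_n) (nu : 'rV[R]_n).
Hypotheses (oOmega : open Omega) (nu1 : edot nu nu = 1).
Local Notation lam := (@lebesgue_rV R n).
Local Notation leb := (@lebesgue_measure R).
Local Open Scope ereal_scope.

Lemma measurable_mid_density1 (g : 'rV[R]_n -> R) : measurable_fun setT g ->
  measurable_fun setT (mid_density Omega g nu).
Proof.
move=> mg.
have mg' : measurable_fun setT (fun z : 'rV[R]_n * 'rV[R]_n => g z.2).
  exact: measurableT_comp mg measurable_snd.
exact: (measurableT_comp (measurable_mid_density oOmega mg') (measurable_pair1 nu)).
Qed.

Lemma measurable_mid_slice (g : 'rV[R]_n -> R) : measurable_fun setT g ->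
  measurable_fun setT (mid_density Omega g nu \_ Omega).
Proof.
move=> mg; apply/(measurable_restrictT _ _).1; first exact: open_measurable_rV.
by apply: measurable_funTS; exact: measurable_mid_density1.
Qed.

Lemma mid_slice_ge0 (g : 'rV[R]_n -> R) x : (forall m, 0 <= g m)%R ->
  0 <= (mid_density Omega g nu \_ Omega) x.
Proof. by move=> g0; rewrite patchE; case: ifP => // _; exact: mid_density_ge0. Qed.

(** The sum over chords is a line integral of the midpoint density ([chord_sumE]). It is unchanged
    when the base point is projected onto the hyperplane, so the slab formula turns it into a volume
    integral. *)
Lemma hyperplane_chord_sum (f : 'rV[R]_n -> R) : (forall m, 0 <= f m)%R ->
  continuous f -> compactly_supported Omega f ->
  \int[hyperplane_measure nu]_(x in hyperplane nu)
    (\sum_(I \in bounded_segments Omega nu x) f (midpoint nu x I))%:E =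
  \int[lam]_x (mid_density Omega f nu \_ Omega) x.
Proof.
move=> f0 cf fK.
have mf : measurable_fun setT f by exact: continuous_measurable_rVR.
pose F := mid_density Omega f nu \_ Omega.
have mF : measurable_fun setT F := measurable_mid_slice mf.
have F0 x : 0 <= F x by exact: mid_slice_ge0.
pose K (z : 'rV[R]_n * measurableTypeR R) := F (z.1 + z.2 *: nu)%R.
have mK : measurable_fun setT K.
  apply: (measurableT_comp mF).
  by apply: (@measurable_fun_line _ _ _ _ fst (cst nu) snd) => //; exact: measurable_cst.
pose H x := \int[leb]_t F (x + t *: nu)%R.
have mH : measurable_fun setT H.
  exact: (@measurable_fun_fubini_tonelli_F _ _ _ _ R leb K mK (fun=> F0 _)).
have H0 x : 0 <= H x by apply: integral_ge0 => t _; exact: F0.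
transitivity (\int[hyperplane_measure nu]_(x in hyperplane nu) H x).
  apply: eq_integral => x _; rewrite /H /F.
  by apply: (chord_sumE oOmega) => //; exact: measurable_mid_density1.
rewrite (ge0_integral_hyperplane nu1 mH H0) -(ge0_integral_slab nu1 mF F0).
apply: eq_integral => x _.
have mline : measurable_fun [set: R] (fun t : R => F (x + t *: nu)%R).
  by apply: (measurableT_comp mF); exact: measurable_line.
have := @ge0_integralD_shift _ (- edot x nu)%R (fun t : R => F (x + t *: nu)%R) mline (fun=> F0 _).
move=> <-; apply: eq_integral => t _; congr (F _).
by rewrite /proj_hyperplane scalerDl scaleNr addrA addrAC.
Qed.

(* The image under the midpoint map of the region [0 < t < 1/L] of a product
   space: its fibre over [x] has length [1/L], so no measure with density is needed. *)
Lemma mid_measure_spec : exists T : {measure set 'rV[R]_n -> \bar R},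
  forall g : 'rV[R]_n -> R, measurable_fun setT g -> (forall m, 0 <= g m)%R ->
  \int[T]_m (g m)%:E = \int[lam]_x (mid_density Omega g nu \_ Omega) x.
Proof.
pose P (z : 'rV[R]_n * measurableTypeR R) := [/\ Omega z.1, fin_seg Omega nu z.1, (0 < z.2)%R &
  (z.2 * seg_len Omega nu z.1 < 1)%R].
have mE : measurable [set z | P z].
  pose b (z : 'rV[R]_n * measurableTypeR R) := [&& fin_seg Omega nu z.1, (0 < z.2)%R &
    (z.2 * seg_len Omega nu z.1 < 1)%R].
  have mr := measurable_rhop1 oOmega nu; have mrN := measurable_rhop1 oOmega (- nu)%R.
  have mL : measurable_fun setT (seg_len Omega nu).
    exact: (measurableT_comp (measurable_seg_len oOmega) (measurable_pair1 nu)).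
  have mb : measurable_fun setT b.
    apply: measurable_and.
      by apply: (measurableT_comp _ measurable_fst); apply: measurable_and;
        apply: measurable_fun_lte => //; exact: measurable_cst.
    apply: measurable_and; apply: measurable_fun_ltr; try exact: measurable_cst.
      exact: measurable_snd.
    by apply: measurable_funM; [exact: measurable_snd|exact: measurableT_comp mL measurable_fst].
  rewrite (_ : [set z | P z] = (fst @^-1` Omega) `&` (b @^-1` [set true])); last first.
    apply/seteqP; split => z; first by move=> [h1 h2 h3 h4]; split => //=; rewrite /b h2 h3 h4.
    by move=> [h1 /= /and3P[]].
  apply: measurableI; rewrite -[X in measurable X]setTI.
    by apply: measurable_fst => //; exact: open_measurable_rV.
  exact: mb.
pose mid (z : 'rV[R]_n * measurableTypeR R) := seg_mid Omega nu z.1.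
have mmid : measurable_fun setT mid.
  apply: measurableT_comp measurable_fst.
  exact: (measurableT_comp (measurable_seg_mid oOmega) (measurable_pair1 nu)).
pose T' := [the measure _ _ of pushforward (mrestr (lam \x leb) mE) mid].
exists (T' mmid) => g mg g0.
have mg' : measurable_fun setT (fun z => (g (mid z))%:E).
  by apply/measurable_EFinP; exact: measurableT_comp mg mmid.
rewrite (ge0_integral_pushforward mmid)//; last 2 first.
- exact/measurable_EFinP.
- by move=> y _; rewrite lee_fin.
rewrite preimage_setT ge0_integral_mrestr//; last by move=> z; rewrite /= lee_fin.
rewrite integral_mkcond.
have mr : measurable_fun setT ((fun z => (g (mid z))%:E) \_ [set z | P z]).
  by apply/(measurable_restrictT _ _).1 => //; exact: measurable_funTS.
have r0 z : 0 <= ((fun z => (g (mid z))%:E) \_ [set z | P z]) z.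
  by rewrite patchE; case: ifP => // _; rewrite lee_fin.
transitivity (\int[lam]_x \int[leb]_t ((fun z => (g (mid z))%:E) \_ [set z | P z]) (x, t)).
  by apply: (etrans _ (fubini_tonelli1 (m1 := lam) (m2 := leb) _ mr r0)); f_equal.
apply: eq_integral => x _.
rewrite patchE; case: ifPn => [|xO]; last first.
  rewrite notin_setE in xO.
  rewrite (eq_integral (cst 0)) ?integral0// => t _.
  by rewrite patchE memNset// => -[].
rewrite inE => xO.
rewrite /mid_density -/(fin_seg _ _ _); case: ifPn => fx; last first.
  rewrite (eq_integral (cst 0)) ?integral0// => t _.
  by rewrite patchE memNset// => -[_]; rewrite (negbTE fx).
have [a [b [aE bE a0 b0]]] := fin_segP fx.
have L0 : (0 < seg_len Omega nu x)%R.
  have : 0 < b%:E by rewrite -bE rhop_gt0.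
  by rewrite lte_fin /seg_len aE bE /= => ?; rewrite ltr_pwDl.
transitivity (\int[leb]_(t in `]0%R, (seg_len Omega nu x)^-1%R[) (g (seg_mid Omega nu x))%:E).
  rewrite [RHS]integral_mkcond; apply: eq_integral => t _; rewrite !patchE.
  congr (if _ then _ else _); apply/idP/idP; rewrite !inE/= in_itv/=.
    by move=> [_ _ /= -> h]; rewrite -div1r ltr_pdivlMr.
  by move=> /andP[h1 h2]; split => //=; rewrite -ltr_pdivlMr// div1r.
rewrite integral_cst//.
have LE : leb `]0%R, (seg_len Omega nu x)^-1%R[%classic = ((seg_len Omega nu x)^-1)%:E.
  by rewrite lebesgue_measure_itv/= lte_fin invr_gt0 L0 sube0.
rewrite [X in (_ * X)%E](_ : _ = ((seg_len Omega nu x)^-1)%:E); last exact: LE.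
by rewrite EFinM.
Qed.

Lemma measurable_skeleton : measurable (skeleton Omega nu).
Proof.
apply: measurableI; last exact: open_measurable_rV.
rewrite -[closure _]setCK; apply: measurableC; apply: open_measurable_rV.
by apply: closed_openC; exact: closed_closure.
Qed.

Lemma skeletal_integral_ext (mu : {measure set 'rV[R]_n -> \bar R}) (g : 'rV[R]_n -> \bar R) :
  skeletal_measure Omega nu mu ->
  \int[mu]_(m in skeleton Omega nu) g m = \int[mu]_m g m.
Proof.
move=> [mu0 _ _]; have mS := measurable_skeleton.
rewrite integral_mkcond; apply: (@eq_integral_null_set _ _ _ mu setT (~` skeleton Omega nu)) => //.
  exact: measurableC.
by move=> x _ /contrapT xS; rewrite patchE mem_set.
Qed.

(** Bump functions give agreement on open subsets of [Omega]. For Borel sets both measures are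
    restricted to the sets [O k], which exhaust [Omega] and lie in compact supports, hence have
    finite measure; neither measure charges the complement of [Omega], midpoints of components being
    in [Omega]. *)
Lemma skeletal_measure_eq (mu T : {measure set 'rV[R]_n -> \bar R}) :
  skeletal_measure Omega nu mu ->
  (forall g : 'rV[R]_n -> R, measurable_fun setT g -> (forall m, 0 <= g m)%R ->
    \int[T]_m (g m)%:E = \int[lam]_x (mid_density Omega g nu \_ Omega) x) ->
  forall A, measurable A -> mu A = T A.
Proof.
move=> muS TP; have [mu0 muK muf] := muS.
have mO : measurable Omega by exact: open_measurable_rV.
have op (U : set 'rV[R]_n) : open U -> U `<=` Omega -> mu U = T U.
  move=> oU UO; apply: measure_open_bumps => // f f0 cf [cK KU].
  have fK : compactly_supported Omega f by split => //; exact: subset_trans UO.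
  rewrite -(skeletal_integral_ext _ muS) muf// hyperplane_chord_sum// TP//.
  exact: continuous_measurable_rVR.
have [f [cf f01 Kf f_homo fO]] := open_bumps oOmega.
pose O (k : nat) := [set x | (2^-1 < f k x)%R].
have oO k : open (O k).
  rewrite (_ : O k = f k @^-1` [set y | (2^-1 < y)%R])//.
  by apply: open_comp => [x _|]; [exact: cf|exact: open_gt].
have OO k : O k `<=` Omega.
  move=> x; rewrite /O /= => h; apply: contrapT => xO; move: h; rewrite (@notin_supp0 _ _ (f k) x).
    by apply/negP; rewrite -leNgt invr_ge0.
  by move=> xK; apply: xO; have [_] := Kf k; apply.
have Ofin k : mu (O k) < +oo.
  have [cK KO] := Kf k; apply: le_lt_trans (muK _ cK KO).
  apply: le_measure; rewrite ?inE.
  - exact: open_measurable_rV.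
  - rewrite -[closure _]setCK; apply: measurableC; apply: open_measurable_rV.
    by apply: closed_openC; exact: closed_closure.
  move=> x /= h; apply: subset_closure => /=; rewrite gt_eqF//.
  by apply: lt_trans h; rewrite invr_gt0.
have OU : \bigcup_k O k = Omega.
  apply/seteqP; split => [x [k _] /OO//|x /fO[k fk]].
  by exists k => //; rewrite /O /= fk invf_lt1// ltr1n.
have nO : nondecreasing_seq O.
  by move=> k l kl; apply/subsetPset => x /= h; apply: lt_le_trans h _; exact: f_homo.
have T0 : T (~` Omega) = 0.
  rewrite -[~` Omega]setIT -integral_indic//; last exact: measurableC.
  rewrite TP//; last by apply: measurable_indic; exact: measurableC.
  rewrite (eq_integral (cst 0)) ?integral0// => x _; rewrite patchE; case: ifPn => //.
  rewrite inE => xO; rewrite /mid_density -/(fin_seg _ _ _); case: ifPn => // fx.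
  rewrite indicE memNset ?mul0r//= => h; apply: h.
  exact: seg_in (seg_mid_in oOmega xO fx).
have muO : mu (~` Omega) = 0.
  apply/eqP; rewrite -measure_le0 -mu0; apply: le_measure; rewrite ?inE.
  - exact: measurableC.
  - by apply: measurableC; exact: measurable_skeleton.
  by apply: subsetC => x [].
move=> A mA.
have step k : mu (A `&` O k) = T (A `&` O k).
  have mOk : measurable (O k) by exact: open_measurable_rV.
  apply: (@measure_unique _ R _ (@open 'rV[R]_n) (fun=> setT) _ _ _ _ (mrestr mu mOk) (mrestr T mOk)) => //.
  - exact: openI.
  - by move=> _; exact: openT.
  - by rewrite bigcup_const//; exists 0%N.
  - by move=> U oU; rewrite /= /mrestr; apply: op; [exact: openI|move=> x [_ /OO]].
  - by move=> _; rewrite /= /mrestr setTI.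
have AO (m : {measure set 'rV[R]_n -> \bar R}) : m (~` Omega) = 0 ->
    m (A `&` O k) @[k --> \oo] --> m A.
  move=> m0.
  have -> : m A = m (\bigcup_k (A `&` O k)).
    rewrite -setI_bigcupr OU -[in LHS](setIT A) -(setUv Omega) setIUr measureU//; last 3 first.
    - exact: measurableI.
    - by apply: measurableI => //; exact: measurableC.
    - by rewrite setIACA setICr setI0.
    rewrite [X in _ + X](_ : _ = 0) ?adde0//; apply/eqP; rewrite -measure_le0 -m0.
    apply: le_measure; rewrite ?inE; [|exact: measurableC|by move=> x []].
    by apply: measurableI => //; exact: measurableC.
  apply: nondecreasing_cvg_mu.
  - by move=> k; apply: measurableI => //; exact: open_measurable_rV.
  - by apply: bigcup_measurable => k _; apply: measurableI => //; exact: open_measurable_rV.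
  - by move=> k l kl; apply/subsetPset; apply: setIS; exact/subsetPset/nO.
rewrite -(cvg_lim (@ereal_hausdorff R) (AO mu muO)) -(cvg_lim (@ereal_hausdorff R) (AO T T0)).
by congr (limn _); apply/funext => k; exact: step.
Qed.

(** Extends the defining property from continuous functions with compact support to nonnegative
    Borel ones; the integrand of the skeletal mean involves [rho], which is in general not
    continuous. *)
Lemma skeletal_integral (mu : {measure set 'rV[R]_n -> \bar R}) (g : 'rV[R]_n -> R) :
  skeletal_measure Omega nu mu -> measurable_fun setT g -> (forall m, 0 <= g m)%R ->
  \int[mu]_(m in skeleton Omega nu) (g m)%:E =
  \int[lam]_x (mid_density Omega g nu \_ Omega) x.
Proof.
move=> muS mg g0; have [T TP] := mid_measure_spec.
rewrite skeletal_integral_ext// -TP//; apply: eq_measure_integral => A mA _.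
exact: skeletal_measure_eq muS TP A mA.
Qed.

End skeletal_measure_integral.

(** * The averaged identity *)

Section sphere_average.
Context {R : realType} {n : nat}.
Variables (p : R) (rad : \bar R) (V W phi : R -> R).
Variables (Omega : set 'rV[R]_n) (d : \bar R) (u : 'rV[R]_n -> R).
Hypothesis adm : admissible p rad V W phi Omega d u.
Local Notation T2 := ('rV[R]_n * 'rV[R]_n)%type.
Local Notation good := (good Omega d).
Local Notation lam := (@lebesgue_rV R n).
Local Notation sig := (@sphere_measure R n).
Local Notation dG := (dG p rad V Omega u).
Local Notation dP := (dP p rad W Omega u).
Local Notation dC := (dC p rad V phi Omega u).
Local Notation dS := (dS p rad Omega u).
Local Notation skelp := (skelp p V phi).
Local Notation skeln := (skeln p V phi).
Local Open Scope ereal_scope.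
Let oOmega := adm_open adm.

Definition slice_int (F : T2 -> \bar R) (nu : 'rV[R]_n) : \bar R :=
  \int[lam]_x (F \_ good) (nu, x).

Definition sphere_int (F : T2 -> \bar R) : \bar R :=
  \int[sig]_(nu in unit_sphere) slice_int F nu.

Section nonneg.
Variable F : T2 -> \bar R.
Hypotheses (mF : measurable_fun setT F) (F0 : forall z, 0 <= F z).

Lemma slice_int_ge0 nu : 0 <= slice_int F nu.
Proof. by apply: integral_ge0 => x _; exact: mask_ge0. Qed.

Lemma sphere_int_ge0 : 0 <= sphere_int F.
Proof. by apply: integral_ge0 => x _; exact: slice_int_ge0. Qed.

Lemma measurable_slice_int : measurable_fun setT (slice_int F).
Proof.
apply: (@measurable_fun_fubini_tonelli_F _ _ _ _ R lam (F \_ good)).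
  exact: (measurable_mask adm).
by move=> z; exact: mask_ge0.
Qed.

Lemma sphere_int_swap :
  sphere_int F = \int[lam]_x \int[sig]_(nu in unit_sphere) (F \_ good) (nu, x).
Proof.
pose K := (F \_ good) \_ [set z : T2 | unit_sphere z.1].
have mS : measurable [set z : T2 | unit_sphere z.1].
  by rewrite -[X in measurable X]setTI; apply: measurable_fst => //; exact: measurable_unit_sphere.
have mK : measurable_fun setT K.
  by apply/(measurable_restrictT _ _).1 => //; apply: measurable_funTS; exact: (measurable_mask adm).
have K0 z : 0 <= K z by rewrite /K patchE; case: ifP => // _; exact: mask_ge0.
rewrite /sphere_int integral_mkcond.
transitivity (\int[sig]_nu \int[lam]_x K (nu, x)).
  apply: eq_integral => nu _; rewrite patchE; case: ifPn => nuS.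
    rewrite /slice_int; apply: eq_integral => x _.
    by rewrite /K [RHS]patchE mem_set//; rewrite inE in nuS.
  rewrite (eq_integral (cst 0)) ?integral0// => x _.
  by rewrite /K patchE memNset//; rewrite notin_setE in nuS.
apply: (etrans (@fubini_tonelli _ _ _ _ R sig lam K mK K0)).
apply: eq_integral => x _; rewrite [RHS]integral_mkcond; apply: eq_integral => nu _.
by rewrite /K !patchE; congr (if _ then _ else _); apply/idP/idP; rewrite !inE.
Qed.

End nonneg.

Lemma sphere_identity :
  sphere_int dG + 2%:E * sphere_int (dS skeln) =
  sphere_int dP + 2%:E * sphere_int (dS skelp) + sphere_int dC.
Proof.
have [mG mP mC] := And3 (measurable_dG adm) (measurable_dP adm) (measurable_dC adm).
have [G0 P0 C0] := And3 (dG_ge0 adm) (dP_ge0 adm) (dC_ge0 adm).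
have mSp := measurable_dSp adm; have mSn := measurable_dSn adm.
have ms F : measurable_fun setT F -> (forall z, 0 <= F z) -> measurable_fun unit_sphere (slice_int F).
  by move=> mF F0; apply: measurable_funTS; exact: measurable_slice_int.
have mU := @measurable_unit_sphere R n.
have EA := @ge0_integralDZ _ _ _ sig unit_sphere (slice_int dG) (slice_int (dS skeln)) mU
  (ms _ mG G0) (ms _ mSn (@dSn_ge0 _ _ _ _ _ _ _ _)) (slice_int_ge0 G0) (slice_int_ge0 (@dSn_ge0 _ _ _ _ _ _ _ _)).
have EB := @ge0_integralDZD _ _ _ sig unit_sphere (slice_int dP) (slice_int (dS skelp)) (slice_int dC) mU
  (ms _ mP P0) (ms _ mSp (@dSp_ge0 _ _ _ _ _ _ _ _)) (ms _ mC C0)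
  (slice_int_ge0 P0) (slice_int_ge0 (@dSp_ge0 _ _ _ _ _ _ _ _)) (slice_int_ge0 C0).
apply: (etrans (esym EA)); apply: (etrans _ EB); apply: eq_integral => nu; rewrite inE => /unit_sphere_edot nu1.
exact: slice_identity.
Qed.

Section null_fibers.
Hypothesis bad0 : exists N : set 'rV[R]_n, [/\ measurable N, sig N = 0 &
    forall nu, unit_sphere nu -> ~ N nu -> lam [set x | bad Omega d (nu, x)] = 0].

(** Bad points are null for almost every direction; Tonelli turns this into null sets of directions
    for almost every point, the form required by spherical means taken at fixed [x]. *)
Lemma bad_null_fiber : exists M : set 'rV[R]_n, [/\ measurable M, lam M = 0 &
  forall x, ~ M x -> exists N, [/\ measurable N, sig N = 0 &
    forall nu, unit_sphere nu -> ~ N nu -> ~ bad Omega d (nu, x)]].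
Proof.
have [N [mN N0 NP]] := bad0.
have ob : open (bad Omega d) by apply: open_bad; [exact: oOmega|exact: (adm_d0 adm)].
pose B := [set z : T2 | unit_sphere z.1 /\ bad Omega d z].
have mB : measurable B.
  apply: measurableI.
    by rewrite -[X in measurable X]setTI; apply: measurable_fst => //; exact: measurable_unit_sphere.
  by apply: open_measurable_rVX; exact: ob.
pose K (z : T2) : \bar R := (\1_B z)%:E.
have mK : measurable_fun setT K by apply/measurable_EFinP; exact: measurable_indic.
have K0 z : 0 <= K z by rewrite lee_fin.
pose G x := \int[sig]_nu K (nu, x).
have mG : measurable_fun setT G by exact: (@measurable_fun_fubini_tonelli_G _ _ _ _ R sig K mK K0).
have mBx x : measurable [set nu | B (nu, x)].
  rewrite -[X in measurable X]setTI; exact: (pair2_measurable x measurableT (Y := B)).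
have Gsec x : G x = sig [set nu | B (nu, x)].
  transitivity (\int[sig]_nu (\1_[set nu | B (nu, x)] nu)%:E); last by rewrite integral_indic// setIT.
  apply: eq_integral => nu _.
  by rewrite /K !indicE; congr ((_ : bool)%:R%:E); apply/idP/idP; rewrite !inE.
have G0 : \int[lam]_x G x = 0.
  rewrite -(@fubini_tonelli _ _ _ _ R sig lam K mK K0).
  rewrite (@eq_integral_null_set _ _ _ sig setT N _ (cst 0))//; first exact: integral0.
  move=> nu _ nuN.
  have [nuS|nuS] := pselect (unit_sphere nu); last first.
    by rewrite (eq_integral (cst 0)) ?integral0// => x _; rewrite /K indicE memNset// => -[].
  have mb : measurable [set x | bad Omega d (nu, x)].
    rewrite -[X in measurable X]setTI; apply: (pair1_measurable nu measurableT (Y := bad Omega d)).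
    by apply: open_measurable_rVX; exact: ob.
  rewrite (@eq_integral_null_set _ _ _ lam setT [set x | bad Omega d (nu, x)] _ (cst 0))//.
  - exact: integral0.
  - exact: NP.
  - by move=> x _ xb; rewrite /K indicE memNset// => -[].
have Gpos x : `|G x| = G x by rewrite gee0_abs// integral_ge0.
have [|M [mM M0 MP]] := (@ae_eq_integral_abs _ _ R lam setT measurableT G mG).1 _.
  by under eq_integral do rewrite Gpos.
exists M; split => // x xM; exists [set nu | B (nu, x)]; split => //.
  rewrite -Gsec; apply: contrapT => Gx; apply: xM; apply: MP => /= h; apply: Gx; exact: h.
by move=> nu nuS h1 h2; apply: h1.
Qed.

End null_fibers.

End sphere_average.

Section ereal_cancellation.
Context {R : realType}.
Local Open Scope ereal_scope.
Implicit Types (x y z G P S C : \bar R).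

Lemma addeM0 x y z : z = 0 -> x + y * z = x.
Proof. by move=> ->; rewrite mule0 adde0. Qed.

Lemma adde_r0 x z : z = 0 -> x + z = x.
Proof. by move=> ->; rewrite adde0. Qed.

Lemma sube_sum_fin G P S C : 0 <= P -> P < +oo -> 0 <= S -> 0 <= C -> G = P + S + C -> G - P = S + C.
Proof.
case: P => [q| |]// _ _; case: S => [s| |]//; case: C => [c| |]// _ _ -> //.
by rewrite -!EFinD; congr _%:E; ring.
Qed.

(** The finite term [Sp] can be moved across, and [adde_def] rules out the remaining sums of
    opposite infinities. *)
Lemma sube_sum_def G P Sp Sn C : 0 <= G -> 0 <= P -> 0 <= Sp -> 0 <= Sn -> 0 <= C -> Sp < +oo ->
  G + Sn = P + Sp + C -> adde_def G (- P) -> adde_def (Sp - Sn) C ->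
  G - P = Sp - Sn + C.
Proof.
case: Sp => [sp| |]//; case: G => [g| |]//; case: P => [q| |]//; case: Sn => [sn| |]//;
  case: C => [c| |]//= _ _ _ _ _ _.
by rewrite -!EFinD => -[h] _ _; congr _%:E; move: h; lra.
Qed.

Lemma sube_sum_pinfty P Sp Sn : 0 <= P -> 0 <= Sp -> 0 <= Sn -> Sp < +oo ->
  adde_def +oo (- P) -> adde_def (Sp - Sn) +oo -> +oo - P = Sp - Sn + +oo.
Proof. by case: P => [q| |]//; case: Sp => [sp| |]//; case: Sn => [sn| |]. Qed.

Lemma twice_sube (Sp Sn : \bar R) : Sp \is a fin_num -> 0 <= Sn ->
  2%:E * (Sp - Sn) = 2%:E * Sp - 2%:E * Sn.
Proof.
case: Sp => [sp| |]// _; case: Sn => [sn| |]// _.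
  by rewrite -EFinB -!EFinM -EFinB mulrBr.
by rewrite /= !gt0_muley// addeNy gt0_muleNy.
Qed.

End ereal_cancellation.

(** * Finiteness and the energies *)

Section energies.
Context {R : realType} {n : nat}.
Variables (p : R) (rad : \bar R) (V W phi : R -> R).
Variables (Omega : set 'rV[R]_n) (d : \bar R) (u : 'rV[R]_n -> R).
Hypothesis adm : admissible p rad V W phi Omega d u.
Local Notation T2 := ('rV[R]_n * 'rV[R]_n)%type.
Local Notation good := (good Omega d).
Local Notation lam := (@lebesgue_rV R n).
Local Notation sig := (@sphere_measure R n).
Local Notation dG := (dG p rad V Omega u).
Local Notation dP := (dP p rad W Omega u).
Local Notation dF := (dF p rad W Omega u).
Local Notation dC := (dC p rad V phi Omega u).
Local Notation dS := (dS p rad Omega u).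
Local Notation skelp := (skelp p V phi).
Local Notation skeln := (skeln p V phi).
Local Notation sphere_int := (sphere_int Omega d).
Local Notation slice_int := (slice_int Omega d).
Local Open Scope ereal_scope.
Let oOmega := adm_open adm.
Let p1 := adm_p adm.
Let pn0 : (p != 0)%R. Proof. by rewrite gt_eqF// (lt_trans _ p1). Qed.
Let tu := adm_test adm.
Hypothesis bad0 : exists N : set 'rV[R]_n, [/\ measurable N, sig N = 0 &
    forall nu, unit_sphere nu -> ~ N nu -> lam [set x | bad Omega d (nu, x)] = 0].

Lemma rad_pinfty nu x : good (nu, x) -> rho Omega nu x = +oo -> rad = +oo.
Proof.
move=> gx rE; have := good_rho gx; rewrite rE leye_eq => /eqP dE.
by case: (adm_d adm) => [|[]//]; rewrite dE ltNge leey.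
Qed.

Lemma V_at_good nu x : good (nu, x) ->
  V_at V (rho Omega nu x) = ext rad V (V_at V +oo) (rho Omega nu x).
Proof.
move=> gx; have r0 : 0 <= rho Omega nu x by rewrite rhop_rho le_min !rhop_ge0.
case rE : (rho Omega nu x) r0 => [t| |]// _.
  by rewrite ext_in//; exact: (good_in adm gx).
by rewrite /ext eqxx (rad_pinfty gx rE) eqxx.
Qed.

(** Passes from a volume integral of spherical means to the masked double integral: almost every [x]
    meets bad pairs only in a null set of directions. [H] may be non-measurable, since it is
    compared pointwise off a null set. *)
Lemma sphere_int_fiber (F : T2 -> \bar R) (H : 'rV[R]_n -> \bar R) :
  measurable_fun setT F -> (forall z, 0 <= F z) ->
  (forall x N, Omega x -> measurable N -> sig N = 0 ->
    (forall nu, unit_sphere nu -> ~ N nu -> good (nu, x)) ->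
    H x = \int[sig]_(nu in unit_sphere) (F \_ good) (nu, x)) ->
  \int[lam]_(x in Omega) H x = sphere_int F.
Proof.
move=> mF F0 HF; rewrite (sphere_int_swap adm mF F0).
have [M [mM M0 MP]] := bad_null_fiber adm bad0.
rewrite integral_mkcond; apply: (@eq_integral_null_set _ _ _ lam setT M) => // x _ xM.
rewrite patchE; case: ifPn => xO; last first.
  rewrite notin_setE in xO; rewrite (eq_integral (cst 0)) ?integral0// => nu _.
  by rewrite patchE memNset// => -[].
rewrite inE in xO; have [N [mN N0 NP]] := MP x xM.
by apply: (HF x N) => // nu nuS nuN; split => //=; exact: NP.
Qed.

Lemma fiber_mask (F : T2 -> \bar R) (f : 'rV[R]_n -> \bar R) x N :
  measurable N -> sig N = 0 -> (forall nu, unit_sphere nu -> ~ N nu -> good (nu, x)) ->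
  (forall nu, unit_sphere nu -> good (nu, x) -> f nu = F (nu, x)) ->
  \int[sig]_(nu in unit_sphere) f nu = \int[sig]_(nu in unit_sphere) (F \_ good) (nu, x).
Proof.
move=> mN N0 NP fF; apply: (eq_integral_null_set mN N0) => nu nuS nuN.
have gx := NP nu nuS nuN.
by rewrite patchE mem_set// fF.
Qed.

Lemma measurable_slice2 (F : T2 -> \bar R) x : measurable_fun setT F ->
  measurable_fun setT (fun nu => F (nu, x)).
Proof. by move=> mF; apply: (measurableT_comp mF); exact: measurable_pair2. Qed.

Lemma gradient_energyE VM : (0 < n)%N -> is_V_mean Omega p V VM ->
  gradient_energy Omega p VM u = sphere_int dG.
Proof.
move=> n0 hVM; apply: sphere_int_fiber; [exact: measurable_dG adm|exact: dG_ge0 adm|].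
move=> x N xO mN N0 NP; set g := gradient u x.
have g0 := edot_ge0 g.
(* A zero gradient has no direction; there both integrands are 0, even if [VM x] is infinite,
   because a product with 0 is 0. *)
have [e0|e0] := eqVneq (enorm g) 0%R.
  rewrite e0 powR0// mule0; apply/esym; rewrite (eq_integral (cst 0)) ?integral0// => nu _.
  rewrite patchE; case: ifP => // _; rewrite /dG /=.
  have gg : edot g g = 0%R by apply/eqP; rewrite -(sqr_sqrtr g0) -/(enorm g) e0 expr0n.
  have g00 : forall i, g ord0 i = 0%R.
    by move=> i; apply/eqP; rewrite -sqrf_eq0 eq_le sqr_ge0 andbT -gg le_edot_coord.
  have -> : dirder u nu x = 0%R by rewrite /dirder /edot big1// => i _; rewrite -/g g00 mul0r.
  by rewrite normr0 powR0// mule0.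
have eg : (0 < enorm g)%R by rewrite lt_neqAle eq_sym e0 sqrtr_ge0.
have ue : unit_sphere (direction g).
  rewrite /unit_sphere /direction /= /enorm.
  rewrite (_ : edot _ _ = (enorm g)^-1 ^+ 2 * edot g g)%R; last first.
    by rewrite /edot mulr_sumr; apply: eq_bigr => i _; rewrite !mxE; ring.
  by rewrite -(sqr_sqrtr g0) -/(enorm g) -exprMn mulVf// expr1n sqrtr1.
rewrite (hVM _ ue x xO) /V_mean.
have cosE nu : unit_sphere nu -> cos_angle nu (direction g) = (dirder u nu x / enorm g)%R.
  move=> nuS; rewrite /cos_angle nuS ue mulr1 divr1 /dirder -/g /direction /edot mulr_suml.
  by apply: eq_bigr => i _; rewrite !mxE; ring.
pose F (z : T2) : \bar R := ext rad V (V_at V +oo) (rho Omega z.1 z.2) *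
   (`|dirder u z.1 z.2 / enorm g| `^ p)%R%:E.
have F0 z : 0 <= F z.
  apply: mule_ge0; last by rewrite lee_fin powR_ge0.
  apply: ext_ge0 => [t /(adm_pos adm) [/ltW]//|].
  exact: (V_at_pinfty_ge0 (adm_pos adm)).
have mF : measurable_fun setT F.
  apply: emeasurable_funM; first by apply: (measurable_ext adm); exact: (continuous_V adm).
  apply/measurable_EFinP; apply: measurable_fun_norm_powR.
  by apply: measurable_funM; [exact: measurable_dirder adm|exact: measurable_cst].
rewrite (@fiber_mask F _ x N)//; last first.
  by move=> nu nuS gx; rewrite /F /= -V_at_good// cosE.
rewrite -ge0_integralZr//; last 4 first.
- exact: measurable_unit_sphere.
- by apply: measurable_funTS; apply: measurable_slice2; apply: (measurable_mask adm); exact: mF.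
- by move=> nu _; exact: mask_ge0.
- by rewrite lee_fin powR_ge0.
apply: eq_integral => nu _; rewrite !patchE; case: ifP => _; last by rewrite mul0e.
rewrite /F /dG /= -muleA -EFinM -powRM ?normr_ge0 ?(ltW eg)//.
by rewrite -[in X in (_ * X)%R](ger0_norm (ltW eg)) -normrM divfK.
Qed.

Lemma potential_energyE :
  potential_energy Omega p W u = sphere_int dP + sphere_int dF.
Proof.
have [mP mF] := (measurable_dP adm, measurable_dF adm).
have [P0 F0] := (dP_ge0 adm, dF_ge0 adm).
have mPF : measurable_fun setT (dP \+ dF)%E by exact: emeasurable_funD.
have PF0 z : 0 <= (dP \+ dF)%E z by rewrite adde_ge0.
transitivity (sphere_int (dP \+ dF)%E); last first.
  rewrite /sphere_int -ge0_integralD//.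
  - apply: eq_integral => nu _; rewrite /slice_int -ge0_integralD//.
    + apply: eq_integral => x _; rewrite !patchE; case: ifP => // _.
      by rewrite adde0.
    + by move=> x _; exact: mask_ge0.
    + by apply: measurable_slice; apply: (measurable_mask adm); exact: mP.
    + by move=> x _; exact: mask_ge0.
    + by apply: measurable_slice; apply: (measurable_mask adm); exact: mF.
  - exact: measurable_unit_sphere.
  - by move=> x _; exact: slice_int_ge0.
  - by apply: measurable_funTS; exact: (measurable_slice_int adm).
  - by move=> x _; exact: slice_int_ge0.
  - by apply: measurable_funTS; exact: (measurable_slice_int adm).
apply: sphere_int_fiber => // x N xO mN N0 NP.
rewrite /W_mean.
have [u0|u0] := eqVneq (`|u x| `^ p)%R 0%R.
  rewrite u0 mule0; apply/esym; rewrite (eq_integral (cst 0)) ?integral0// => nu _.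
  by rewrite patchE; case: ifP => // _; rewrite /dP /dF /= u0 !mule0 adde0.
pose F (z : T2) := ext rad W 0 (rho Omega z.1 z.2) + ext rad (cst 0%R) (W_at W +oo) (rho Omega z.1 z.2).
have e1 z : 0 <= ext rad W 0 (rho Omega z.1 z.2).
  by apply: ext_ge0 => // t /(adm_pos adm) [_ /ltW].
have e2 z : 0 <= ext rad (cst 0%R) (W_at W +oo) (rho Omega z.1 z.2).
  by apply: ext_ge0 => [t //|]; exact: (W_at_pinfty_ge0 (adm_pos adm)).
have FF0 z : 0 <= F z by rewrite adde_ge0.
have mFF : measurable_fun setT F.
  apply: emeasurable_funD; first by apply: (measurable_ext adm); exact: (continuous_W adm).
  by apply: (measurable_ext adm) => t _; exact: cst_continuous.
rewrite (@fiber_mask F _ x N)//; last first.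
  move=> nu nuS gx; rewrite /F /=.
  have r0 : 0 <= rho Omega nu x by rewrite rhop_rho le_min !rhop_ge0.
  case rE : (rho Omega nu x) r0 => [t| |]// _.
    have It := good_in adm gx rE.
    by rewrite !ext_in//= adde0.
  by rewrite /ext eqxx (rad_pinfty gx rE) eqxx add0e.
rewrite -ge0_integralZr//; last 3 first.
- exact: measurable_unit_sphere.
- by apply: measurable_funTS; apply: measurable_slice2; apply: (measurable_mask adm); exact: mFF.
- by move=> nu _; exact: mask_ge0.
apply: eq_integral => nu _; rewrite !patchE; case: ifP => _; last by rewrite mul0e.
rewrite /F /dP /dF /=; exact: ge0_muleDl (e1 (nu, x)) (e2 (nu, x)).
Qed.

(** Near a point that is not the midpoint of a bounded chord, [rho] is affine along the line with
    slope [orient] or identically [+oo], so the quotient rule applies; at a midpoint it has a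
    corner. On full lines [phi_at] is the constant 1. *)
Lemma phi_line_derive nu x : good (nu, x) ->
  (rhop Omega nu x = rhop Omega (- nu)%R x -> rhop Omega nu x = +oo) ->
  (phi_at phi (rho Omega nu x) * 'D_nu (fun y => u y / phi_at phi (rho Omega nu y)) x =
   dirder u nu x - orient Omega (nu, x) * u x *
     (log_slope phi \_ [set t | in_interval rad t]) (fine (rho Omega nu x)))%R.
Proof.
move=> gx hx; have xO : Omega x by case: gx.
have C1u := test_function_C1 tu.
have du : is_derive (0%R : R) 1%R (fun t : R => u (x + t *: nu))%R (dirder u nu x).
  exact: is_derive_dirder0.
pose w (y : 'rV[R]_n) := (u y / phi_at phi (rho Omega nu y))%R.
have lineD (g : R -> R) dg : (\forall t \near (0%R : R), w (x + t *: nu)%R = g t) ->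
    is_derive (0%R : R) 1%R g dg -> 'D_nu w x = dg.
  move=> wg dgP.
  have : is_derive (0%R : R) 1%R (fun t : R => w (x + t *: nu)%R) dg.
    by apply: near_eq_is_derive dgP; apply: filterS wg => t ->.
  by move=> /is_derive_lineP; rewrite scale0r addr0 => -[_ <-].
have a0 := rhop_ge0 Omega (- nu)%R x; have b0 := rhop_ge0 Omega nu x.
have nearseg : \forall t \near (0%R : R), seg Omega nu x t.
  have os : open (seg Omega nu x) by exact: seg_open.
  by move: os; rewrite openE => /(_ 0%R); apply; exact: seg0.
have [[bE aE]|hfin] := pselect (rhop Omega nu x = +oo /\ rhop Omega (- nu)%R x = +oo).
  rewrite /orient /= bE aE ltxx !mul0r subr0 rhop_rho bE aE minxx /= mul1r.
  apply: lineD du; near=> t.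
  have ss : seg Omega nu x t by near: t.
  rewrite /w rhop_rho (rhop_shift oOmega xO ss) (rhopN_shift oOmega xO ss) aE bE minxx /=.
  by rewrite divr1.
have [s [t0 [sE r0E rE]]] : exists s t0, [/\ orient Omega (nu, x) = s, rho Omega nu x = t0%:E &
    (\forall t \near (0%R : R), rho Omega nu (x + t *: nu)%R = (t0 + s * t)%R%:E)].
  have smallnear (c : R) : (0 < c)%R -> \forall t \near (0%R : R), (`|t| < c)%R.
    by move=> c0; have := @nbhs0_lt R R c c0; apply: filterS => t /=.
  case bE : (rhop Omega nu x) b0 => [b| |]// b0; case aE : (rhop Omega (- nu)%R x) a0 => [a| |]// a0.
  - have ba : (a != b)%R by apply/eqP => ab; have := hx; rewrite bE aE ab => /(_ erefl).
    have [ab|ab|] := ltgtP a b; last by move=> h; rewrite h eqxx in ba.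
    + exists 1%R, a; split.
      * by rewrite /orient /= aE bE lte_fin ab.
      * by rewrite rhop_rho aE bE /mine lte_fin ltNge (ltW ab).
      near=> t; have ss : seg Omega nu x t by near: t.
      have tc : (`|t| < (b - a) / 2)%R by near: t; apply: smallnear; rewrite divr_gt0// subr_gt0.
      rewrite rhop_rho (rhop_shift oOmega xO ss) (rhopN_shift oOmega xO ss) aE bE -EFinB -EFinD mul1r.
      by apply/min_idPr; rewrite lee_fin; move: tc; rewrite ltr_norml => /andP[_]; lra.
    + exists (-1)%R, b; split.
      * by rewrite /orient /= aE bE !lte_fin ab ltNge (ltW ab).
      * by rewrite rhop_rho aE bE /mine lte_fin ab.
      near=> t; have ss : seg Omega nu x t by near: t.
      have tc : (`|t| < (a - b) / 2)%R by near: t; apply: smallnear; rewrite divr_gt0// subr_gt0.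
      rewrite rhop_rho (rhop_shift oOmega xO ss) (rhopN_shift oOmega xO ss) aE bE -EFinB -EFinD mulN1r.
      by apply/min_idPl; rewrite lee_fin; move: tc; rewrite ltr_norml => /andP[+ _]; lra.
  - exists (-1)%R, b; split.
    * by rewrite /orient /= aE bE ltNge leey /= ltry.
    * by rewrite rhop_rho aE bE /mine ltry.
    near=> t; have ss : seg Omega nu x t by near: t.
    rewrite rhop_rho (rhop_shift oOmega xO ss) (rhopN_shift oOmega xO ss) aE bE mulN1r.
    by apply/min_idPl; exact: leey.
  - exists 1%R, a; split.
    * by rewrite /orient /= aE bE ltry.
    * by rewrite rhop_rho aE bE /mine ltNge leey.
    near=> t; have ss : seg Omega nu x t by near: t.
    rewrite rhop_rho (rhop_shift oOmega xO ss) (rhopN_shift oOmega xO ss) aE bE mul1r.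
    by apply/min_idPr; exact: leey.
  - by exfalso; apply: hfin.
have It := good_in adm gx r0E.
have [phi0 phiC1 _ _] := adm_sol adm.
have f0 := phi0 _ It; have [dphi _] := phiC1 _ It.
have dphi' : is_derive t0 1%R phi (derive1 phi t0) by rewrite derive1E; exact: derivableP.
have dlin : is_derive (0%R : R) 1%R (fun t : R => t0 + s * t)%R s.
  have := is_deriveD (is_derive_cst t0 (0%R : R) 1%R) (is_deriveZ s (is_derive_id (0%R : R) 1%R)).
  by rewrite add0r scaler1.
have dcomp : is_derive (0%R : R) 1%R (phi \o (fun t : R => t0 + s * t))%R (derive1 phi t0 * s)%R.
  by apply: is_derive1_comp; rewrite mulr0 addr0.
have fn0 : ((phi \o (fun t : R => t0 + s * t)) 0 != 0)%R by rewrite /= mulr0 addr0 gt_eqF.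
rewrite (lineD _ _ _ (is_deriveM du (is_deriveV fn0 dcomp))); last first.
  by near=> t; rewrite /w (near rE t) //.
rewrite scale0r addr0 r0E sE /= patchE mem_set// /log_slope mulr0 addr0 /GRing.scale /=.
by field; rewrite gt_eqF.
Unshelve. all: by end_near.
Qed.

(** Each component contains at most one such point, so the set is null on every line, component by
    component. *)
Lemma midpoints_null nu : edot nu nu = 1%R ->
  measurable [set x | Omega x /\ rhop Omega nu x = rhop Omega (- nu)%R x /\ rhop Omega nu x < +oo] /\
  lam [set x | Omega x /\ rhop Omega nu x = rhop Omega (- nu)%R x /\ rhop Omega nu x < +oo] = 0.
Proof.
move=> nu1; set B := [set x | _].
have mr := measurable_rhop1 oOmega nu; have mrN := measurable_rhop1 oOmega (- nu)%R.
have mB : measurable B.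
  pose b x := (rhop Omega nu x == rhop Omega (- nu)%R x) && (rhop Omega nu x < +oo).
  have mb : measurable_fun setT b.
    apply: measurable_and; first exact: measurable_fun_eqe.
    by apply: measurable_fun_lte => //; exact: measurable_cst.
  rewrite (_ : B = Omega `&` (b @^-1` [set true])); last first.
    apply/seteqP; split => x; first by move=> [h1 [h2 h3]]; split => //=; rewrite /b h2 eqxx -h2 h3.
    by move=> [h1 /= /andP[/eqP h2 h3]].
  apply: measurableI; first exact: open_measurable_rV.
  by rewrite -[X in measurable X]setTI; exact: mb.
split => //; pose f x := (\1_B x)%:E : \bar R.
have mf : measurable_fun setT f by apply/measurable_EFinP; exact: measurable_indic.
have f0 x : 0 <= f x by rewrite lee_fin.
transitivity (\int[lam]_x f x); first by rewrite integral_indic// setIT.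
rewrite -(ge0_integral_slab nu1 mf f0).
rewrite (eq_integral (cst 0)) ?integral0// => x _.
transitivity (\int[@lebesgue_measure R]_s (cst 0 (x + s *: nu)%R : \bar R)); last exact: integral0.
apply: (@integral_line_components _ _ Omega oOmega f (cst 0)) => //.
- by move=> y yO; rewrite /f indicE memNset// => -[].
move=> y yO; pose s0 := ((fine (rhop Omega nu y) - fine (rhop Omega (- nu)%R y)) / 2)%R.
apply: (@eq_integral_null_set _ _ _ (@lebesgue_measure R) (seg Omega nu y) [set s0]) => //.
  exact: lebesgue_measure_set1.
move=> s ss /= ns; rewrite /f indicE memNset// => -[_ [h1 h2]]; apply: ns.
rewrite (rhop_shift oOmega yO ss) (rhopN_shift oOmega yO ss) in h1 h2.
rewrite /s0; move: h1 h2; have := rhop_ge0 Omega nu y; have := rhop_ge0 Omega (- nu)%R y.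
case: (rhop Omega nu y) => [b| |]//; case: (rhop Omega (- nu)%R y) => [a| |]//= _ _ [h] _.
lra.
Qed.

Lemma good_nonmid nu x : good (nu, x) ->
  ~ (Omega x /\ rhop Omega nu x = rhop Omega (- nu)%R x /\ rhop Omega nu x < +oo) ->
  V_at V (rho Omega nu x) * (Cp p ('D_nu u x)
    (phi_at phi (rho Omega nu x) * 'D_nu (fun y => u y / phi_at phi (rho Omega nu y)) x))%R%:E =
  dC (nu, x).
Proof.
move=> gx nmid; have xO : Omega x by case: gx.
rewrite (phi_line_derive gx); last first.
  move=> h; apply: contrapT => h2; apply: nmid; split => //; split => //.
  by rewrite ltey; apply/eqP.
by rewrite /dC /= (V_at_good gx) deriveE_dirder//; exact: (test_function_C1 tu).
Qed.

Lemma measurable_bad_slice nu : measurable [set x | bad Omega d (nu, x)].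
Proof.
rewrite -[X in measurable X]setTI; apply: (pair1_measurable nu measurableT (Y := bad Omega d)).
by apply: open_measurable_rVX; apply: open_bad; [exact: oOmega|exact: (adm_d0 adm)].
Qed.

Lemma Cp_termE : Cp_term Omega p V phi u = sphere_int dC.
Proof.
have [N [mN N0 NP]] := bad0.
apply: (eq_integral_null_set mN N0) => nu nuS nuN; rewrite /slice_int integral_mkcond.
have [mB B0] := midpoints_null (unit_sphere_edot nuS); set B := [set x | _ /\ _] in mB B0.
have mbad := measurable_bad_slice nu.
apply: (@eq_integral_null_set _ _ _ lam setT ([set x | bad Omega d (nu, x)] `|` B)) => //.
- exact: measurableU.
- exact: etrans (measureU0 mbad mB B0) (NP nu nuS nuN).
move=> x _ /not_orP[xb xB]; rewrite !patchE; case: ifPn => xO; last first.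
  by rewrite notin_setE in xO; rewrite memNset// => -[].
rewrite inE in xO; have gx : good (nu, x) by split.
by rewrite mem_set// good_nonmid.
Qed.

Section skeletal.
Variable mu : 'rV[R]_n -> {measure set 'rV[R]_n -> \bar R}.
Hypothesis hmu : forall nu, unit_sphere nu -> skeletal_measure Omega nu (mu nu).

(** A bad midpoint makes its whole component bad, because [bad] is saturated along lines; Lebesgue
    nullity therefore passes to the skeletal measure. *)
Lemma skeletal_bad_null nu : unit_sphere nu -> lam [set x | bad Omega d (nu, x)] = 0 ->
  mu nu [set x | bad Omega d (nu, x)] = 0.
Proof.
move=> nuS b0; have mbad := measurable_bad_slice nu.
have mS := hmu nuS; have nu1 := unit_sphere_edot nuS.
transitivity (\int[mu nu]_(m in skeleton Omega nu) (\1_[set x | bad Omega d (nu, x)] m)%:E).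
  by rewrite (skeletal_integral_ext oOmega _ mS) integral_indic// setIT.
rewrite (skeletal_integral oOmega nu1 mS)//.
rewrite (@eq_integral_null_set _ _ _ lam setT _ _ (cst 0) mbad b0) ?integral0// => x _ xb.
rewrite patchE; case: ifPn => //; rewrite inE => xO.
rewrite /mid_density -/(fin_seg _ _ _); case: ifPn => // fx.
by rewrite indicE memNset ?mul0r// => /= /bad_shift.
Qed.

Lemma skeletal_slice (h : R -> R) nu : unit_sphere nu -> lam [set x | bad Omega d (nu, x)] = 0 ->
  {in [set t | in_interval rad t], continuous h} -> (forall t, 0 <= h t)%R ->
  \int[mu nu]_(m in skeleton Omega nu) (skel_fun p rad Omega u h nu m)%:E = slice_int (dS h) nu.
Proof.
move=> nuS b0 ch h0; have nu1 := unit_sphere_edot nuS; have mbad := measurable_bad_slice nu.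
rewrite (skeletal_integral oOmega nu1 (hmu nuS)); last 2 first.
- exact: (measurableT_comp (measurable_skel_fun adm ch) (measurable_pair1 nu)).
- by move=> m; exact: skel_fun_ge0.
apply: (@eq_integral_null_set _ _ _ lam setT _ _ _ mbad b0) => // x _ xb.
rewrite !patchE; case: ifPn => xO.
  by rewrite mem_set//; rewrite inE in xO; split.
by rewrite notin_setE in xO; rewrite memNset// => -[].
Qed.

Lemma skeletal_integrand nu m : good (nu, m) ->
  V_at V (rho Omega nu m) *
     (spow p (dphi_at phi (rho Omega nu m) / phi_at phi (rho Omega nu m)) * `|u m| `^ p)%R%:E =
  (skel_fun p rad Omega u (skel p V phi) nu m)%:E.
Proof.
move=> gx; have r0 : 0 <= rho Omega nu m by rewrite rhop_rho le_min !rhop_ge0.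
rewrite /skel_fun; case rE : (rho Omega nu m) r0 => [t| |]// _ /=.
  have It := good_in adm gx rE.
  by rewrite patchE mem_set// /skel /log_slope -EFinM mulrA.
(* At infinite distance [dphi_at] is 0, and [fine] gives 0, which lies outside the interval: both
   sides vanish even when [V_at] is infinite. *)
rewrite patchE memNset; last by move=> -[]; rewrite ltxx.
by rewrite mul0r /spow normr0 mulr0 !mul0r mule0.
Qed.

Lemma skel_fun_max nu m :
  Num.max (skel_fun p rad Omega u (skel p V phi) nu m) 0%R = skel_fun p rad Omega u skelp nu m /\
  Num.max (- skel_fun p rad Omega u (skel p V phi) nu m)%R 0%R = skel_fun p rad Omega u skeln nu m.
Proof.
have X0 := powR_ge0 `|u m| p.
rewrite /skel_fun !patchE; case: ifPn => _; last by rewrite !mul0r oppr0 maxxx.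
by rewrite /skelp /skeln -mulNr !maxr_pMl// !mul0r.
Qed.

Lemma skeletal_meanE :
  skeletal_mean Omega mu (fun nu m => V_at V (rho Omega nu m) *
     (spow p (dphi_at phi (rho Omega nu m) / phi_at phi (rho Omega nu m)) * `|u m| `^ p)%R%:E) =
  \int[sig]_(nu in unit_sphere) (slice_int (dS skelp) nu - slice_int (dS skeln) nu).
Proof.
have [N [mN N0 NP]] := bad0.
apply: (eq_integral_null_set mN N0) => nu nuS nuN; have b0 := NP nu nuS nuN.
have mbad := measurable_bad_slice nu; have mub := skeletal_bad_null nuS b0.
transitivity (\int[mu nu]_(m in skeleton Omega nu) (skel_fun p rad Omega u (skel p V phi) nu m)%:E).
  apply: (eq_integral_null_set mbad mub) => m [_ mO] mb; apply: skeletal_integrand.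
  by split.
rewrite integralE -!skeletal_slice//.
- by congr (_ - _); apply: eq_integral => m _; rewrite ?funeposE ?funenegE -?EFinN -EFin_max;
    have [e1 e2] := skel_fun_max nu m; rewrite ?e1 ?e2.
- exact: continuous_skeln adm.
- exact: skeln_ge0.
- exact: continuous_skelp adm.
- exact: skelp_ge0.
Qed.

End skeletal.

Local Notation leb := (@lebesgue_measure R).
Local Notation I := (in_interval rad).

(** Tonelli and translation invariance. It converts a bound on short line integrals, uniform in the
    base point, into a bound on the integral over the whole space. *)
Lemma integral_average (F : 'rV[R]_n -> \bar R) (nu : 'rV[R]_n) (del : R) : measurable_fun setT F ->
  (forall x, 0 <= F x) -> (0 < del)%R ->
  measurable_fun setT (fun x : 'rV[R]_n => \int[leb]_(t in `[0%R, del]) F (x + t *: nu)%R) /\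
  del%:E * \int[lam]_x F x = \int[lam]_x \int[leb]_(t in `[0%R, del]) F (x + t *: nu)%R.
Proof.
move=> mF F0 d0.
have mI : measurable (`[0%R, del]%classic : set (measurableTypeR R)) by exact: measurable_itv.
pose K (z : 'rV[R]_n * measurableTypeR R) := (\1_(`[0%R, del]%classic : set R) z.2)%:E * F (z.1 + z.2 *: nu)%R.
have mK : measurable_fun setT K.
  apply: emeasurable_funM; first exact: (measurable_indic_comp (f := snd) mI).
  apply: (measurableT_comp mF).
  by apply: (@measurable_fun_line _ _ _ _ fst (cst nu) snd) => //; exact: measurable_cst.
have K0 z : 0 <= K z by rewrite mule_ge0// lee_fin.
have EK x : \int[leb]_t K (x, t) = \int[leb]_(t in `[0%R, del]) F (x + t *: nu)%R.
  rewrite [RHS]integral_mkcond; apply: eq_integral => t _.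
  by rewrite /K patchE indicE /=; case: ifPn => _; rewrite ?mul1e ?mul0e.
rewrite -(_ : (fun x => \int[leb]_t K (x, t)) = fun x => \int[leb]_(t in `[0%R, del]) F (x + t *: nu)%R); last exact/funext.
split; first exact: (@measurable_fun_fubini_tonelli_F _ _ _ _ R leb K mK K0).
rewrite (fubini_tonelli (m1 := lam) (m2 := leb) K)//.
transitivity (\int[leb]_(t in `[0%R, del]) (\int[lam]_x F x)).
  by rewrite integral_cst//= lebesgue_measure_itv/= lte_fin d0 sube0 muleC.
rewrite integral_mkcond; apply: eq_integral => t _; rewrite patchE.
case: ifPn => tI.
  rewrite -(ge0_integral_rV_translation (t *: nu)%R mF F0).
  by apply: eq_integral => x _; rewrite /K indicE /= tI mul1e.
by rewrite (eq_integral (cst 0)) ?integral0// => x _; rewrite /K indicE /= (negbTE tI) mul0e.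
Qed.

Lemma slice_bound (F : T2 -> \bar R) (B : R) : measurable_fun setT F -> (forall z, 0 <= F z) ->
  (forall nu, unit_sphere nu -> slice_int F nu <= B%:E) -> sphere_int F < +oo.
Proof.
move=> mF F0 FB; have mS := @measurable_unit_sphere R n.
apply: (@le_lt_trans _ _ (\int[sig]_(nu in unit_sphere) B%:E)).
  apply: ge0_le_integral => //.
  - by move=> nu _; exact: slice_int_ge0.
  - by apply: measurable_funTS; exact: (measurable_slice_int adm).
rewrite integral_cst// ltey_eq fin_numM//.
exact: sphere_measure_fin.
Qed.

Definition cube (k : nat) : set 'rV[R]_n := [set v | forall i, (`|v ord0 i| <= k%:R)%R].

Lemma cube_integral (B : R) k : (0 <= B)%R ->
  \int[lam]_x (B * \1_(cube k) x)%:E = B%:E * lam (cube k) /\ lam (cube k) \is a fin_num.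
Proof.
move=> B0; have mQ : measurable (cube k) by exact: measurable_cube.
split; last by rewrite ge0_fin_numE//; exact: lebesgue_rV_bounded.
under eq_integral do rewrite EFinM.
by rewrite ge0_integralZl//; [rewrite integral_indic// setIT|apply/measurable_EFinP; exact: measurable_indic].
Qed.

Lemma supp_cube nu (x y : 'rV[R]_n) (r : R) k : edot nu nu = 1%R -> (forall x, supp u x -> forall i, (`|x ord0 i| <= k%:R)%R) ->
  supp u (x + r *: nu)%R -> forall q, (`|r| <= q)%R -> cube (k + (Num.trunc q).+1) x.
Proof.
move=> nu1 kP xK q rq i; have := kP _ xK i; rewrite !mxE => h.
rewrite -[x ord0 i](addrK (r * nu ord0 i)%R) natrD (le_trans (ler_normB _ _))// lerD//.
rewrite normrM (@le_trans _ _ (`|r| * 1)%R)//; first by rewrite ler_wpM2l// edot1_coord.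
by rewrite mulr1 (le_trans rq)// ltW// truncnS_gt.
Qed.

Lemma measurable_potential_line nu x :
  measurable_fun [set: R] (fun s : R => ext rad W 0 (rho Omega nu (x + s *: nu)%R)).
Proof.
have mE : measurable_fun setT (fun z : T2 => ext rad W 0 (rho Omega z.1 z.2)).
  by apply: (measurable_ext adm); exact: continuous_W adm.
exact: (measurableT_comp (measurableT_comp mE (measurable_pair1 nu)) (measurable_line nu x)).
Qed.

Lemma potential_ext_ge0 nu x : 0 <= ext rad W 0 (rho Omega nu x).
Proof. by apply: ext_ge0 => // t /(adm_pos adm) [_ /ltW]. Qed.

(** * Finite potential energy for increasing solutions *)

Section increasing.
Hypothesis incr : forall r s, I r -> I s -> (r <= s)%R -> (phi r <= phi s)%R.
Let sk c := skel p V phi c.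

Lemma potential_segment_bound nu x (a b r0 e c : R) : good (nu, x) -> (`|e| = 1)%R -> (a <= b)%R -> I c ->
  (forall s, (a <= s <= b)%R -> [/\ seg Omega nu x s, rho Omega nu (x + s *: nu)%R = (r0 + e * s)%R%:E &
     (c <= r0 + e * s)%R]) ->
  \int[leb]_(s in `[a, b]) ext rad W 0 (rho Omega nu (x + s *: nu)%R) <= (sk c)%:E.
Proof.
move=> gx e1 + Ic H; have xO : Omega x by case: gx.
have sk0 := increasing_skel_ge0 (adm_pos adm) (adm_sol adm) incr Ic.
rewrite le_eqVlt => /orP[/eqP ->|ab]; first by rewrite set_itv1 integral_set1 lee_fin.
have Is s : (a <= s <= b)%R -> I (r0 + e * s)%R.
  move=> /H[ss rE _]; apply: (good_in adm _ rE).
  exact/(good_shift d xO ss).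
apply: (@le_trans _ _ (\int[leb]_(s in `[a, b]) (W (r0 + e * s))%:E)).
  rewrite le_eqVlt; apply/orP; left; apply/eqP; apply: eq_integral => s.
  rewrite inE/= in_itv/= => sab; have [_ -> _] := H s sab.
  by rewrite ext_in//; exact: Is.
apply: (potential_line_bound p1 (adm_pos adm) (adm_V adm) (adm_W adm) (adm_sol adm) incr e1 ab Ic).
by move=> s sab; have [_ _ h] := H s sab; split => //; exact: Is.
Qed.

(** On the window both one-sided distances stay at least [c], and [rho] is their minimum, hence
    affine on at most two pieces separated by [(b - a) / 2]. Each piece costs at most [skel c]. *)
Lemma potential_window_bound nu x (c : R) : good (nu, x) -> (0 < c)%R ->
  (c%:E <= rhop Omega (- nu)%R x) -> ((c + c)%R%:E <= rhop Omega nu x) ->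
  rho Omega nu x < +oo ->
  \int[leb]_(s in `[0%R, c]) ext rad W 0 (rho Omega nu (x + s *: nu)%R) <= (sk c + sk c)%:E.
Proof.
move=> gx c0 ca cb roo; have xO : Omega x by case: gx.
have Ic : I c.
  split => //; have r0 : c%:E <= rho Omega nu x.
    by rewrite rhop_rho le_min ca andbT (le_trans _ cb)// lee_fin lerDl ltW.
  move: r0 roo; case rE : (rho Omega nu x) => [r| |]// cr _.
  by have [_] := good_in adm gx rE; apply: le_lt_trans.
have sk0 := increasing_skel_ge0 (adm_pos adm) (adm_sol adm) incr Ic.
have ss s : (0 <= s <= c)%R -> seg Omega nu x s.
  move=> /andP[s0 s1]; split; first by apply: lt_le_trans cb; rewrite lte_fin; lra.
  by apply: lt_le_trans ca; rewrite lte_fin; lra.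
have rs s : (0 <= s <= c)%R -> rho Omega nu (x + s *: nu)%R =
    mine (rhop Omega nu x - s%:E) (rhop Omega (- nu)%R x + s%:E).
  by move=> /ss h; rewrite rhop_rho (rhop_shift oOmega xO h) (rhopN_shift oOmega xO h).
have one (a b : R) : (0 <= a)%R -> (a <= b)%R -> (b <= c)%R -> forall r0 e, (`|e| = 1)%R ->
   (forall s, (a <= s <= b)%R -> mine (rhop Omega nu x - s%:E) (rhop Omega (- nu)%R x + s%:E) = (r0 + e * s)%R%:E) ->
   \int[leb]_(s in `[a, b]) ext rad W 0 (rho Omega nu (x + s *: nu)%R) <= (sk c)%:E.
  move=> a0 ab bc r0 e e1 H; apply: (potential_segment_bound gx e1 ab Ic (r0 := r0)) => s sab.
  have s0c : (0 <= s <= c)%R by move/andP: sab => [h1 h2]; apply/andP; split; lra.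
  split; [exact: ss|by rewrite rs// H|].
  rewrite -lee_fin -H// le_min; apply/andP; split.
    rewrite leeBrDr// (le_trans _ cb)// -EFinD lee_fin lerD2l.
    by case/andP: s0c.
  by rewrite -[leLHS]adde0 leeD// lee_fin; case/andP: s0c.
have wk (v : \bar R) : v <= (sk c)%:E -> v <= (sk c + sk c)%:E.
  by move=> h; apply: le_trans h _; rewrite lee_fin lerDl.
have lee c' : (0 <= c)%R by rewrite ltW.
case aE : (rhop Omega (- nu)%R x) ca => [a| |]// ca; case bE : (rhop Omega nu x) cb => [b| |]// cb.
- have [m0|m0] := leP ((b - a) / 2)%R 0%R.
    apply: wk; apply: (one 0%R c _ _ _ b (-1)%R) => //; first exact: ltW.
      by rewrite normrN normr1.
    by move=> s /andP[s0 _]; rewrite aE bE mulN1r -EFinB -EFinD; apply/min_idPl; rewrite lee_fin; lra.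
  have [mc|mc] := leP c ((b - a) / 2)%R.
    apply: wk; apply: (one 0%R c _ _ _ a 1%R) => //; first exact: ltW.
      by rewrite normr1.
    by move=> s /andP[_ s1]; rewrite aE bE mul1r -EFinB -EFinD; apply/min_idPr; rewrite lee_fin; lra.
  set m := ((b - a) / 2)%R in m0 mc.
  have mf := measurable_potential_line nu x.
  have f0 s : 0 <= ext rad W 0 (rho Omega nu (x + s *: nu)%R) by exact: potential_ext_ge0.
  have -> : `[0%R, c]%classic = `[0%R, m]%classic `|` `]m, c]%classic.
    apply/seteqP; split => s /=; rewrite !in_itv/=.
      by move=> /andP[h1 h2]; have [h|h] := leP s m; [left; rewrite h1|right].
    by move=> [/andP[h1 h2]|/andP[h1 h2]]; apply/andP; split => //; lra.
  rewrite ge0_integral_setU//; last 2 first.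
  - exact: measurable_funTS.
  - rewrite disj_set2E; apply/eqP/seteqP; split => // s [] /=; rewrite !in_itv/= => /andP[_ h1] /andP[h2 _]; lra.
  rewrite EFinD; apply: leeD.
    apply: (one 0%R m _ _ _ a 1%R) => //; [exact: ltW|exact: ltW|by rewrite normr1|].
    by move=> s /andP[_ s1]; rewrite aE bE mul1r -EFinB -EFinD; apply/min_idPr; rewrite lee_fin; move: s1; rewrite /m; lra.
  apply: (@le_trans _ _ (\int[leb]_(s in `[m, c]) ext rad W 0 (rho Omega nu (x + s *: nu)%R))).
    apply: ge0_subset_integral => //; first exact: measurable_funTS.
    by move=> s /=; rewrite !in_itv/= => /andP[h1 ->]; rewrite ltW.
  apply: (one m c _ _ _ b (-1)%R) => //; [exact: ltW|exact: ltW|by rewrite normrN normr1|].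
  by move=> s /andP[s1 _]; rewrite aE bE mulN1r -EFinB -EFinD; apply/min_idPl; rewrite lee_fin; move: s1; rewrite /m; lra.
- apply: wk; apply: (one 0%R c _ _ _ a 1%R) => //; [exact: ltW|by rewrite normr1|].
  by move=> s _; rewrite aE bE mul1r; apply/min_idPr; exact: leey.
- apply: wk; apply: (one 0%R c _ _ _ b (-1)%R) => //; [exact: ltW|by rewrite normrN normr1|].
  by move=> s _; rewrite aE bE mulN1r; apply/min_idPl; exact: leey.
- by move: roo; rewrite rhop_rho aE bE minxx.
Qed.

(* The integral of the potential over windows of fixed length [c] is bounded
   uniformly; averaging over windows then bounds the integral over each slice. *)
Lemma potential_finite : sphere_int dP < +oo.
Proof.
have [c0 c00 cP] := supp_rhop_gap adm; have [k kP] := supp_bounded tu.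
have [M M0 MP] := test_function_bounded tu.
(* Half the gap: if a window of length [c] meets the support, its starting point has distance at
   least [c0 - c = c] behind and [c0 = c + c] ahead, as [potential_window_bound] asks. *)
pose c := (c0 / 2)%R; have cpos : (0 < c)%R by rewrite divr_gt0.
pose Q := cube (k + (Num.trunc c).+1).
pose A := (M `^ p * (Num.max (sk c) 0 + Num.max (sk c) 0))%R.
have A0 : (0 <= A)%R by rewrite mulr_ge0 ?powR_ge0// addr_ge0// le_max lexx orbT.
have [QE Qfin] := cube_integral (k + (Num.trunc c).+1) A0.
have mP := measurable_dP adm; have P0 := dP_ge0 adm.
apply: (@slice_bound _ (c^-1 * (A * fine (lam Q)))%R) => // nu nuS.
have nu1 := unit_sphere_edot nuS.
have nu1' : edot (- nu) (- nu) = 1%R by rewrite edotNN.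
pose F x := (dP \_ good) (nu, x).
have mF : measurable_fun setT F by apply: measurable_slice; apply: (measurable_mask adm).
have F0 x : 0 <= F x by exact: mask_ge0.
have [mJ JE] := integral_average nu mF F0 cpos.
rewrite /slice_int -/F EFinM lee_pdivlMl// JE EFinM fineK// -QE.
have mQ : measurable Q by exact: measurable_cube.
apply: ge0_le_integral => //.
- by move=> x _; apply: integral_ge0 => t _.
- by apply/measurable_EFinP; apply: measurable_funM; [exact: measurable_cst|exact: measurable_indic].
move=> x _.
(* Either the window contains a good point of the support at finite distance, or the masked density
   is 0 on all of it. *)
have [[t0 [t0c gy yoo yK]]|none] := pselect (exists t0, [/\ (0 <= t0 <= c)%R, good (nu, x + t0 *: nu)%R,
    rho Omega nu (x + t0 *: nu)%R < +oo & supp u (x + t0 *: nu)%R]); last first.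
  have R0 : 0 <= (A * \1_(cube (k + (Num.trunc c).+1)) x)%:E by rewrite lee_fin; exact: mulr_ge0.
  rewrite (eq_integral (cst 0)) ?integral0// => t; rewrite inE/= in_itv/= => tc.
  rewrite /F patchE; case: ifPn => //; rewrite inE => gy; rewrite /dP /=.
  have [uK|uK] := pselect (supp u (x + t *: nu)%R); last first.
    by rewrite (notin_supp0 uK) normr0 powR0// mule0.
  have [|roo] := boolP (rho Omega nu (x + t *: nu)%R < +oo); first by move=> roo; exfalso; apply: none; exists t.
  by move: roo; rewrite -leNgt leye_eq /ext => /eqP ->; rewrite eqxx; case: ifP => _; rewrite mul0e.
have /andP[t00 t01] := t0c.
have yO : Omega (x + t0 *: nu)%R by case: gy.
have ca := cP nu _ nu1 yK; have cb := cP (- nu)%R _ nu1' yK.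
have sy : seg Omega nu (x + t0 *: nu)%R (- t0)%R.
  split; first by apply: lt_le_trans ca; rewrite lte_fin; lra.
  by rewrite opprK; apply: lt_le_trans cb; rewrite lte_fin; move: t01; rewrite /c; lra.
have xE : (x + t0 *: nu + (- t0) *: nu = x)%R by rewrite scaleNr addrK.
have gx : good (nu, x) by have := (good_shift d yO sy).2 gy; rewrite xE.
have xa : rhop Omega nu x = rhop Omega nu (x + t0 *: nu)%R + t0%:E.
  by rewrite -[in LHS]xE (rhop_shift oOmega yO sy) EFinN oppeK.
have xb : rhop Omega (- nu)%R x = rhop Omega (- nu)%R (x + t0 *: nu)%R - t0%:E.
  by rewrite -[in LHS]xE (rhopN_shift oOmega yO sy) EFinN.
have xQ : Q x by apply: (supp_cube x nu1 kP yK); rewrite ger0_norm.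
have roo : rho Omega nu x < +oo.
  move: yoo; rewrite !rhop_rho xa xb !gt_min -EFinN => /orP[h|h]; apply/orP; [left|right];
    exact: lte_add_pinfty h (ltry _).
apply: (@le_trans _ _ ((M `^ p)%:E * \int[leb]_(t in `[0%R, c]) ext rad W 0 (rho Omega nu (x + t *: nu)%R))).
  have e0 y : 0 <= ext rad W 0 (rho Omega nu y) by exact: potential_ext_ge0.
  have me := measurable_potential_line nu x.
  rewrite -ge0_integralZl//; last 2 first.
  - exact: measurable_funTS.
  - by rewrite lee_fin powR_ge0.
  apply: ge0_le_integral => //.
  - by apply: measurable_funTS; apply: (measurableT_comp mF); exact: measurable_line.
  - by apply: measurable_funTS; apply: emeasurable_funM => //; exact: measurable_cst.
  move=> t _; rewrite /F patchE; case: ifPn => _; last by rewrite mule_ge0// lee_fin powR_ge0.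
  rewrite /dP /= muleC lee_wpmul2r// lee_fin.
  by apply: ge0_ler_powR; rewrite ?nnegrE//; apply: ltW; exact: lt_trans p1.
rewrite indicE mem_set// mulr1 /A EFinM lee_wpmul2l ?lee_fin ?powR_ge0//.
apply: le_trans (potential_window_bound gx cpos _ _ roo) _.
- by rewrite xb leeBrDr// (le_trans _ cb)// -EFinD lee_fin; move: t01; rewrite /c; lra.
- by rewrite xa (le_trans _ (leeD ca (_ : 0 <= t0%:E)))// adde0 lee_fin /c; lra.
by rewrite lee_fin lerD// le_max lexx.
Qed.

End increasing.

(** * Bounded positive skeletal part for solutions that are not increasing *)

Section not_increasing.
Hypothesis nincr : ~ (forall r s, I r -> I s -> (r <= s)%R -> (phi r <= phi s)%R).

(** Beyond a point [xi] of negative flux [skel] is nonpositive, and between [c] and [xi] continuity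
    on a compact interval gives a bound; [c] keeps away from a possible singularity at 0. *)
Lemma skelp_bounded (c : R) : (0 < c)%R -> exists xi H : R, [/\ (0 < xi)%R, (0 <= H)%R,
  forall r, I r -> (xi <= r)%R -> skelp r = 0%R & forall r, I r -> (c <= r <= xi)%R -> (skelp r <= H)%R].
Proof.
move=> c0.
have [xi Ixi fxi] := not_increasing_flux (adm_pos adm) (adm_sol adm) nincr.
have xi0 : (0 < xi)%R by case: Ixi.
have z r : I r -> (xi <= r)%R -> skelp r = 0%R.
  move=> Ir xr; rewrite /skelp max_r//.
  exact: (skel_le0 p1 (adm_pos adm) (adm_sol adm) Ixi Ir fxi xr).
have [cxi|xic] := leP c xi; last first.
  exists xi, 0%R; split => // r _ /andP[h1 h2]; lra.
have Icx r : (c <= r <= xi)%R -> I r.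
  move=> /andP[h1 h2]; split; first exact: lt_le_trans h1.
  by case: Ixi => _; apply: le_lt_trans; rewrite lee_fin.
have [|m mI mP] := @EVT_max R skelp c xi cxi.
  apply: continuous_in_subspaceT => r; rewrite inE/= in_itv/= => /Icx Ir.
  by apply: (continuous_skelp adm); rewrite inE.
exists xi, (skelp m); split => //; first exact: skelp_ge0.
by move=> r Ir rc; apply: mP; rewrite in_itv.
Qed.

(** The density can be nonzero only if the midpoint lies in the support and the half-length is
    between [c0] and [xi]. It is then at most [H M^p / (2 c0)], and the point is within [xi] of the
    support, hence in a fixed cube. *)
Lemma skelp_slice_bound : exists B : R, forall nu, unit_sphere nu -> slice_int (dS skelp) nu <= B%:E.
Proof.
have [c0 c00 cP] := supp_rhop_gap adm; have [k kP] := supp_bounded tu.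
have [M M0 MP] := test_function_bounded tu.
have [xi [H [xi0 H0 Hz HP]]] := skelp_bounded c00.
pose A := (H * M `^ p / (c0 + c0))%R.
have A0 : (0 <= A)%R by rewrite divr_ge0 ?mulr_ge0 ?powR_ge0// addr_ge0// ltW.
pose Q := cube (k + (Num.trunc xi).+1).
have [QE Qfin] := cube_integral (k + (Num.trunc xi).+1) A0.
exists (A * fine (lam Q))%R => nu nuS; have nu1 := unit_sphere_edot nuS.
rewrite EFinM fineK// -QE.
have mQ : measurable Q by exact: measurable_cube.
apply: ge0_le_integral => //.
- by move=> x _; apply: mask_ge0; exact: dSp_ge0.
- by apply: measurable_slice; apply: (measurable_mask adm); exact: measurable_dSp adm.
- by apply/measurable_EFinP; apply: measurable_funM; [exact: measurable_cst|exact: measurable_indic].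
move=> x _; have R0 : 0 <= (A * \1_Q x)%:E by rewrite lee_fin; exact: mulr_ge0.
rewrite patchE; case: ifPn => //; rewrite inE => gx; have xO : Omega x by case: gx.
rewrite /dS /mid_density /= -/(fin_seg _ _ _); case: ifPn => // fx.
have sm := seg_mid_in oOmega xO fx.
set m := seg_mid Omega nu x; have mE : m = (x + ((fine (rhop Omega nu x) - fine (rhop Omega (- nu) x)) / 2) *: nu)%R by [].
have [a [b [aE bE a0 b0]]] := fin_segP fx.
have gm : good (nu, m) by rewrite mE; exact/(good_shift d xO sm).
have rm : rho Omega nu m = ((a + b) / 2)%R%:E.
  rewrite mE rhop_rho (rhop_shift oOmega xO sm) (rhopN_shift oOmega xO sm) aE bE /= -EFinB -EFinD.
  have -> : (b - (b - a) / 2 = (a + b) / 2)%R by lra.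
  have -> : (a + (b - a) / 2 = (a + b) / 2)%R by lra.
  by rewrite minxx.
have Im := good_in adm gm rm.
rewrite /skel_fun rm /= patchE mem_set//.
have LE : seg_len Omega nu x = (a + b)%R by rewrite /seg_len aE bE /= addrC.
rewrite LE.
have [mK|mK] := pselect (supp u m); last by rewrite (notin_supp0 mK) normr0 powR0// mulr0 mul0r.
have [xim|mxi] := leP xi ((a + b) / 2)%R; first by rewrite Hz// !mul0r.
have cm : (c0 <= (a + b) / 2)%R.
  rewrite -lee_fin -rm rhop_rho le_min; apply/andP; split; apply: cP => //.
  by rewrite edotNN.
have xQ : Q x.
  apply: (supp_cube x nu1 kP (r := ((fine (rhop Omega nu x) - fine (rhop Omega (- nu) x)) / 2)%R)) => //.
  by rewrite aE bE /= ler_norml; apply/andP; split; lra.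
rewrite indicE mem_set// mulr1 lee_fin /A.
apply: ler_pM.
- by rewrite mulr_ge0 ?powR_ge0 ?skelp_ge0.
- by rewrite invr_ge0; lra.
- apply: ler_pM; [exact: skelp_ge0|exact: powR_ge0| |].
    by apply: HP => //; rewrite cm ltW.
  by apply: ge0_ler_powR; rewrite ?nnegrE//; apply: ltW; exact: lt_trans p1.
- by rewrite lef_pV2 ?posrE; lra.
Qed.

End not_increasing.

(** * Energies on lines contained in the domain *)

Lemma integral_pinfty_norm (v : R -> R) t0 : continuous v -> v t0 != 0%R ->
  \int[leb]_t (+oo * (`|v t| `^ p)%:E) = +oo.
Proof.
move=> cv v0.
have /nbhs_ballP[e /= e0 eP] : nbhs t0 [set t | v t != 0%R].
  apply: open_nbhs_nbhs; split => //.
  rewrite (_ : [set t | _] = v @^-1` [set y | y != 0%R])//.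
  by apply: open_comp => [t _|]; [exact: cv|exact: open_neq].
have mf : measurable_fun [set: R] (fun t : R => +oo * (`|v t| `^ p)%:E).
  apply: emeasurable_funM; first exact: measurable_cst.
  by apply/measurable_EFinP; apply: measurable_fun_norm_powR; exact: continuous_measurable_fun.
apply/eqP; rewrite -leye_eq.
apply: (@le_trans _ _ (\int[leb]_(t in ball t0 e) (+oo * (`|v t| `^ p)%:E))); last first.
  apply: ge0_subset_integral => //; first exact: measurable_ball.
rewrite (eq_integral (cst +oo)); last first.
  by move=> t; rewrite inE => /eP /= vt; rewrite gt0_mulye// lte_fin powR_gt0// normr_gt0.
rewrite integral_cst; last exact: measurable_ball.
have LE : leb (ball t0 e) = (e *+ 2)%:E by rewrite lebesgue_measure_ball// ltW.
rewrite [X in _ * X](_ : _ = (e *+ 2)%:E); last exact: LE.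
by rewrite gt0_mulye// lte_fin pmulrn_lgt0.
Qed.

Lemma rho_pinfty nu x : rho Omega nu x = +oo -> rhop Omega nu x = +oo /\ rhop Omega (- nu)%R x = +oo.
Proof.
move=> h; have : +oo <= rho Omega nu x by rewrite h.
by rewrite rhop_rho le_min !leye_eq => /andP[/eqP -> /eqP ->].
Qed.

(** Full lines with an infinite coefficient: for [g] equal to [u] this dominates [dF], and for the
    directional derivative it is below [dG] and [dC] on good pairs when the upper limit of [V] is
    infinite. *)
Definition full_density (g : T2 -> R) (z : T2) : \bar R :=
  ext rad (cst 0%R) +oo (rho Omega z.1 z.2) * (`|g z| `^ p)%:E.

Lemma measurable_full_density g : measurable_fun setT g -> measurable_fun setT (full_density g).
Proof.
move=> mg; apply: emeasurable_funM.
  by apply: (measurable_ext adm) => t _; exact: cst_continuous.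
by apply/measurable_EFinP; exact: measurable_fun_norm_powR.
Qed.

Lemma full_density_ge0 g z : 0 <= full_density g z.
Proof. by rewrite mule_ge0 ?lee_fin ?powR_ge0//; apply: ext_ge0 => [t //|_]; exact: leey. Qed.

Lemma full_densityE g z : rad = +oo ->
  full_density g z = if rho Omega z.1 z.2 == +oo then +oo * (`|g z| `^ p)%:E else 0.
Proof.
move=> radoo; rewrite /full_density /ext radoo eqxx; case: ifPn => // _.
by rewrite patchE; case: ifP => _; rewrite mul0e.
Qed.

(* [full_density g] only takes the values [0] and [+oo], so its integral is
   invariant under doubling. *)
Lemma sphere_int_full_density g : measurable_fun setT g -> rad = +oo ->
  sphere_int (full_density g) = 0 \/ sphere_int (full_density g) = +oo.
Proof.
move=> mg radoo; set F := full_density g.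
have mF : measurable_fun setT F by exact: measurable_full_density.
have F0 z : 0 <= F z by exact: full_density_ge0.
have E2 : sphere_int F = 2%:E * sphere_int F.
  rewrite {2}/sphere_int -ge0_integralZl//; last 3 first.
  - exact: measurable_unit_sphere.
  - by apply: measurable_funTS; exact: (measurable_slice_int adm).
  - by move=> x _; exact: slice_int_ge0.
  apply: eq_integral => nu _; rewrite {2}/slice_int -ge0_integralZl//; last 2 first.
  - by apply: measurable_slice; apply: (measurable_mask adm).
  - by move=> x _; exact: mask_ge0.
  apply: eq_integral => x _; rewrite patchE; case: ifP => _; last by rewrite mule0.
  rewrite /F full_densityE//; case: ifP => _; last by rewrite mule0.
  by rewrite muleA gt0_muley.
have J0 : 0 <= sphere_int F by exact: sphere_int_ge0.
case: (sphere_int F) E2 J0 => [r| |]// E2 _; last by right.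
by left; congr _%:E; move: E2 => [] /eqP; lra.
Qed.

(** On a full line [u] has compact support, so it vanishes identically exactly when its derivative
    does. In that case both line integrals are 0; otherwise continuity and the coefficient [+oo]
    make both infinite. *)
Lemma full_line_densities nu : rad = +oo -> edot nu nu = 1%R ->
  slice_int (full_density (fun z => u z.2)) nu = slice_int (full_density (fun z => dirder u z.1 z.2)) nu.
Proof.
move=> radoo nu1; set A := full_density _; set B := full_density _.
have mA : measurable_fun setT A by apply: measurable_full_density; exact: (measurable_test2 adm).
have mB : measurable_fun setT B by apply: measurable_full_density; exact: (measurable_dirder adm).
have A0 z : 0 <= A z by exact: full_density_ge0.
have B0 z : 0 <= B z by exact: full_density_ge0.
have slab_int (F : T2 -> \bar R) : measurable_fun setT F -> (forall z, 0 <= F z) ->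
   slice_int F nu = \int[lam]_(x in slab nu) \int[leb]_t (F \_ good) (nu, x + t *: nu)%R.
  move=> mF F0; apply/esym.
  apply: (@ge0_integral_slab _ _ nu nu1 (fun x => (F \_ good) (nu, x))).
    by apply: measurable_slice; apply: (measurable_mask adm).
  by move=> x; exact: mask_ge0.
apply: (etrans (slab_int A mA A0)); apply/esym.
apply: (etrans (slab_int B mB B0)); apply/esym.
apply: eq_integral => x _.
apply: (@integral_line_components _ _ Omega oOmega (fun x => (A \_ good) (nu, x)) (fun x => (B \_ good) (nu, x))).
- by apply: measurable_slice; apply: (measurable_mask adm).
- by apply: measurable_slice; apply: (measurable_mask adm).
- by move=> y; exact: mask_ge0.
- by move=> y; exact: mask_ge0.
- by move=> y yO; rewrite patchE memNset// => -[].
- by move=> y yO; rewrite patchE memNset// => -[].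
move=> y yO.
have z0 (F : T2 -> \bar R) : (forall s, seg Omega nu y s -> (F \_ good) (nu, y + s *: nu)%R = 0) ->
    \int[leb]_(s in seg Omega nu y) (F \_ good) (nu, y + s *: nu)%R = 0.
  move=> F0; transitivity (\int[leb]_(s in seg Omega nu y) (cst 0 s : \bar R)); last exact: integral0.
  by apply: eq_integral => s; rewrite inE; exact: F0.
have [gy|gy] := pselect (good (nu, y)); last first.
  have ng (F : T2 -> \bar R) s : seg Omega nu y s -> (F \_ good) (nu, y + s *: nu)%R = 0.
    by move=> ss; rewrite patchE memNset// => /(good_shift d yO ss).
  exact: etrans (z0 A (ng A)) (esym (z0 B (ng B))).
have [[aE bE]|hfin] := pselect (rhop Omega (- nu)%R y = +oo /\ rhop Omega nu y = +oo); last first.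
  have nf g s : seg Omega nu y s -> (full_density g \_ good) (nu, y + s *: nu)%R = 0.
    move=> ss; rewrite patchE; case: ifP => // _; rewrite full_densityE//= ifF//.
    apply/eqP => /rho_pinfty[]; rewrite (rhop_shift oOmega yO ss) (rhopN_shift oOmega yO ss) => h1 h2.
    apply: hfin; split; [move: h2|move: h1]; by case: (rhop _ _ _).
  exact: etrans (z0 A (nf _)) (esym (z0 B (nf _))).
have segT : seg Omega nu y = setT.
  by apply/seteqP; split => s // _; rewrite /seg /= aE bE !ltry.
have val g (s : R) : (full_density g \_ good) (nu, y + s *: nu)%R = +oo * (`|g (nu, y + s *: nu)%R| `^ p)%:E.
  have ss : seg Omega nu y s by rewrite segT.
  rewrite patchE mem_set; last exact/(good_shift d yO ss).
  by rewrite full_densityE//= rhop_rho (rhop_shift oOmega yO ss) (rhopN_shift oOmega yO ss) aE bE minxx eqxx.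
rewrite segT.
transitivity (\int[leb]_s (+oo * (`|u (y + s *: nu)%R| `^ p)%:E)); first by apply: eq_integral => s _; exact: val.
transitivity (\int[leb]_s (+oo * (`|dirder u nu (y + s *: nu)%R| `^ p)%:E)); last by apply: eq_integral => s _; rewrite val.
have C1u := test_function_C1 tu.
have [bd bd0 bdP] := line_supp_bounded adm y nu1.
have dv := is_derive_dirder C1u y nu.
have cv : continuous (fun s : R => u (y + s *: nu)%R).
  move=> s; apply: (@continuous_comp _ _ _ (fun s : R => y + s *: nu)%R u); first exact: line_continuous.
  exact: (test_function_continuous tu).
have [[t0 vt0]|v0] := pselect (exists t, u (y + t *: nu)%R != 0%R).
  rewrite (integral_pinfty_norm cv vt0).
  have [[t1 vt1]|dv0] := pselect (exists t, dirder u nu (y + t *: nu)%R != 0%R).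
    have cdv : continuous (fun s : R => dirder u nu (y + s *: nu)%R) by exact: continuous_dirder_line.
    by rewrite (integral_pinfty_norm cdv vt1).
  exfalso; move/eqP: vt0; apply.
  have dv00 (t : R) : is_derive t (1%R : R) (fun s : R => u (y + s *: nu)%R) 0%R.
    have := dv t; suff -> : dirder u nu (y + t *: nu)%R = 0%R by [].
    by apply/eqP; apply: contrapT => h; apply: dv0; exists t; exact/negP.
  have /= -> := @is_derive_0_is_cst _ (fun s : R => u (y + s *: nu)%R) t0 (bd + 1)%R dv00.
  apply: notin_supp0 => /bdP; rewrite ger0_norm; lra.
have v00 s : u (y + s *: nu)%R = 0%R by apply/eqP; apply: contrapT => h; apply: v0; exists s; exact/negP.
apply: eq_integral => s _; rewrite v00; suff -> : dirder u nu (y + s *: nu)%R = 0%R by [].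
have [_ <-] := dv s.
by rewrite (_ : (fun s : R => u (y + s *: nu)%R) = cst 0%R) ?derive_cst//; exact/funext.
Qed.

(** [dF] is dominated by the full-line density of [u]. If the integral of the latter is not 0 it is
    [+oo], and so is that of the derivative, a lower bound for those of [dG] and [dC]. *)
Lemma full_line_energy : rad = +oo -> V_at V +oo = +oo ->
  sphere_int dF = 0 \/ (sphere_int dG = +oo /\ sphere_int dC = +oo).
Proof.
move=> radoo Voo.
have mA : measurable_fun setT (fun z : T2 => u z.2) := measurable_test2 adm.
have mB := measurable_dirder adm.
have mono (F G : T2 -> \bar R) : measurable_fun setT F -> measurable_fun setT G -> (forall z, 0 <= F z) ->
    (forall z, 0 <= G z) -> (forall z, good z -> F z <= G z) -> sphere_int F <= sphere_int G.
  move=> mF mG F0 G0 FG; apply: ge0_le_integral => //.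
  - exact: measurable_unit_sphere.
  - by move=> nu _; exact: slice_int_ge0.
  - by apply: measurable_funTS; exact: (measurable_slice_int adm).
  - by apply: measurable_funTS; exact: (measurable_slice_int adm).
  move=> nu _; apply: ge0_le_integral => //.
  - by move=> x _; exact: mask_ge0.
  - by apply: measurable_slice; apply: (measurable_mask adm).
  - by apply: measurable_slice; apply: (measurable_mask adm).
  by move=> x _; rewrite !patchE; case: ifPn => //; rewrite inE => gx; exact: FG.
have [e0|eoo] := sphere_int_full_density mA radoo.
  left; apply/eqP; rewrite eq_le -{1}e0 sphere_int_ge0 ?andbT; last exact: dF_ge0 adm.
  apply: mono; [exact: measurable_dF adm|exact: measurable_full_density|exact: dF_ge0 adm|exact: full_density_ge0|].
  move=> [nu x] gz; rewrite full_densityE// /dF /ext /= radoo eqxx; case: ifPn => _.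
    by rewrite lee_wpmul2r ?leey// lee_fin powR_ge0.
  by rewrite patchE; case: ifP => _; rewrite mul0e.
right.
have Boo : sphere_int (full_density (fun z => dirder u z.1 z.2)) = +oo.
  rewrite -eoo; apply: eq_integral => nu; rewrite inE => /unit_sphere_edot nu1.
  by rewrite full_line_densities.
split; apply/eqP; rewrite -leye_eq -Boo.
  apply: mono; [exact: measurable_full_density|exact: measurable_dG adm|exact: full_density_ge0|exact: dG_ge0 adm|].
  move=> [nu x] gz; rewrite full_densityE//; case: ifPn => [/eqP /= roo|_]; last exact: (dG_ge0 adm (nu, x)).
  by rewrite /dG -[rho _ _ _]/(rho Omega nu x) roo /ext radoo !eqxx Voo.
apply: mono; [exact: measurable_full_density|exact: measurable_dC adm|exact: full_density_ge0|exact: dC_ge0 adm|].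
move=> [nu x] gz; rewrite full_densityE//; case: ifPn => [/eqP /= roo|_]; last exact: (dC_ge0 adm (nu, x)).
have [bE aE] : rhop Omega nu x = +oo /\ rhop Omega (- nu)%R x = +oo.
  exact: rho_pinfty.
rewrite /dC -[rho _ _ _]/(rho Omega nu x) roo /ext radoo !eqxx Voo /orient /= aE bE ltxx !mul0r subr0 Cp_id//.
Qed.

(** * Cancellation in the extended reals *)

Variables (VM : 'rV[R]_n -> \bar R) (mu : 'rV[R]_n -> {measure set 'rV[R]_n -> \bar R}).
Hypothesis n0 : (0 < n)%N.
Hypothesis hVM : is_V_mean Omega p V VM.
Hypothesis hmu : forall nu, unit_sphere nu -> skeletal_measure Omega nu (mu nu).
Local Notation grad := (gradient_energy Omega p VM u).
Local Notation pot := (potential_energy Omega p W u).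
Local Notation skt := (skeletal_term Omega p V phi u mu).
Local Notation cpt := (Cp_term Omega p V phi u).

Let Sp0 : 0 <= sphere_int (dS skelp).
Proof. by apply: sphere_int_ge0; exact: dSp_ge0. Qed.
Let Sn0 : 0 <= sphere_int (dS skeln).
Proof. by apply: sphere_int_ge0; exact: dSn_ge0. Qed.
Let G0 : 0 <= sphere_int dG.
Proof. by apply: sphere_int_ge0; exact: dG_ge0 adm. Qed.
Let P0 : 0 <= sphere_int dP.
Proof. by apply: sphere_int_ge0; exact: dP_ge0 adm. Qed.
Let F0 : 0 <= sphere_int dF.
Proof. by apply: sphere_int_ge0; exact: dF_ge0 adm. Qed.
Let C0 : 0 <= sphere_int dC.
Proof. by apply: sphere_int_ge0; exact: dC_ge0 adm. Qed.

Lemma sphere_int_eq0 (F : T2 -> \bar R) : (forall z, F z = 0) ->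
  (forall nu, slice_int F nu = 0) /\ sphere_int F = 0.
Proof.
move=> F00; have s0 nu : slice_int F nu = 0.
  rewrite /slice_int (eq_integral (cst 0)) ?integral0// => x _.
  by rewrite patchE F00; case: ifP.
by split => //; rewrite /sphere_int (eq_integral (cst 0)) ?integral0.
Qed.

Section increasing.
Hypothesis incr : forall r s, I r -> I s -> (r <= s)%R -> (phi r <= phi s)%R.

Lemma dSn_increasing z : dS skeln z = 0.
Proof.
rewrite /dS /mid_density; case: ifP => // _.
suff -> : skel_fun p rad Omega u skeln z.1 (seg_mid Omega z.1 z.2) = 0%R by rewrite mul0r.
rewrite /skel_fun patchE; case: ifPn => [|_]; last by rewrite mul0r.
rewrite inE => Ir; rewrite /skeln max_r ?mul0r// oppr_le0.
exact: (increasing_skel_ge0 (adm_pos adm) (adm_sol adm) incr Ir).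
Qed.

Lemma dF_increasing z : dF z = 0.
Proof.
rewrite /dF /ext; case: eqP => _; last by rewrite patchE; case: ifP => _; rewrite mul0e.
case: eqP => [radoo|_]; last by rewrite mul0e.
by rewrite (W_at_pinfty_increasing p1 (adm_pos adm) (adm_V adm) (adm_W adm) (adm_sol adm) incr radoo) mul0e.
Qed.

Lemma energy_increasing :
  [/\ grad - pot = skt + cpt, 0 <= grad - pot & pot <= grad].
Proof.
have [sn0 Sn00] := sphere_int_eq0 dSn_increasing.
have [_ F00] := sphere_int_eq0 dF_increasing.
have sk : skt = 2%:E * sphere_int (dS skelp).
  rewrite /skeletal_term (skeletal_meanE hmu); congr (_ * _).
  by apply: eq_integral => nu _; rewrite sn0 sube0.
have potE : pot = sphere_int dP by rewrite potential_energyE F00 adde0.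
have gradE : grad = sphere_int dG by exact: gradient_energyE.
have cE : cpt = sphere_int dC by exact: Cp_termE.
have Pfin : sphere_int dP < +oo := potential_finite incr.
have S20 : 0 <= 2%:E * sphere_int (dS skelp) by exact: (mule_ge0 _ Sp0).
have id := etrans (esym (addeM0 _ 2%:E Sn00)) (sphere_identity adm).
have E : grad - pot = skt + cpt.
  rewrite gradE potE sk cE; exact: (sube_sum_fin P0 Pfin S20 C0 id).
have d0 : 0 <= grad - pot by rewrite E sk cE; exact: (adde_ge0 S20 C0).
have potfin : pot \is a fin_num by rewrite potE (ge0_fin_numE P0).
split; [exact: E|exact: d0|].
by move: d0; rewrite sube_ge0// potfin ?orbT.
Qed.

End increasing.

Section not_increasing.
Hypothesis nincr : ~ (forall r s, I r -> I s -> (r <= s)%R -> (phi r <= phi s)%R).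

Lemma skeletal_not_increasing : sphere_int (dS skelp) < +oo /\
  skt = 2%:E * sphere_int (dS skelp) - 2%:E * sphere_int (dS skeln).
Proof.
have [B SB] := skelp_slice_bound nincr.
have mSp := measurable_dSp adm; have mSn := measurable_dSn adm.
have mS := @measurable_unit_sphere R n.
have Spfin : sphere_int (dS skelp) < +oo := slice_bound mSp (@dSp_ge0 _ _ _ _ _ _ _ _) SB.
split; first exact: Spfin.
have Spf : sphere_int (dS skelp) \is a fin_num by rewrite (ge0_fin_numE Sp0).
rewrite -(twice_sube Spf Sn0).
rewrite /skeletal_term (skeletal_meanE hmu); congr (_ * _).
pose f := slice_int (dS skelp) \_ unit_sphere; pose g := slice_int (dS skeln) \_ unit_sphere.
have fp nu : 0 <= slice_int (dS skelp) nu by apply: slice_int_ge0; exact: dSp_ge0.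
have gp nu : 0 <= slice_int (dS skeln) nu by apply: slice_int_ge0; exact: dSn_ge0.
have mfp : measurable_fun setT (slice_int (dS skelp)).
  by apply: (measurable_slice_int adm) => //; exact: dSp_ge0.
have mgp : measurable_fun setT (slice_int (dS skeln)).
  by apply: (measurable_slice_int adm) => //; exact: dSn_ge0.
have mf : measurable_fun setT f.
  by apply/(measurable_restrictT _ _).1 => //; exact: measurable_funTS.
have mg : measurable_fun setT g.
  by apply/(measurable_restrictT _ _).1 => //; exact: measurable_funTS.
have f0 nu : 0 <= f nu by rewrite /f patchE; case: ifP.
have g0 nu : 0 <= g nu by rewrite /g patchE; case: ifP.
have ff nu : f nu \is a fin_num.
  rewrite (ge0_fin_numE (f0 nu)) /f patchE; case: ifPn => nuS; last exact: (ltry 0%R).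
  by rewrite inE in nuS; apply: le_lt_trans (SB nu nuS) _; exact: ltry.
have fE : sphere_int (dS skelp) = \int[sig]_nu f nu by exact: integral_mkcond.
have gE : sphere_int (dS skeln) = \int[sig]_nu g nu by exact: integral_mkcond.
have foo : \int[sig]_nu f nu < +oo by rewrite -fE.
rewrite fE gE; transitivity (\int[sig]_nu (f nu - g nu)); last exact: (integralB_ge0 mf mg f0 ff g0 foo).
transitivity (\int[sig]_nu ((fun nu => slice_int (dS skelp) nu - slice_int (dS skeln) nu) \_ unit_sphere) nu).
  exact: integral_mkcond.
apply: eq_integral => nu _.
by rewrite /f /g !patchE; case: ifP => // _; rewrite sube0.
Qed.

(** Either full lines contribute nothing to the potential, and the finite positive skeletal part is
    moved across, or the gradient and [C_p] integrals are infinite, and both sides are [+oo] as soon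
    as they are defined. *)
Lemma energy_not_increasing : adde_def grad (- pot) -> adde_def skt cpt -> grad - pot = skt + cpt.
Proof.
have [Spfin sk] := skeletal_not_increasing.
have potE : pot = sphere_int dP + sphere_int dF by rewrite potential_energyE.
have gradE : grad = sphere_int dG by exact: gradient_energyE.
have cE : cpt = sphere_int dC by exact: Cp_termE.
have id := sphere_identity adm.
have Sp20 : 0 <= 2%:E * sphere_int (dS skelp) by exact: (mule_ge0 _ Sp0).
have Sn20 : 0 <= 2%:E * sphere_int (dS skeln) by exact: (mule_ge0 _ Sn0).
have Sp2 : 2%:E * sphere_int (dS skelp) < +oo by apply: lte_mul_pinfty => //; exact: Spfin.
have [F00|[Goo Coo]] : sphere_int dF = 0 \/ (sphere_int dG = +oo /\ sphere_int dC = +oo).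
  have [radoo|nradoo] := eqVneq rad +oo.
    apply: (full_line_energy radoo).
    exact: (V_at_pinfty_not_increasing p1 (adm_pos adm) (adm_sol adm) nincr radoo).
  left; apply: (sphere_int_eq0 _).2 => z; rewrite /dF /ext (negbTE nradoo).
  by case: ifP => _; rewrite ?patchE; try case: ifP => _; rewrite mul0e.
- rewrite gradE (etrans potE (adde_r0 _ F00)) sk cE; exact: (sube_sum_def G0 P0 Sp20 Sn20 C0 Sp2 id).
rewrite gradE potE sk cE Goo Coo; exact: (sube_sum_pinfty (adde_ge0 P0 F0) Sp20 Sn20 Sp2).
Qed.

End not_increasing.

End energies.

(** If [phi] is increasing, the potential energy is finite and both terms on the right are
    nonnegative, so the two sums are unambiguous. Otherwise [adde_def] excludes opposite infinities,
    whose sum the extended reals fix by convention. *)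
Theorem theorem2 (R : realType) (N : nat) (p : R) (Omega : set 'rV[R]_N)
    (rad : \bar R) (V W phi : R -> R) (VM : 'rV[R]_N -> \bar R)
    (mu : 'rV[R]_N -> {measure set 'rV[R]_N -> \bar R})
    (hN : (2 <= N)%N) (hp : 1 < p)
    (hdom : domain Omega) (hproper : Omega <> setT)
    (hrad : (0 < rad)%E)
    (hpair : bessel_pair p rad V W)
    (hphi : positive_solution p rad V W phi)
    (hdiam : (2^-1%:E * essential_diameter Omega < rad)%E \/
             (essential_diameter Omega = +oo%E /\ rad = +oo%E))
    (hVM : is_V_mean Omega p V VM)
    (hmu : forall nu, unit_sphere nu -> skeletal_measure Omega nu (mu nu)) :
  let increasing := forall r s, in_interval rad r -> in_interval rad s ->
    r <= s -> phi r <= phi s in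
  (increasing -> forall u, test_function Omega u ->
     (0 <= delta_M Omega p VM W u)%E /\
     (potential_energy Omega p W u <= gradient_energy Omega p VM u)%E) /\
  (forall u, test_function Omega u ->
     increasing \/
       adde_def (gradient_energy Omega p VM u) (- potential_energy Omega p W u)%E /\
       adde_def (skeletal_term Omega p V phi u mu) (Cp_term Omega p V phi u) ->
     delta_M Omega p VM W u =
       (skeletal_term Omega p V phi u mu + Cp_term Omega p V phi u)%E).
Proof.
move=> increasing; have [oOmega _ _] := hdom; have [VW0 VC1 WC1 _] := hpair.
have [d [d0 Dd drad]] : exists d : \bar R, [/\ (0 <= d)%E,
    (2^-1%:E * essential_diameter Omega <= d)%E & (d < rad)%E \/ (rad = +oo%E /\ d = +oo%E)].
  case: hdiam => [h|[h1 h2]]; last by exists +oo%E; split; rewrite ?leey//; right.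
  (* The maximum with 0 secures [0 <= d] whatever the sign of the essential supremum, and [hrad]
     keeps it below [rad]. *)
  exists (maxe 0 (2^-1%:E * essential_diameter Omega))%E; split.
  - by rewrite le_max lexx.
  - by rewrite le_max lexx orbT.
  - by left; rewrite gt_max hrad h.
have bad0 := bad_null oOmega d0 Dd.
have N0 : (0 < N)%N by exact: leq_trans hN.
have adm u (tu : test_function Omega u) : admissible p rad V W phi Omega d u by split.
split=> [incr u tu|u tu].
  by have [_ h1 h2] := energy_increasing (adm u tu) bad0 N0 hVM hmu incr.
have [incr _|nincr] := pselect increasing.
  by have [h _ _] := energy_increasing (adm u tu) bad0 N0 hVM hmu incr.
case=> [//|[h1 h2]].
exact: (energy_not_increasing (adm u tu) bad0 N0 hVM hmu nincr h1 h2).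
Qed.
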